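(* Let $1\le p<\infty$ and let $(X,d,\mathfrak m)$ be a metric measure space such that $(X,d)$ is complete. Then $$H^{1,p}_{\mathscr C}(X)=H^{1,p}_{\mathrm{AGS}}(X)=H^{1,p}_{\mathrm{curve}}(X)$$ and $$\|u\|_{H^{1,p}_{\mathscr C}(X)}=\|u\|_{H^{1,p}_{\mathrm{AGS}}(X)}=\|u\|_{H^{1,p}_{\mathrm{curve}}(X)}\qquad\text{for every }u\in L^p(X).$$
   Context: A metric measure space $(X,d,\mathfrak m)$ is a separable metric space $(X,d)$ (not necessarily complete) with a non-trivial outer measure $\mathfrak m$ which is Radon and finite on bounded sets. $\mathcal L^p(X)$ is the space of functions $u:X\to\mathbb R$ with $\int|u|^p\,d\mathfrak m<\infty$ and $L^p(X)$ is its quotient by $\mathfrak m$-a.e. equality. $\mathrm{Lip}(X)$ is the set of Lipschitz functions $X\to\mathbb R$. Relaxation. For a functional $F:\mathcal L^p(X)\to[0,+\infty]$ set $\tilde F(u):=\inf\{\liminf_{j\to\infty}F(u_j): u_j\to u \text{ in } L^p(X)\}$; it depends only on the class of $u$ in $L^p(X)$. The associated space is $H=\{u\in L^p(X):\tilde F(u)<+\infty\}$ with norm given by $\|u\|_{H}^p:=\|u\|_{L^p(X)}^p+\tilde F(u)^p$ (for $u\in L^p(X)$ outside $H$ this is $+\infty$). Curves. A curve is a continuous map $\gamma:[a,b]\to X$, $\alpha(\gamma)=\gamma(a)$, $\omega(\gamma)=\gamma(b)$; it is rectifiable if its length $\ell(\gamma)$ is finite. For Borel $g:X\to[0,+\infty]$,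 $\int_\gamma g:=\int_0^{\ell(\gamma)}g(\gamma'(t))\,dt$ where $\gamma'$ is the arc-length reparametrization of $\gamma$. For Borel $u$, a Borel function $g:X\to[0,+\infty]$ is an upper gradient of $u$, $g\in \mathrm{UG}(u)$, if $|u(\omega(\gamma))-u(\alpha(\gamma))|\le\int_\gamma g$ for every rectifiable curve $\gamma$. Chains. For $\varepsilon>0$, an $\varepsilon$-chain is a finite sequence of points $c=\{q_i\}_{i=0}^N$ of $X$ with $d(q_i,q_{i+1})\le\varepsilon$ for all $i$; $\alpha(c)=q_0$, $\omega(c)=q_N$. For $g:X\to[0,+\infty]$, $\int_c g:=\sum_{i=0}^{N-1}\frac{g(q_i)+g(q_{i+1})}{2}d(q_i,q_{i+1})$ (with $0\cdot\infty=0$). A Borel function $g:X\to[0,+\infty]$ is an $\varepsilon$-upper gradient of $u:X\to\mathbb R$, $g\in\mathrm{UG}^\varepsilon(u)$, if $|u(\omega(c))-u(\alpha(c))|\le\int_c g$ for every $\varepsilon$-chain $c$. Local Lipschitz constant. $\mathrm{lip}\,u(x):=\lim_{\varepsilon\to0}\sup_{y\in B_\varepsilon(x),\,y\ne x}\frac{|u(y)-u(x)|}{d(x,y)}$ (equal to $0$ at isolated points). The spaces. With $\inf\emptyset=+\infty$, define on $\mathcal L^p(X)$: - $F_{\mathscr C}(u):=\lim_{\varepsilon\to0}\inf\{\|g\|_{L^p(X)}:g\in\mathrm{UG}^\varepsilon(u)\}$; - $F_{\mathrm{AGS}}(u):=\|\mathrm{lip}\,u\|_{L^p(X)}$ if $u\in\mathrm{Lip}(X)$,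 and $+\infty$ otherwise; - $F_{\mathrm{curve}}(u):=\inf\{\|g\|_{L^p(X)}:g\in\mathrm{UG}(u)\}$. The normed spaces associated by relaxation to these functionals are $H^{1,p}_{\mathscr C}(X)$, $H^{1,p}_{\mathrm{AGS}}(X)$, $H^{1,p}_{\mathrm{curve}}(X)$ respectively. *)

(* Defs.v *)
From HB Require Import structures.
From mathcomp Require Import all_boot all_order all_algebra.
From mathcomp Require Import all_classical all_reals all_analysis measurable_realfun.

Set Implicit Arguments.
Unset Strict Implicit.
Unset Printing Implicit Defensive.

Import Order.TTheory GRing.Theory Num.Theory.
Import numFieldNormedType.Exports.

Local Open Scope classical_set_scope.
Local Open Scope ring_scope.

(* The library's sigma-algebras live on pointed types.  Having a point is no
   restriction here: a space carrying a non-trivial measure is non-empty. *)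
#[short(type="pMetricType")]
HB.structure Definition PointedMetric (K : numDomainType) :=
  {T of Metric K T & Pointed T}.

Section metric_measure_space.
Context {R : realType} (X : pMetricType R).

(* The condition of the mixin [Uniform_isComplete]. *)
Definition complete_space : Prop :=
  forall F : set_system X, ProperFilter F -> cauchy F -> cvg F.

Definition separable_space : Prop := exists2 D : set X, countable D & dense D.

Definition metric_bounded (A : set X) : Prop :=
  exists M : R, forall x y, A x -> A y -> mdist x y <= M.

Local Open Scope ereal_scope.

(* Radon in the sense of outer measures (Federer, Mattila): the outer
   regularity is required of all sets, which includes Borel regularity. *)
Definition radon (m : {outer_measure set X -> \bar R}) : Prop :=
  [/\ forall U : set X, open U -> m.-caratheodory U,
      forall K : set X, compact K -> m K < +oo,
      forall U : set X, open U ->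
        m U = ereal_sup [set m K | K in [set K | compact K /\ K `<=` U]] &
      forall A : set X,
        m A = ereal_inf [set m U | U in [set U | open U /\ A `<=` U]]].

Definition is_metric_measure_space (m : {outer_measure set X -> \bar R}) :=
  [/\ separable_space, 0 < m setT, radon m &
      forall B : set X, metric_bounded B -> m B < +oo].

Definition borel_fun (d : measure_display) (Y : measurableType d)
    (f : X -> Y) : Prop :=
  measurable_fun setT (f : g_sigma_algebraType (@open X) -> Y).

End metric_measure_space.

Section gradients.
Context {R : realType} {X : pMetricType R}.
Local Open Scope ereal_scope.

(* A curve is given by its endpoints a <= b and by a map on R of which only
   the restriction to [a, b] matters. *)
Definition is_curve (a b : R) (c : R -> X) : Prop :=
  (a <= b)%R /\ {within `[a, b], continuous c}.

Definition curve_length (a b : R) (c : R -> X) : \bar R :=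
  ereal_sup [set let q := nth b (a :: s) in
    (\sum_(0 <= i < size s) mdist (c (q i)) (c (q i.+1)))%R%:E
    | s in itv_partition a b].

Definition rectifiable (a b : R) (c : R -> X) : Prop :=
  is_curve a b c /\ curve_length a b c < +oo.

(* The arc-length reparametrization on [0, curve_length a b c]: its value at s
   is c t, for any t such that c has length s on [a, t]; c is constant on
   the set of such t. *)
Definition arclength (a b : R) (c : R -> X) (s : R) : X :=
  c (xget a [set t | `[a, b]%classic t /\ curve_length a t c = s%:E]).

Definition curve_integral (g : X -> \bar R) (a b : R) (c : R -> X) : \bar R :=
  \int[lebesgue_measure]_(s in `[0%R, fine (curve_length a b c)])
    g (arclength a b c s).

Definition UG (u : X -> R) : set (X -> \bar R) :=
  [set g : X -> \bar R | [/\ borel_fun u, borel_fun g, forall x, 0 <= g x &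
    forall a b c, rectifiable a b c ->
      `|u (c b) - u (c a)|%:E <= curve_integral g a b c]].

(* The chain q_0, ..., q_N is given by N and by a sequence q of which only the
   first N + 1 terms matter. *)
Definition is_chain (eps : R) (N : nat) (q : nat -> X) : Prop :=
  forall i, (i < N)%N -> (mdist (q i) (q i.+1) <= eps)%R.

Definition chain_integral (g : X -> \bar R) (N : nat) (q : nat -> X) : \bar R :=
  \sum_(i < N) ((g (q i) + g (q i.+1)) * (2^-1)%:E
                * (mdist (q i) (q i.+1))%:E).

Definition UGeps (eps : R) (u : X -> R) : set (X -> \bar R) :=
  [set g : X -> \bar R | [/\ borel_fun g, forall x, 0 <= g x &
    forall N q, is_chain eps N q ->
      `|u (q N) - u (q 0%N)|%:E <= chain_integral g N q]].

Definition is_lipschitz (u : X -> R) : Prop :=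
  exists L : R, forall x y, (`|u x - u y| <= L * mdist x y)%R.

(* 0 is added so that the supremum over the empty set is 0, not -oo. *)
Definition slope_sup (u : X -> R) (x : X) (eps : R) : \bar R :=
  ereal_sup (0 |` [set (`|u y - u x| / mdist x y)%:E
                  | y in [set y | ball x eps y /\ y <> x]]).

Definition lip (u : X -> R) (x : X) : \bar R :=
  lim (slope_sup u x eps @[eps --> 0%R^'+]).

End gradients.

Section sobolev_spaces.
Context {R : realType} {X : pMetricType R}.
Variables (m : {outer_measure set X -> \bar R}) (p : R).
Local Open Scope ereal_scope.

(* m as a measure on its Caratheodory-measurable sets. *)
Definition cara_measure : {measure set (caratheodory_type m) -> \bar R} :=
  (m : set (caratheodory_type m) -> \bar R).

Definition Lpnorm (g : X -> \bar R) : \bar R := 'N[cara_measure]_p%:E[g].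

Definition F_chain (u : X -> R) : \bar R :=
  lim (ereal_inf [set Lpnorm g | g in UGeps eps u] @[eps --> 0%R^'+]).

Definition F_AGS (u : X -> R) : \bar R :=
  if `[< is_lipschitz u >] then Lpnorm (lip u) else +oo.

Definition F_curve (u : X -> R) : \bar R :=
  ereal_inf [set Lpnorm g | g in UG u].

Variable p1 : 1 <= p%:E.

Definition relaxation (F : (X -> R) -> \bar R) (u : LspaceType cara_measure p1)
    : \bar R :=
  ereal_inf [set limn_einf (fun j => F (u_ j)) |
    u_ in [set u_ : nat -> LfunType cara_measure p1 |
           Lpnorm (fun x => (u_ j x - u x)%:E) @[j --> \oo] --> 0]].

Definition Hspace (F : (X -> R) -> \bar R) : set (LspaceType cara_measure p1) :=
  [set u | relaxation F u < +oo].

Definition Hnorm (F : (X -> R) -> \bar R) (u : LspaceType cara_measure p1)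
    : \bar R :=
  (Lpnorm (EFin \o u) `^ p + relaxation F u `^ p) `^ p^-1.

End sobolev_spaces.

Arguments Hspace {R X} m {p} p1 F.
Arguments Hnorm {R X} m {p} p1 F u.

(* Main.v *)
From mathcomp Require Import all_boot all_order all_algebra.
From mathcomp Require Import all_classical all_reals all_analysis measurable_realfun.
From mathcomp Require Import lra.
Require Import Defs.

(** The three spaces agree because their relaxed functionals agree, and by
    [le_relaxation] a relaxed functional is at most another one as soon as every
    function of finite second energy is an [L^p]-limit of functions whose first
    energy is almost as small.

    Two of the comparisons with the Lipschitz functional are soft. The local
    Lipschitz constant of a Lipschitz function is an upper gradient ([lip_UG]), and
    the slopes at a fixed scale are chain upper gradients ([slope_sup_UGeps]) which,
    for a function cut off at a large distance, decrease to the local Lipschitz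
    constant under an integrable bound ([F_chain_cut_le]).

    The converse comparisons both follow from the density of Lipschitz functions in
    energy ([density_in_energy]): if the oscillation of [u] along every rectifiable
    curve whose end points have [g] finite is at most the integral of [g], then [u]
    is an [L^p]-limit of Lipschitz functions with local Lipschitz constant almost
    bounded in norm by [g]. A chain upper gradient satisfies this hypothesis
    ([UGeps_curve_le]): the chains of equally spaced points along the curve have, on
    average over the position of the first point, the integral of [g] as their cost.

    The Lipschitz functions are obtained by minimizing over chains. Let [K] be a
    compact set of almost full measure in a large ball. The function [g] is replaced
    by a lower semicontinuous majorant which is nearly as small in norm, is bounded
    away from zero, and takes large values off suitable compact sets and off the
    ball ([exists_weights]); it is an increasing limit of Lipschitz weights. The
    least value, over chains of mesh at most [1 / (n + 1)] from [K] to [x], of [u] at the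
    start plus the cost of the chain for the [n]-th weight is a Lipschitz function
    of [x] whose local Lipschitz constant is at most that weight ([lip_chain_inf]).
    It is at most [u] on [K], and it converges to [u] there
    ([chain_inf_cvg_lower]): otherwise there would be chains of bounded cost, hence
    of bounded length and close to compact sets, ending at the same point and with
    a cost too small for the difference of [u] between their ends. By completeness
    such chains converge along an ultrafilter to a rectifiable curve
    ([limit_curve]), along which the integral of [g] would be smaller than the
    oscillation of [u]. *)

Set Implicit Arguments.
Unset Strict Implicit.
Unset Printing Implicit Defensive.

Import Order.TTheory GRing.Theory Num.Theory.
Import numFieldNormedType.Exports.

Local Open Scope classical_set_scope.
Local Open Scope ring_scope.

(** * Lp norms of extended real functions *)

Section Lnorm_tools.
Context d (T : measurableType d) (R : realType).
Variables (mu : {measure set T -> \bar R}) (p : R).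
Hypothesis p1 : 1 <= p.
Local Open Scope ereal_scope.
Implicit Types f g h : T -> \bar R.

Local Notation N := (Lnorm mu p%:E).

Let p0 : (0 < p)%R. Proof. exact: lt_le_trans p1. Qed.

Let pn0 : p != 0%R. Proof. by rewrite gt_eqF. Qed.

Let pV0 : (0 <= p^-1)%R. Proof. by rewrite invr_ge0 ltW. Qed.

Lemma le_poweR (x y : \bar R) (r : R) : (0 <= r)%R -> 0 <= x -> x <= y ->
  x `^ r <= y `^ r.
Proof.
move=> r0 x0 xy; apply: gt0_ler_poweR => //; rewrite in_itv/= ?x0 ?leey//.
by rewrite (le_trans x0 xy).
Qed.

Lemma measurable_abse_poweR f : measurable_fun setT f ->
  measurable_fun setT (fun x => `|f x| `^ p).
Proof.
move=> mf; apply: (measurableT_comp (measurable_poweR p)).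
exact: measurableT_comp.
Qed.

Lemma LnormE f : N f = (\int[mu]_x `|f x| `^ p) `^ p^-1.
Proof. by rewrite unlock. Qed.

Lemma le_Lnorm f g : measurable_fun setT f -> measurable_fun setT g ->
  (forall x, `|f x| <= `|g x|) -> N f <= N g.
Proof.
move=> mf mg fg; rewrite !LnormE; apply: le_poweR => //.
  by apply: integral_ge0 => x _; exact: poweR_ge0.
apply: ge0_le_integral => //.
- by move=> x _; exact: poweR_ge0.
- exact: measurable_abse_poweR.
- exact: measurable_abse_poweR.
- by move=> x _; apply: le_poweR => //; exact: ltW.
Qed.

Lemma Lnorm_le_integral f (e : R) : (0 <= e)%R ->
  \int[mu]_x `|f x| `^ p <= (e `^ p)%:E -> N f <= e%:E.
Proof.
move=> e0 h; rewrite LnormE.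
apply: (@le_trans _ _ ((e `^ p)%:E `^ p^-1)).
  by apply: le_poweR => //; apply: integral_ge0 => x _; exact: poweR_ge0.
by rewrite poweR_EFin -powRrM mulfV// powRr1.
Qed.

Lemma Lnorm_lty_integral f : N f < +oo -> \int[mu]_x `|f x| `^ p < +oo.
Proof. by move=> h; rewrite -(poweR_Lnorm _ _ pn0) poweR_lty. Qed.

Lemma Lnorm_lty_ae_fin f : measurable_fun setT f -> N f < +oo ->
  {ae mu, forall x, setT x -> f x \is a fin_num}.
Proof.
move=> mf /Lnorm_lty_integral h.
have : mu.-integrable setT (fun x => `|f x| `^ p).
  apply/integrableP; split; first exact: measurable_abse_poweR.
  by under eq_integral do rewrite gee0_abs ?poweR_ge0//.
move=> /(integrable_ae measurableT); apply: filterS => x /(_ I) h' _.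
by case: (f x) h' => //; rewrite /abse poweRyr.
Qed.

Lemma ae_eq_Lnorm f g : measurable_fun setT f -> measurable_fun setT g ->
  ae_eq mu setT f g -> N f = N g.
Proof.
move=> mf mg fg; rewrite !LnormE; congr (_ `^ _).
apply: ge0_ae_eq_integral => //.
- exact: measurable_abse_poweR.
- exact: measurable_abse_poweR.
- by move=> x _; exact: poweR_ge0.
- by move=> x _; exact: poweR_ge0.
- by apply: filterS fg => x + _ => /(_ I) ->.
Qed.

(** A function of finite norm is finite almost everywhere, which reduces the
    inequality to real-valued functions. *)
Lemma ge0_minkowski f g : measurable_fun setT f -> measurable_fun setT g ->
  (forall x, 0 <= f x) -> (forall x, 0 <= g x) ->
  N (fun x => f x + g x) <= N f + N g.
Proof.
move=> mf mg f0 g0.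
have [->|Nf] := eqVneq (N f) +oo.
  by rewrite addye ?leey// -ltNye (lt_le_trans _ (Lnorm_ge0 _ _ _)).
have [->|Ng] := eqVneq (N g) +oo.
  by rewrite addey ?leey// -ltNye (lt_le_trans _ (Lnorm_ge0 _ _ _)).
have af := Lnorm_lty_ae_fin mf; rewrite ltey in af; have {}af := af Nf.
have ag := Lnorm_lty_ae_fin mg; rewrite ltey in ag; have {}ag := ag Ng.
have mff : measurable_fun setT (fine \o f) by exact: measurableT_comp.
have mfg : measurable_fun setT (fine \o g) by exact: measurableT_comp.
rewrite (@ae_eq_Lnorm f (EFin \o (fine \o f)))//; last 2 first.
- exact/measurable_EFinP.
- by apply: filterS af => x + _ /= => /(_ I) /fineK ->.
rewrite (@ae_eq_Lnorm g (EFin \o (fine \o g)))//; last 2 first.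
- exact/measurable_EFinP.
- by apply: filterS ag => x + _ /= => /(_ I) /fineK ->.
rewrite (@ae_eq_Lnorm _ (EFin \o ((fine \o f) \+ (fine \o g))%R))//; last 3 first.
- exact: emeasurable_funD.
- by apply/measurable_EFinP; exact: measurable_funD.
- move: af ag; apply: filterS2 => x fx gx _ /=.
  by rewrite EFinD !fineK ?fx ?gx.
exact: minkowski_EFin.
Qed.

Lemma Lnorm_dominated_cvg (f_ : nat -> T -> R) (g : T -> \bar R) :
  (forall n, measurable_fun setT (f_ n)) -> measurable_fun setT g ->
  (forall n x, `|f_ n x|%:E <= g x) -> N g < +oo ->
  (forall x, f_ ^~ x @ \oo --> 0%R) ->
  forall e : R, (0 < e)%R -> \forall n \near \oo, N (EFin \o f_ n) <= e%:E.
Proof.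
move=> mf mg fg Ng f0 e e0.
have g0 x : 0 <= g x by apply: le_trans (fg 0%N x); rewrite lee_fin.
pose F n x := (`|f_ n x| `^ p)%R%:E.
have mF n : measurable_fun setT (F n).
  have /measurable_abse_poweR : measurable_fun setT (EFin \o f_ n).
    exact/measurable_EFinP.
  by [].
have [] := @dominated_convergence _ T R mu setT measurableT F (cst 0)
  (fun x => g x `^ p) mF (measurable_cst _).
- apply: aeW => x _; rewrite /F /=.
  apply: cvg_EFin; first by apply: nearW.
  rewrite /comp/=; apply/cvgrPdist_lt => /= r r0.
  have := f0 x => /cvgrPdist_lt /(_ (r `^ p^-1)%R).
  rewrite powR_gt0// => /(_ isT); apply: filterS => n.
  rewrite !sub0r !normrN => h.
  rewrite ger0_norm ?powR_ge0//.
  have := @gt0_ltr_powR _ p p0 `|f_ n x|%R (r `^ p^-1)%R.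
  rewrite !nnegrE normr_ge0 powR_ge0 => /(_ isT isT h).
  by rewrite -powRrM mulVf// powRr1// ltW.
- apply/integrableP; split.
    by apply: (measurableT_comp (measurable_poweR p)).
  rewrite (eq_integral (fun x => `|g x| `^ p)); first exact: Lnorm_lty_integral.
  by move=> x _; rewrite gee0_abs ?poweR_ge0// gee0_abs.
- apply: aeW => x n _; rewrite gee0_abs ?lee_fin ?powR_ge0//.
  by rewrite /F -poweR_EFin; apply: le_poweR => //; exact: ltW.
move=> _ _; rewrite integral0 => /fine_cvgP[finF /cvgrPdist_lt].
move=> /(_ (e `^ p)%R); rewrite powR_gt0// => /(_ isT).
apply: filterS2 finF => n finn; rewrite /= sub0r normrN => h.
apply: Lnorm_le_integral; first exact: ltW.
have -> : \int[mu]_x `|(EFin \o f_ n) x| `^ p = \int[mu]_x F n x.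
  exact: eq_integral.
rewrite -[X in X <= _]fineK// lee_fin ltW//.
by apply: le_lt_trans h; rewrite ler_norm.
Qed.

End Lnorm_tools.

(** * Borel functions and regularity of the measure *)

Section borel.
Context {R : realType} {X : pMetricType R}.

Lemma lsc_borel (f : X -> \bar R) :
  (forall r : R, open [set x | (r%:E < f x)%E]) -> borel_fun f.
Proof.
move=> of_; rewrite /borel_fun.
apply: (measurability _ (ErealGenOInfty.measurableE R)).
move=> /= _ [_ [r ->]] <-; rewrite setTI; apply: sub_sigma_algebra.
have := of_ r; congr open; apply/seteqP; split => x /=; by rewrite in_itv/= andbT.
Qed.

Lemma continuous_borel (f : X -> R) : continuous f -> borel_fun f.
Proof.
move=> cf; apply/measurable_EFinP; apply: lsc_borel => r /=.
rewrite (_ : [set x | _] = f @^-1` [set y | r < y]).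
  by apply: open_comp => //; exact: open_gt.
by apply/seteqP; split => x /=; rewrite lte_fin.
Qed.

Lemma lipschitz_continuous (f : X -> R) : is_lipschitz f -> continuous f.
Proof.
move=> [L Lf] x; apply/cvgrPdist_lt => e e0.
have L1 : 0 < Num.max L 1 by rewrite lt_max ltr01 orbT.
apply/nbhs_ballP; exists (e / Num.max L 1); first by rewrite /= divr_gt0.
move=> y; rewrite ballEmdist /= ltr_pdivlMr// mulrC => h.
apply: le_lt_trans (Lf _ _) _; apply: le_lt_trans h.
by rewrite ler_wpM2r ?mdist_ge0// le_max lexx.
Qed.

Lemma lipschitz_borel (f : X -> R) : is_lipschitz f -> borel_fun f.
Proof. by move=> /lipschitz_continuous; exact: continuous_borel. Qed.

Lemma is_lipschitz_pos (f : X -> R) : is_lipschitz f ->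
  exists2 L : R, 0 < L & forall x y, `|f x - f y| <= L * mdist x y.
Proof.
move=> [L Lf]; exists (Num.max L 1); first by rewrite lt_max ltr01 orbT.
move=> x y; apply: le_trans (Lf _ _) _.
by rewrite ler_wpM2r ?mdist_ge0// le_max lexx.
Qed.

End borel.

Section regularity.
Context {R : realType} {X : pMetricType R}.
Variable m : {outer_measure set X -> \bar R}.
Hypothesis Xm : is_metric_measure_space m.
Local Open Scope ereal_scope.

Lemma open_caratheodory (U : set X) : open U -> m.-caratheodory U.
Proof. by case: Xm => _ _ [h _ _ _] _; exact: h. Qed.

Lemma closed_caratheodory (U : set X) : closed U -> m.-caratheodory U.
Proof.
move=> cU; rewrite -(setCK U); apply: caratheodory_measurable_setC.
by apply: open_caratheodory; rewrite openC.
Qed.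

Lemma compact_caratheodory (K : set X) : compact K -> m.-caratheodory K.
Proof.
by move=> cK; apply: closed_caratheodory; apply: compact_closed => //; exact: metric_hausdorff.
Qed.

(** Open sets are Caratheodory measurable because the measure is Radon. *)
Lemma borel_caratheodory d (Y : measurableType d) (f : X -> Y) : borel_fun f ->
  measurable_fun setT (f : caratheodory_type m -> Y).
Proof.
move=> mf _ B mB; rewrite setTI.
have : <<s @open X >> (f @^-1` B) by have := mf measurableT B mB; rewrite setTI.
apply: smallest_sub; last by move=> U; exact: open_caratheodory.
split; first exact: caratheodory_measurable_set0.
- by move=> A mA; rewrite setTD; exact: caratheodory_measurable_setC.
- by move=> F mF; exact: caratheodory_measurable_bigcup.
Qed.

Lemma bounded_finite (A : set X) : metric_bounded A -> m A < +oo.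
Proof. by case: Xm => _ _ _; apply. Qed.

Lemma outer_regular (A : set X) (e : R) : m.-caratheodory A -> m A < +oo ->
  (0 < e)%R -> exists U, [/\ open U, A `<=` U & m (U `\` A) <= e%:E].
Proof.
move=> cA Afin e0.
have Afn : m A \is a fin_num by rewrite ge0_fin_numE// outer_measure_ge0.
have : m A < m A + e%:E by rewrite lteDl// lte_fin.
case: Xm => _ _ [_ _ _ reg] _; rewrite {1}reg => /ereal_inf_lt[_ [U [oU AU] <-]] h.
exists U; split => //; move: h; rewrite (cA U) setIC setIidl// setDE.
by rewrite lteD2lE// => /ltW.
Qed.

(** An open superset [U] of [E] is exhausted by a compact set; removing from the
    latter an open set that barely exceeds [U `\` E] leaves a compact subset of [E]. *)
Lemma inner_regular (E : set X) (e : R) : m.-caratheodory E -> metric_bounded E ->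
  (0 < e)%R -> exists K, [/\ compact K, K `<=` E & m (E `\` K) <= e%:E].
Proof.
move=> cE /bounded_finite Efin e0; have e20 : (0 < e / 2)%R by rewrite divr_gt0.
have [U [oU EU UE]] := outer_regular cE Efin ltr01.
have Ufin : m U < +oo.
  rewrite (cE U) setIC setIidl// lte_add_pinfty//.
  by rewrite -setDE (le_lt_trans UE) ?ltry.
have Ufn : m U \is a fin_num by rewrite ge0_fin_numE// outer_measure_ge0.
have [C [cC CU UC]] : exists C, [/\ compact C, C `<=` U & m (U `\` C) <= (e / 2)%:E].
  have : m U - (e / 2)%:E < m U by rewrite lteBlDr// lteDl// lte_fin.
  case: Xm => _ _ [_ _ reg _] _; rewrite {2}(reg _ oU).
  move=> /ereal_sup_gt[_ [C [cC CU] <-]] h; exists C; split => //.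
  move: h; rewrite {1}(compact_caratheodory cC U) setIC setIidl// -setDE.
  have Cfn : m C \is a fin_num.
    rewrite ge0_fin_numE ?outer_measure_ge0//.
    by apply: le_lt_trans Ufin; exact: le_outer_measure.
  by rewrite lteBlDr// lteD2lE// => /ltW.
have cUE : m.-caratheodory (U `\` E).
  by apply: caratheodory_measurable_setD => //; exact: open_caratheodory.
have UEfin : m (U `\` E) < +oo by rewrite (le_lt_trans UE) ?ltry.
have [V [oV UEV hV]] := outer_regular cUE UEfin e20.
exists (C `\` V); split.
- apply: (@subclosed_compact _ _ C) => //.
    rewrite setDE; apply: closedI.
      by apply: compact_closed => //; exact: metric_hausdorff.
    by rewrite closedC.
- move=> x [Cx Vx]; apply: contrapT => Ex; apply: Vx; apply: UEV; split => //.
  exact: CU.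
- rewrite (splitr e) EFinD; apply: (@le_trans _ _ (m ((U `\` C) `|` (V `\` (U `\` E))))).
    apply: le_outer_measure => x [Ex nK]; have [Cx|Cx] := pselect (C x).
      right; split; last by case.
      by apply: contrapT => Vx; exact: nK.
    by left; split => //; exact: EU.
  by apply: le_trans (outer_measureU2 _ _ _) _; rewrite leeD.
Qed.

Lemma bounded_closed_ball (x0 : X) (r : R) : metric_bounded [set x | mdist x0 x <= r]%R.
Proof.
exists (r + r)%R => x y /= xr yr.
apply: le_trans (metric_triangle x x0 y) _.
by rewrite (metric_sym x x0) lerD.
Qed.

End regularity.

(** * Length of curves *)

Section curves.
Context {R : realType} {X : pMetricType R}.
Implicit Types (c : R -> X) (a b t : R) (s : seq R).

(** The length of the polygonal line through a partition, as a recursion on the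
    partition: cutting a partition at a point is then an induction. *)
Fixpoint inscribed_length c (x : R) s : R :=
  if s is y :: s' then mdist (c x) (c y) + inscribed_length c y s' else 0.

Lemma inscribed_lengthE c a b s :
  \sum_(0 <= i < size s) mdist (c (nth b (a :: s) i)) (c (nth b (a :: s) i.+1))
  = inscribed_length c a s.
Proof.
elim: s a => [|y s ih] a /=; first by rewrite big_nil.
by rewrite big_nat_recl//= -ih.
Qed.

Lemma curve_lengthE c a b : curve_length a b c =
  ereal_sup [set (inscribed_length c a s)%:E | s in itv_partition a b].
Proof.
rewrite /curve_length; congr ereal_sup; apply/seteqP; split => _ [s sP <-];
  by exists s => //=; rewrite ?inscribed_lengthE// -(inscribed_lengthE c a b).
Qed.

Lemma inscribed_length_cat c x s1 s2 : inscribed_length c x (s1 ++ s2) =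
  inscribed_length c x s1 + inscribed_length c (last x s1) s2.
Proof. by elim: s1 x => [|y s1 ih] x /=; rewrite ?add0r// ih addrA. Qed.

(** Adding the point [t] to a partition does not decrease the inscribed length. *)
Lemma inscribed_length_split c a b t s : itv_partition a b s -> a <= t <= b ->
  exists s1 s2, [/\ itv_partition a t s1, itv_partition t b s2 &
    inscribed_length c a s <= inscribed_length c a s1 + inscribed_length c t s2].
Proof.
elim: s a => [|y s ih] a abs /andP[at_ tb].
  have E := itv_partition_nil abs; have ta : t = a.
    by apply/eqP; rewrite eq_le at_ andbT E.
  by exists [::], [::]; rewrite ta E /=; split=> //=; rewrite addr0.
have [ta|nta] := eqVneq t a.
  by exists [::], (y :: s); rewrite ta add0r; split=> //; rewrite /itv_partition /=.
have lat : a < t by rewrite lt_neqAle eq_sym nta.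
have [yt|ty] := leP y t.
  have [s1 [s2 [h1 h2 h3]]] : exists s1 s2, [/\ itv_partition y t s1,
    itv_partition t b s2 & inscribed_length c y s <=
      inscribed_length c y s1 + inscribed_length c t s2].
    by apply: ih; rewrite ?yt//; exact: itv_partition_cons abs.
  exists (y :: s1), s2; split => //=; last by rewrite -addrA lerD2l.
  case: abs => /= /andP[ay _] _; case: h1 => h1 h1'.
  by rewrite /itv_partition /= ay.
exists [:: t], (y :: s); split.
- exact: itv_partition1.
- case: abs => /= /andP[ay ys] lb.
  by rewrite /itv_partition /= ty.
- by rewrite /= addr0 addrA lerD2r metric_triangle.
Qed.

Lemma ge_curve_length c a b (v : \bar R) :
  (forall s, itv_partition a b s -> ((inscribed_length c a s)%:E <= v)%E) ->
  (curve_length a b c <= v)%E.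
Proof.
by move=> h; rewrite curve_lengthE; apply: ge_ereal_sup => _ [s ss <-]; exact: h.
Qed.

Lemma inscribed_le_curve_length c a b s : itv_partition a b s ->
  ((inscribed_length c a s)%:E <= curve_length a b c)%E.
Proof. by move=> h; rewrite curve_lengthE; apply: ereal_sup_ubound; exists s. Qed.

Lemma mdist_le_curve_length c a b : a <= b ->
  ((mdist (c a) (c b))%:E <= curve_length a b c)%E.
Proof.
rewrite le_eqVlt => /predU1P[->|ab].
  by rewrite mdistxx; apply: (@inscribed_le_curve_length c b b [::]); split.
have := @inscribed_le_curve_length c a b [:: b] (itv_partition1 ab).
by rewrite /= addr0.
Qed.

Lemma curve_length_ge0 c a b : a <= b -> (0 <= curve_length a b c)%E.
Proof.
by move=> ab; apply: le_trans (mdist_le_curve_length c ab); rewrite lee_fin mdist_ge0.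
Qed.

Lemma curve_length_fin c a b : a <= b -> (curve_length a b c < +oo)%E ->
  curve_length a b c \is a fin_num.
Proof. by move=> ab h; rewrite ge0_fin_numE// curve_length_ge0. Qed.

Lemma curve_lengthD c a t b : a <= t -> t <= b ->
  (curve_length a b c < +oo)%E ->
  (curve_length a b c = curve_length a t c + curve_length t b c)%E.
Proof.
move=> at_ tb fin; have ab := le_trans at_ tb.
have vE := fineK (curve_length_fin ab fin).
set v := fine _ in vE.
have key s1 s2 : itv_partition a t s1 -> itv_partition t b s2 ->
    inscribed_length c a s1 + inscribed_length c t s2 <= v.
  move=> h1 h2; have := inscribed_le_curve_length c (itv_partition_cat h1 h2).
  rewrite -vE inscribed_length_cat lee_fin.
  by case: h1 => _ /eqP ->.
have key1 s1 : itv_partition a t s1 ->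
    (curve_length t b c <= (v - inscribed_length c a s1)%:E)%E.
  by move=> h1; apply: ge_curve_length => s2 h2; rewrite lee_fin lerBrDl key.
have tbfin : curve_length t b c \is a fin_num.
  rewrite ge0_fin_numE ?curve_length_ge0//.
  have : itv_partition a t (if a == t then [::] else [:: t]).
    have [->|n] := eqVneq a t; first by split.
    by apply: itv_partition1; rewrite lt_neqAle n.
  by move=> /key1 /le_lt_trans; apply; rewrite ltry.
apply/eqP; rewrite eq_le; apply/andP; split.
- apply: ge_curve_length => s hs.
  have [|s1 [s2 [h1 h2 h]]] := @inscribed_length_split c a b t s hs.
    by rewrite at_.
  rewrite (@le_trans _ _ (inscribed_length c a s1 + inscribed_length c t s2)%:E)//.
  by rewrite EFinD leeD// inscribed_le_curve_length.
- rewrite -vE -leeBrDr//; apply: ge_curve_length => s1 /key1.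
  rewrite -(fineK tbfin) !lee_fin => h; lra.
Qed.

Lemma curve_length_lipschitz c a b (K : R) : a <= b ->
  (forall x y, a <= x -> x <= y -> y <= b -> mdist (c x) (c y) <= K * (y - x)) ->
  (curve_length a b c <= (K * (b - a))%:E)%E.
Proof.
move=> ab cK; apply: ge_curve_length => s.
elim: s a ab cK => [|y s ih] a ab cK abs; rewrite lee_fin /=.
  by rewrite (itv_partition_nil abs) subrr mulr0.
have ybs := itv_partition_cons abs.
have ay : a < y by case: abs => /= /andP[].
have yb := itv_partition_le ybs.
have := ih y yb _ ybs; rewrite lee_fin => /(_ _) h.
have h' : inscribed_length c y s <= K * (b - y).
  by apply: h => s0 t0 s0y; apply: cK; rewrite (le_trans (ltW ay)).
by have := cK _ _ (lexx a) (ltW ay) yb; lra.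
Qed.

End curves.

(** * Arc length parametrization *)

Section arclength.
Context {R : realType} {X : pMetricType R}.
Variables (a b : R) (c : R -> X).
Hypothesis rect : rectifiable a b c.

Let ab : a <= b. Proof. by case: rect => -[]. Qed.

Let lenfin : (curve_length a b c < +oo)%E. Proof. by case: rect. Qed.

Lemma curve_continuous_dist t0 (e : R) : a <= t0 <= b -> 0 < e ->
  exists2 d : R, 0 < d & forall t, a <= t <= b -> `|t - t0| < d ->
    mdist (c t0) (c t) < e.
Proof.
move=> t0ab e0; case: rect => -[_ cc] _.
have := cc t0; move=> /(_ _ (nbhsx_ballx (c t0) e e0)).
have t0A : `[a, b]%classic t0 by rewrite /= in_itv.
rewrite /= /nbhs /= -(nbhs_subspace_in t0A) => /nbhs_ballP[d /= d0 h].
exists d => // t tab tt0.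
have : ball t0 d t by rewrite /ball /= distrC.
move=> /h /=; rewrite ballEmdist /=; apply.
by rewrite in_itv.
Qed.

Lemma curve_length_sub s t : a <= s -> s <= t -> t <= b ->
  (curve_length s t c < +oo)%E.
Proof.
move=> as_ st tb.
have h := lenfin; rewrite (curve_lengthD (le_trans as_ st) tb lenfin) in h.
have at_lt : (curve_length a t c < +oo)%E.
  by apply: le_lt_trans h; rewrite leeDl// curve_length_ge0.
have E := curve_lengthD as_ st at_lt.
by apply: le_lt_trans at_lt;
  rewrite E leeDr// curve_length_ge0.
Qed.

Let len t := fine (curve_length a t c).

Lemma fine_curve_lengthE t : a <= t <= b -> curve_length a t c = (len t)%:E.
Proof.
by case/andP => h1 h2; rewrite /len fineK// curve_length_fin// curve_length_sub.
Qed.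

Lemma curve_length_increment s t : a <= s -> s <= t -> t <= b ->
  curve_length s t c = (len t - len s)%:E.
Proof.
move=> as_ st tb.
have E := curve_lengthD as_ st (curve_length_sub (lexx a) (le_trans as_ st) tb).
move: E; rewrite !fine_curve_lengthE ?as_ ?(le_trans st)// ?tb ?(le_trans as_)//.
rewrite -[curve_length s t c]fineK; last first.
  by rewrite curve_length_fin// curve_length_sub.
by rewrite -EFinD => -[->]; rewrite addrAC subrr add0r.
Qed.

Lemma mdist_le_length s t : a <= s -> s <= t -> t <= b ->
  mdist (c s) (c t) <= len t - len s.
Proof.
move=> as_ st tb; rewrite -lee_fin -curve_length_increment//.
exact: mdist_le_curve_length.
Qed.

Lemma length_homo s t : a <= s -> s <= t -> t <= b -> len s <= len t.
Proof.
move=> as_ st tb; rewrite -subr_ge0; apply: le_trans (mdist_le_length as_ st tb).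
exact: mdist_ge0.
Qed.

Lemma length_start : len a = 0.
Proof.
by have := curve_length_increment (lexx a) (lexx a) ab; rewrite subrr /len => ->.
Qed.

Lemma exists_inscribed s t (e : R) : a <= s -> s <= t -> t <= b -> 0 < e ->
  exists2 r, itv_partition s t r & len t - len s - e < inscribed_length c s r.
Proof.
move=> as_ st tb e0.
have : ((len t - len s - e)%:E < curve_length s t c)%E.
  by rewrite curve_length_increment// lte_fin ltrBlDr ltrDl.
by rewrite curve_lengthE => /ereal_sup_gt[_ [r rP <-]]; rewrite lte_fin; exists r.
Qed.

(** A partition of [[t0, b]] that almost attains the length may be cut at any [t] of
    its first interval; when [t] is close to [t0] the piece [[t0, t]] contributes
    little by continuity of the curve, so that almost all the length lies in
    [[t, b]]. *)
Lemma length_right_continuous t0 (e : R) : a <= t0 <= b -> 0 < e ->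
  exists2 d : R, 0 < d & forall t, t0 <= t <= b -> t - t0 < d -> len t - len t0 < e.
Proof.
move=> /andP[at0 t0b] e0; have e20 : 0 < e / 2 by rewrite divr_gt0.
have [E|t0b'] := eqVneq t0 b.
  exists 1 => // t; rewrite E -eq_le => /eqP <- _.
  by rewrite subrr.
have lt0b : t0 < b by rewrite lt_neqAle t0b'.
have [[|y r] hr hlen] := exists_inscribed at0 t0b (lexx b) e20.
  by move: t0b'; rewrite (itv_partition_nil hr) eqxx.
have [|d d0 hd] := @curve_continuous_dist t0 _ _ e20; first by rewrite at0.
have t0y : t0 < y by case: hr => /= /andP[].
have yb : y <= b by apply: itv_partition_le (itv_partition_cons hr).
exists (Num.min d (y - t0)); first by rewrite lt_min d0 subr_gt0.
move=> t /andP[t0t tb]; rewrite lt_min => /andP[td]; rewrite ltrD2r => ty.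
have h1 : mdist (c t0) (c t) < e / 2.
  by apply: hd; rewrite ?tb ?(le_trans at0)//= ger0_norm// subr_ge0.
have h2 : itv_partition t b (y :: r).
  by case: hr => /= /andP[_ yr] l; rewrite /itv_partition /= ty.
have := inscribed_le_curve_length c h2.
rewrite (curve_length_increment (le_trans at0 t0t) tb (lexx b)) lee_fin /=.
move: hlen => /=.
have := metric_triangle (c t0) (c t) (c y).
lra.
Qed.

(** The same argument with the last interval of a partition of [[a, t0]]. *)
Lemma length_left_continuous t0 (e : R) : a <= t0 <= b -> 0 < e ->
  exists2 d : R, 0 < d & forall t, a <= t <= t0 -> t0 - t < d -> len t0 - len t < e.
Proof.
move=> /andP[at0 t0b] e0; have e20 : 0 < e / 2 by rewrite divr_gt0.
have [E|t0a] := eqVneq a t0.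
  exists 1 => // t; rewrite E -eq_le => /eqP <- _.
  by rewrite subrr.
have la : a < t0 by rewrite lt_neqAle t0a.
have [r] := exists_inscribed (lexx a) at0 t0b e20.
case/lastP: r => [|r y] hr hlen.
  by move: t0a; rewrite (itv_partition_nil hr) eqxx.
have yE : y = t0 by case: hr => _; rewrite last_rcons => /eqP.
subst y.
have [|d d0 hd] := @curve_continuous_dist t0 _ _ e20; first by rewrite at0.
set y := last a r.
have yt0 : y < t0 by case: hr => /=; rewrite rcons_path => /andP[].
have ay : itv_partition a y r.
  by case: hr => /=; rewrite rcons_path => /andP[]; split.
exists (Num.min d (t0 - y)); first by rewrite lt_min d0 subr_gt0.
move=> t /andP[at_ tt0]; rewrite lt_min => /andP[td] yt.
have {}yt : y < t by lra.
have h1 : mdist (c t0) (c t) < e / 2.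
  by apply: hd; rewrite ?at_ ?(le_trans tt0)//= distrC ger0_norm// subr_ge0.
have h2 : itv_partition a t (rcons r t).
  rewrite /itv_partition rcons_path last_rcons eqxx; split => //.
  by case: ay => -> _.
have := inscribed_le_curve_length c h2.
rewrite (curve_length_increment (lexx a) at_ (le_trans tt0 t0b)) lee_fin.
move: hlen; rewrite -!cats1 !inscribed_length_cat /= -/y length_start.
have := metric_triangle (c y) (c t) (c t0).
rewrite (metric_sym (c t) (c t0)).
lra.
Qed.

Lemma length_continuous : {within `[a, b], continuous len}.
Proof.
rewrite continuous_subspace_in.
move=> t0 /[dup] t0A'; rewrite inE /= in_itv /= => t0A.
apply/cvgrPdist_lt => e e0.
have [d1 d10 h1] := length_right_continuous t0A e0.
have [d2 d20 h2] := length_left_continuous t0A e0.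
have t0A2 : `[a, b]%classic t0 by rewrite /= in_itv.
rewrite /= /nbhs /= -(nbhs_subspace_in t0A2).
rewrite nearE /=; apply/nbhs_ballP; exists (Num.min d1 d2).
  by rewrite /= lt_min d10.
move=> t; rewrite /ball /= lt_min => /andP[td1 td2]; rewrite /= in_itv/= => /andP[at_ tb].
case/andP: t0A => at0 t0b.
have [t0t|tt0] := leP t0 t.
  have hh := length_homo at0 t0t tb.
  rewrite ler0_norm; last by rewrite subr_le0.
  rewrite opprB; apply: h1; rewrite ?t0t ?tb//.
  by move: td1; rewrite distrC ger0_norm// subr_ge0.
have hh := length_homo at_ (ltW tt0) t0b.
rewrite ger0_norm; last by rewrite subr_ge0.
apply: h2; rewrite ?at_ ?(ltW tt0)//.
by move: td2; rewrite ger0_norm// subr_ge0 ltW.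
Qed.

Lemma length_surjective s : 0 <= s <= len b ->
  exists2 t, a <= t <= b & len t = s.
Proof.
move=> /andP[s0 sl].
have [|t tab <-] := @IVT _ len a b s ab length_continuous.
  by rewrite ge_min le_max length_start s0 sl orbT.
by exists t => //; rewrite in_itv in tab.
Qed.

Lemma length_eq_point s t : a <= s <= b -> a <= t <= b -> len s = len t ->
  c s = c t.
Proof.
wlog st : s t / s <= t => [wlg|].
  have [st|ts] := leP s t; first exact: wlg.
  by move=> sab tab E; apply/esym/wlg => //; exact: ltW.
move=> /andP[as_ _] /andP[_ tb] E; apply: mdist_positivity.
apply/eqP; rewrite eq_le mdist_ge0 andbT.
by apply: le_trans (mdist_le_length as_ st tb) _; rewrite E subrr.
Qed.

(** The curve is constant on the set of parameters of a given length, so the choice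
    made by [arclength] does not matter. *)
Lemma arclength_len t : a <= t <= b -> arclength a b c (len t) = c t.
Proof.
move=> tab; rewrite /arclength.
have [] := @xgetPex _ a
  [set t0 | `[a, b]%classic t0 /\ curve_length a t0 c = (len t)%:E].
  by exists t; split; [rewrite /= in_itv | rewrite fine_curve_lengthE].
set u := xget _ _; rewrite /= in_itv /= => uab.
by rewrite fine_curve_lengthE// => -[]; exact: length_eq_point.
Qed.

Lemma arclength_start : arclength a b c 0 = c a.
Proof. by rewrite -length_start arclength_len// lexx. Qed.

Lemma arclength_end : arclength a b c (len b) = c b.
Proof. by rewrite arclength_len// lexx ab. Qed.

Lemma arclength_lipschitz s t : 0 <= s -> s <= t -> t <= len b ->
  mdist (arclength a b c s) (arclength a b c t) <= t - s.
Proof.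
move=> s0 st tl.
have [|x xab xs] := @length_surjective s; first by rewrite s0 (le_trans st).
have [|y yab yt] := @length_surjective t; first by rewrite tl (le_trans s0).
rewrite -xs -yt !arclength_len//.
have [xy|yx] := leP x y.
  by case/andP: xab => ? _; case/andP: yab => _ ?; exact: mdist_le_length.
have E : len x = len y.
  apply/eqP; rewrite eq_le {1}xs {1}yt st/=.
  case/andP: xab => _ ?; case/andP: yab => ? _.
  by apply: length_homo => //; exact: ltW.
by rewrite (length_eq_point xab yab E) E subrr mdistxx.
Qed.

End arclength.

(** * Averages over equally spaced points *)

Section shift.
Context {R : realType}.
Local Open Scope ereal_scope.
Local Notation mu := (@lebesgue_measure R).

Lemma lebesgue_measure_shift (h : R) (A : set R) : measurable A ->
  pushforward mu ((fun t => t + h)%R : _ -> measurableTypeR R) A = mu A.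
Proof.
have mh : measurable_fun setT (fun t : R => (t + h)%R : measurableTypeR R).
  by apply: measurable_funD => //.
move=> mA; apply/esym.
apply: (@lebesgue_measure_unique _
  (pushforward mu ((fun t => t + h)%R : _ -> measurableTypeR R))) => //= _ [[a b]] _ <-.
rewrite /pushforward /=.
rewrite (_ : _ @^-1` _ = `]a - h, b - h]%classic)%R; last first.
  by apply/seteqP; split => t /=; rewrite !in_itv/= ltrBlDr lerBrDr.
by rewrite !lebesgue_measure_itv/= !lte_fin ltrD2r -!EFinD opprB addrA subrK.
Qed.

Lemma ge0_integral_shift (f : R -> \bar R) (h x y : R) :
  measurable_fun setT f -> (forall t, 0 <= f t) ->
  \int[mu]_(t in `[(x + h)%R, (y + h)%R[) f t =
  \int[mu]_(t in `[x, y[) f (t + h)%R.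
Proof.
move=> mf f0.
have mh : measurable_fun setT (fun t : R => (t + h)%R : measurableTypeR R).
  by apply: measurable_funD => //.
transitivity (\int[pushforward mu ((fun t => t + h)%R : _ -> measurableTypeR R)]_(t in
    `[(x + h)%R, (y + h)%R[) f t).
  by apply: eq_measure_integral => //= A mA AS; exact/esym/lebesgue_measure_shift.
rewrite ge0_integral_pushforward//=; last exact: measurable_funTS.
congr (integral _ _ _); apply/seteqP; split => t /=; rewrite !in_itv/=.
  by rewrite lerD2r ltrD2r.
by rewrite lerD2r ltrD2r.
Qed.

Lemma ge0_integral_equally_spaced (f : R -> \bar R) (h : R) n :
  measurable_fun setT f -> (forall t, 0 <= f t) -> (0 <= h)%R ->
  \int[mu]_(t in `[0%R, (n%:R * h)%R[) f t =
  \int[mu]_(t in `[0%R, h[) (\sum_(i < n) f (t + i%:R * h)%R).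
Proof.
move=> mf f0 h0.
have msh (k : R) : measurable_fun setT (fun t : R => f (t + k)%R).
  by apply: (measurableT_comp mf); exact: measurable_funD.
elim: n => [|n ih].
  rewrite mul0r set_itvE integral_set0.
  by under eq_integral do rewrite big_ord0; rewrite integral0.
transitivity (\int[mu]_(t in `[0%R, h[) (\sum_(i < n) f (t + i%:R * h)%R +
    f (t + n%:R * h)%R)); last by apply: eq_integral => t _; rewrite big_ord_recr.
rewrite ge0_integralD//=; last 3 first.
- by move=> t _; apply: sume_ge0.
- by apply: emeasurable_sum => i; apply: measurable_funTS; exact: msh.
- by apply: measurable_funTS; exact: msh.
rewrite -ih.
have -> : `[0%R, (n.+1%:R * h)%R[%classic = `[0%R, (n%:R * h)%R[%classic `|`
    `[(n%:R * h)%R, (n.+1%:R * h)%R[%classic :> set R.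
  rewrite -itv_bndbnd_setU// bnd_simp ?mulr_ge0//.
  by rewrite ler_wpM2r// ler_nat.
rewrite ge0_integral_setU//=.
- congr (_ + _); rewrite -ge0_integral_shift//.
  by rewrite add0r -nat1r mulrDl mul1r.
- exact: measurable_funTS.
- rewrite disj_set2E; apply/eqP/seteqP; split => // t /=; rewrite !in_itv/=.
  by move=> [/andP[_ h1] /andP[h2 _]]; move: (lt_le_trans h1 h2); rewrite ltxx.
Qed.

(** The average over [t] of the Riemann sums at the points [t + i * (l / n)] is the
    integral, so one of these sums does not exceed the integral by more than [e]. *)
Lemma equally_spaced_sample (f : R -> \bar R) (l e : R) n :
  measurable_fun setT f -> (forall t, 0 <= f t) -> (0 < l)%R -> (0 < n)%N ->
  (0 < e)%R -> \int[mu]_(t in `[0%R, l[) f t < +oo ->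
  exists2 t : R, (0 <= t < l / n%:R)%R &
    (\sum_(i < n) f (t + i%:R * (l / n%:R))%R) * (l / n%:R)%:E <=
    \int[mu]_(t in `[0%R, l[) f t + e%:E.
Proof.
move=> mf f0 l0 n0 e0; set I := integral _ _ _ => Ifin.
set h := (l / n%:R)%R; have h0 : (0 < h)%R by rewrite divr_gt0// ltr0n.
have IE : I = \int[mu]_(t in `[0%R, h[) (\sum_(i < n) f (t + i%:R * h)%R).
  rewrite -ge0_integral_equally_spaced// ?ltW//.
  by rewrite /I /h mulrC -mulrA mulVf ?mulr1// pnatr_eq0 -lt0n.
have I0 : 0 <= I by apply: integral_ge0.
have Ir : I \is a fin_num by rewrite ge0_fin_numE.
apply: contrapT => no.
have : (I + e%:E) <= I.
  rewrite {2}IE -(fineK Ir).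
  apply: (@le_trans _ _ (\int[mu]_(t in `[0%R, h[) (cst ((fine I + e) / h)%:E t))).
    rewrite integral_cst//= lebesgue_measure_itv/= lte_fin h0 oppr0 adde0.
    by rewrite -EFinM divfK ?gt_eqF.
  apply: ge0_le_integral => //.
  - by move=> t _; rewrite lee_fin divr_ge0 ?addr_ge0 ?fine_ge0// ltW.
  - apply: emeasurable_sum => i; apply: measurable_funTS.
    by apply: (measurableT_comp mf); exact: measurable_funD.
  - move=> t; rewrite /= in_itv/= => th; rewrite leNgt; apply/negP => hlt.
    apply: no; exists t => //.
    rewrite -(fineK Ir) -EFinD -lee_pdivlMr// -EFinM.
    exact: ltW.
by rewrite -(fineK Ir) -EFinD lee_fin gerDl leNgt e0.
Qed.

End shift.

(** * Integration along curves *)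

Section curve_integral.
Context {R : realType} {X : pMetricType R}.
Variables (a b : R) (c : R -> X).
Hypothesis rect : rectifiable a b c.
Local Open Scope ereal_scope.
Local Notation mu := (@lebesgue_measure R).

Let ab : (a <= b)%R. Proof. by case: rect => -[]. Qed.

Let L := fine (curve_length a b c).

Let L0 : (0 <= L)%R. Proof. by rewrite fine_ge0// curve_length_ge0. Qed.

(** Extended constantly outside of [[0, L]], the arc length parametrization is
    1-Lipschitz on the whole line, hence Borel. *)
Definition clamped_arclength (s : R) : X :=
  arclength a b c (Num.max 0%R (Num.min s L)).

Lemma clamped_arclength_in s : (0 <= s <= L)%R ->
  clamped_arclength s = arclength a b c s.
Proof. by case/andP => s0 sL; rewrite /clamped_arclength min_l// max_r. Qed.

Lemma clamped_arclength_lipschitz s t :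
  (mdist (clamped_arclength s) (clamped_arclength t) <= `|s - t|)%R.
Proof.
wlog st : s t / (s <= t)%R => [wlg|].
  have [st|ts] := leP s t; first exact: wlg.
  by rewrite metric_sym distrC wlg// ltW.
rewrite distrC ger0_norm ?subr_ge0//.
set s' := Num.max 0%R (Num.min s L); set t' := Num.max 0%R (Num.min t L).
have [h1 h2 h3 h4] : [/\ 0 <= s', s' <= t', t' <= L & t' - s' <= t - s]%R.
  have L0' := L0.
  rewrite /s' /t' /Num.max /Num.min.
  split; repeat case: ifPn => //; rewrite -?leNgt; lra.
by apply: le_trans (arclength_lipschitz rect h1 h2 h3) h4.
Qed.

Lemma measurable_clamped_arclength d (Y : measurableType d) (g : X -> Y) :
  borel_fun g -> measurable_fun setT (g \o clamped_arclength).
Proof.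
move=> mg; apply: (@measurable_comp _ _ _ _ (g_sigma_algebraType (@open X)) _ setT) => //.
apply: (@measurability _ _ (measurableTypeR R) (g_sigma_algebraType (@open X))
  setT clamped_arclength (@open X)) => //.
move=> _ [U oU <-]; rewrite setTI; apply: open_measurable.
move: oU; rewrite openE => oU; rewrite openE => s /= /oU.
move=> /nbhs_ballP[e /= e0 eU]; apply/nbhs_ballP; exists e => // t st.
apply: eU; rewrite ballEmdist /=.
exact: le_lt_trans (clamped_arclength_lipschitz _ _) st.
Qed.

Lemma curve_integralE (g : X -> \bar R) : curve_integral g a b c =
  \int[mu]_(s in `[0%R, L]) (g \o clamped_arclength) s.
Proof.
apply: eq_integral => s; rewrite inE /= in_itv /= => sL.
by rewrite clamped_arclength_in.
Qed.

(** An upper Riemann sum in the original parameter: the arc length interval that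
    corresponds to [[t i, t i.+1]] has the length of that piece as its size. *)
Lemma curve_integral_le_bounds (h : X -> \bar R) (t H : nat -> R) (n : nat) :
  borel_fun h -> (forall x, 0 <= h x) ->
  t 0%N = a -> t n = b -> (forall i, (i < n)%N -> (t i <= t i.+1)%R) ->
  (forall i, (i < n)%N -> (0 <= H i)%R) ->
  (forall i x, (i < n)%N -> (t i <= x <= t i.+1)%R -> h (c x) <= (H i)%:E) ->
  curve_integral h a b c <=
    (\sum_(i < n) H i * fine (curve_length (t i) (t i.+1) c))%R%:E.
Proof.
move=> mh h0 t0 tn tS H0 hH.
have tmono i j : (i <= j)%N -> (j <= n)%N -> (t i <= t j)%R.
  elim: j => [|j ih]; first by rewrite leqn0 => /eqP ->.
  rewrite leq_eqVlt => /predU1P[->//|]; rewrite ltnS => ij jn.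
  by apply: le_trans (ih ij (ltnW jn)) (tS _ jn).
have tin i : (i <= n)%N -> (a <= t i <= b)%R by move=> ?; rewrite -t0 -tn !tmono.
set len := fun x => fine (curve_length a x c).
have key k : (k <= n)%N ->
    \int[mu]_(s in `[0%R, len (t k)]) (h \o clamped_arclength) s <=
    (\sum_(i < k) H i * fine (curve_length (t i) (t i.+1) c))%R%:E.
  elim: k => [_|k ih kn].
    rewrite t0 /len (length_start rect) set_itv1 integral_set1 big_ord0.
    exact: lexx.
  have /andP[atk tkb] := tin _ (ltnW kn); have /andP[atk1 tk1b] := tin _ kn.
  have tkS := tS _ kn.
  have lk0 : (0 <= len (t k))%R by rewrite fine_ge0// curve_length_ge0.
  have lkS := length_homo rect atk tkS tk1b.
  rewrite (@itv_bndbnd_setU _ _ _ (BRight (len (t k)))) ?bnd_simp//.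
  rewrite ge0_integral_setU//=; last 2 first.
  - by apply: measurable_funTS; exact: measurable_clamped_arclength.
  - rewrite disj_set2E; apply/eqP/seteqP; split => // s /=; rewrite !in_itv/=.
    by move=> [/andP[_ h1] /andP[h2 _]]; move: (le_lt_trans h1 h2); rewrite ltxx.
  rewrite big_ord_recr/= EFinD; apply: leeD; first exact: ih (ltnW kn).
  rewrite (curve_length_increment rect)//= -/(len _) -/(len _).
  have -> : (H k * (len (t k.+1) - len (t k)))%R%:E =
     \int[mu]_(s in `](len (t k)), (len (t k.+1))]) cst (H k)%:E s.
    rewrite integral_cst//= lebesgue_measure_itv/= lte_fin.
    have [_|] := ltP (len (t k)) (len (t k.+1)); first by rewrite EFinM EFinB.
    by move=> le; rewrite mule0 (@le_anti _ _ (len (t k)) (len (t k.+1))) ?lkS// subrr mulr0.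
  apply: ge0_le_integral => //.
  - by apply: measurable_funTS; exact: measurable_clamped_arclength.
  - move=> s; rewrite /= in_itv/= => /andP[s1 s2].
    have sL : (0 <= s <= L)%R.
      rewrite (le_trans lk0 (ltW s1)) (le_trans s2)//.
      exact: (length_homo rect atk1 tk1b (lexx b)).
    rewrite clamped_arclength_in//.
    have [x /andP[ax xb] xs] := length_surjective rect sL.
    have [xt|tx] := leP x (t k.+1).
      rewrite -xs (arclength_len rect) ?ax//; apply: hH => //; rewrite xt andbT.
      rewrite leNgt; apply/negP => xtk.
      have := length_homo rect ax (ltW xtk) tkb.
      by rewrite xs leNgt s1.
    have -> : s = len (t k.+1).
      apply/eqP; rewrite eq_le s2 -xs.
      exact: (length_homo rect atk1 (ltW tx) xb).
    rewrite (arclength_len rect) ?atk1//; apply: hH => //.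
    by rewrite tkS lexx.
by rewrite curve_integralE; have := key n (leqnn n); rewrite tn.
Qed.

End curve_integral.

Section chain_to_curve.
Context {R : realType} {X : pMetricType R}.
Local Open Scope ereal_scope.
Local Notation mu := (@lebesgue_measure R).

(** The trapezoidal rule counts interior points fully and the end points by half. *)
Lemma chain_integral_le (g : X -> \bar R) (q : nat -> X) n (h : R) :
  (forall x, 0 <= g x) -> (forall i, (i < n.+1)%N -> mdist (q i) (q i.+1) <= h)%R ->
  chain_integral g n.+1 q <=
  (\sum_(i < n) g (q i.+1)) * h%:E + (g (q 0%N) + g (q n.+1)) * (2^-1 * h)%:E.
Proof.
move=> g0 qh; have h0 : (0 <= h)%R by apply: le_trans (qh 0%N isT); exact: mdist_ge0.
set S := \sum_(i < n) _.
have S0 : 0 <= S by exact: sume_ge0.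
have d0 i : (0 <= mdist (q i) (q i.+1))%R by exact: mdist_ge0.
have h20 : (0 <= 2^-1 * h)%R by rewrite mulr_ge0// invr_ge0.
apply: (@le_trans _ _ (\sum_(i < n.+1) (g (q i) + g (q i.+1)) * (2^-1 * h)%:E)).
  apply: lee_sum => i _; rewrite -muleA -EFinM.
  apply: lee_wpmul2l; first by rewrite adde_ge0.
  by rewrite lee_fin ler_wpM2l// ?invr_ge0//; exact: qh.
rewrite -ge0_sume_distrl; last by move=> i _; rewrite adde_ge0.
rewrite big_split/= [X in (X + _) * _]big_ord_recl/= [X in (_ + X) * _]big_ord_recr/=.
have -> : \sum_(i < n) g (q (bump 0 i)) = S by apply: eq_bigr.
have -> : h%:E = (2^-1 * h)%:E + (2^-1 * h)%:E.
  by rewrite -EFinD; congr EFin; lra.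
rewrite -/S ge0_muleDr ?lee_fin// -ge0_muleDl// -ge0_muleDl ?adde_ge0//.
by rewrite [X in (_ + X) * _]addeC addeACA [X in X * _]addeC.
Qed.

(** The chain made of equally spaced points and of the two end points costs a Riemann
    sum, which may be chosen below the integral up to [e], plus half the mesh times
    the values of [g] at the ends. The last term vanishes with the mesh when these
    values are finite; they may be infinite in general, since a chain pays for its
    end points and a curve does not. *)
Lemma UGeps_curve_le (eps : R) (u : X -> R) (g : X -> \bar R) (a b : R) (c : R -> X) :
  (0 < eps)%R -> UGeps eps u g -> rectifiable a b c ->
  g (c a) < +oo -> g (c b) < +oo ->
  `|u (c b) - u (c a)|%:E <= curve_integral g a b c.
Proof.
move=> eps0 [mg g0 ug] rect ga gb.
have ab : (a <= b)%R by case: rect => -[].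
have I0 : 0 <= curve_integral g a b c by apply: integral_ge0 => *; exact: g0.
have [L0|L0] := leP (fine (curve_length a b c)) 0%R.
  have -> : c b = c a.
    apply/esym; apply: mdist_positivity; apply/eqP; rewrite eq_le mdist_ge0 andbT.
    apply: le_trans (mdist_le_length rect (lexx a) ab (lexx b)) _.
    by rewrite (length_start rect) subr0.
  by rewrite subrr normr0.
set L := fine _ in L0.
have [Iy|Iy] := eqVneq (curve_integral g a b c) +oo; first by rewrite Iy leey.
have Ifin : curve_integral g a b c < +oo by rewrite ltey.
pose G := g \o clamped_arclength a b c.
have mG : measurable_fun setT G by exact: measurable_clamped_arclength.
have IE : curve_integral g a b c = \int[mu]_(t in `[0%R, L[) G t.
  rewrite curve_integralE integral_itv_bndo_bndc//.
  exact: measurable_funTS.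
apply/lee_addgt0Pr => e e0.
have gafin : g (c a) \is a fin_num by rewrite ge0_fin_numE.
have gbfin : g (c b) \is a fin_num by rewrite ge0_fin_numE.
set A := fine (g (c a)) ; set B := fine (g (c b)).
have A0 : (0 <= A)%R by rewrite fine_ge0.
have B0 : (0 <= B)%R by rewrite fine_ge0.
(* enough points for the mesh to be below eps and for the end terms to be small *)
have [n [n0 nL nAB]] : exists n : nat, [/\ (0 < n)%N, L / n%:R <= eps &
   (A + B) * (2^-1 * (L / n%:R)) <= e / 2]%R.
  pose M := (L / eps + (A + B) * L / e)%R.
  have M1 : (L / eps <= M)%R by rewrite lerDl divr_ge0 ?mulr_ge0 ?addr_ge0// ltW.
  have M2 : ((A + B) * L / e <= M)%R by rewrite lerDr divr_ge0 ?ltW.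
  have [n Mn] : exists n : nat, (M < n.+1%:R)%R.
    by exists (Num.truncn M); rewrite truncnS_gt.
  have nn0 : (0 < n.+1%:R :> R)%R by rewrite ltr0n.
  exists n.+1; split => //.
    rewrite ler_pdivrMr// mulrC -ler_pdivrMr//.
    exact: le_trans M1 (ltW Mn).
  have := le_trans M2 (ltW Mn); rewrite ler_pdivrMr// => h.
  rewrite mulrCA [leRHS]mulrC ler_pM2l ?invr_gt0// mulrA ler_pdivrMr// mulrC.
  by rewrite (mulrC e) (mulrC L).
have e20 : (0 < e / 2)%R by rewrite divr_gt0.
have [|t /andP[t0 th] ht] := equally_spaced_sample mG (fun t => g0 _) L0 n0 e20.
  by rewrite -IE.
set h := (L / n%:R)%R in th ht nL nAB.
have h0 : (0 < h)%R by rewrite divr_gt0// ltr0n.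
have nh : (n%:R * h = L)%R by rewrite /h mulrC divfK// pnatr_eq0 -lt0n.
(* the endpoints of the curve are added to the equally spaced points *)
pose T i := (if i is j.+1 then if (j < n)%N then t + j%:R * h else L else 0)%R.
pose q i := arclength a b c (T i).
have T0 i : (0 <= T i)%R.
  by case: i => [|i]//=; case: ifP => _; [rewrite addr_ge0// mulr_ge0// ltW | exact: ltW].
have TL i : (T i <= L)%R.
  case: i => [|i] /=; first exact: ltW.
  case: ifPn => // iN; rewrite -nh -(subnKC iN) natrD mulrDl -natr1 mulrDl mul1r.
  by have := mulr_ge0 (ler0n R (n - i.+1)) (ltW h0); lra.
have TS i : (i < n.+1)%N -> (T i <= T i.+1)%R /\ (T i.+1 - T i <= h)%R.
  case: i => [_|i] /=.
    by rewrite n0 mul0r addr0 subr0 t0 ltW.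
  rewrite ltnS => iN; rewrite iN.
  case: ifPn => [iN'|].
    by rewrite -natr1 mulrDl mul1r; split; lra.
  rewrite -leqNgt => nS.
  have E : n = i.+1 by apply/eqP; rewrite eqn_leq nS iN.
  rewrite -nh E -natr1 mulrDl mul1r; split; lra.
have qh i : (i < n.+1)%N -> (mdist (q i) (q i.+1) <= h)%R.
  move=> iN; have [T1 T2] := TS i iN.
  exact: le_trans (arclength_lipschitz rect (T0 i) T1 (TL _)) T2.
have q0 : q 0%N = c a by rewrite /q /T (arclength_start rect).
have qn : q n.+1 = c b by rewrite /q /T ltnn (arclength_end rect).
have := ug n.+1 q (fun i iN => le_trans (qh i iN) nL).
rewrite q0 qn => /le_trans; apply.
apply: le_trans (chain_integral_le g0 qh) _.
rewrite q0 qn IE (splitr e) EFinD addeA; apply: leeD.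
  have -> : \sum_(i < n) g (q i.+1) = \sum_(i < n) G (t + i%:R * h)%R.
    apply: eq_bigr => i _; rewrite /q /T ltn_ord /G /= clamped_arclength_in//.
    by have := T0 i.+1; have := TL i.+1; rewrite /T ltn_ord => -> ->.
  exact: ht.
by rewrite -(fineK gafin) -(fineK gbfin) -EFinD -EFinM lee_fin.
Qed.

End chain_to_curve.

(** * Slopes and local Lipschitz constants *)

Section slopes.
Context {R : realType} {X : pMetricType R}.
Local Open Scope ereal_scope.
Implicit Types (u f : X -> R) (x y : X).

Lemma lim_at_right0_inf (f : R -> \bar R) :
  (forall s t : R, (0 < s)%R -> (s <= t)%R -> f s <= f t) ->
  lim (f x @[x --> 0%R^'+]) = ereal_inf (f @` [set e | 0 < e]%R).
Proof.
move=> nf; apply/cvg_lim => //.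
have -> : [set e : R | 0 < e]%R = `]0%R, +oo[%classic :> set R.
  by apply/seteqP; split => e /=; rewrite in_itv/= andbT.
apply: nondecreasing_at_right_cvge => //.
by move=> s t; rewrite !in_itv/= !andbT => s0 _; exact: nf.
Qed.

Lemma slope_sup_ge0 u x e : 0 <= slope_sup u x e.
Proof. by apply: ereal_sup_ubound; left. Qed.

Lemma slope_sup_le u x e (v : \bar R) : 0 <= v ->
  (forall y, (mdist x y < e)%R -> `|u y - u x|%:E <= v * (mdist x y)%:E) ->
  slope_sup u x e <= v.
Proof.
move=> v0 h; apply: ge_ereal_sup => _ [->//|[y [xy yx] <-]].
rewrite ballEmdist /= in xy.
have d0 : (0 < mdist x y)%R.
  by rewrite mdist_gt0; apply/eqP => E; apply: yx.
have := h y xy; case: v v0 {h} => [v| |]//; rewrite ?leey//.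
by move=> _; rewrite -EFinM !lee_fin ler_pdivrMr.
Qed.

Lemma slope_sup_lower u x y e : (mdist x y < e)%R -> x <> y ->
  (`|u y - u x| / mdist x y)%:E <= slope_sup u x e.
Proof.
move=> xy nxy; apply: ereal_sup_ubound; right; exists y => //; split.
  by rewrite ballEmdist.
by move=> yx; exact: nxy.
Qed.

Lemma slope_sup_dist u x y e : (mdist x y < e)%R ->
  `|u y - u x|%:E <= slope_sup u x e * (mdist x y)%:E.
Proof.
move=> xy; have [<-|nxy] := pselect (x = y).
  by rewrite subrr normr0 mdistxx mule0.
have d0 : (0 < mdist x y)%R by rewrite mdist_gt0; exact/eqP.
have := slope_sup_lower u xy nxy; have := slope_sup_ge0 u x e.
case: (slope_sup u x e) => [v| |]// _; last first.
  by move=> _; rewrite gt0_mulye ?lte_fin// leey.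
by rewrite -EFinM !lee_fin ler_pdivrMr.
Qed.

Lemma slope_sup_homo u x e1 e2 : (e1 <= e2)%R -> slope_sup u x e1 <= slope_sup u x e2.
Proof.
move=> e12; apply: slope_sup_le; first exact: slope_sup_ge0.
by move=> y xy; apply: slope_sup_dist; exact: lt_le_trans e12.
Qed.

Lemma slope_sup_lipschitz u x e (L : R) : (0 <= L)%R ->
  (forall x y, `|u x - u y| <= L * mdist x y)%R -> slope_sup u x e <= L%:E.
Proof.
move=> L0 uL; apply: slope_sup_le; first by rewrite lee_fin.
by move=> y _; rewrite -EFinM lee_fin metric_sym uL.
Qed.

Lemma lipE u x : lip u x = ereal_inf [set slope_sup u x e | e in [set e | 0 < e]%R].
Proof.
by rewrite /lip lim_at_right0_inf// => e1 e2 _; exact: slope_sup_homo.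
Qed.

Lemma lip_le_slope u x e : (0 < e)%R -> lip u x <= slope_sup u x e.
Proof. by move=> e0; rewrite lipE; apply: ereal_inf_lbound; exists e. Qed.

Lemma lip_ge0 u x : 0 <= lip u x.
Proof.
by rewrite lipE; apply: le_ereal_inf_tmp => _ [e _ <-]; exact: slope_sup_ge0.
Qed.

Lemma lip_lt_slope u x (v : \bar R) : lip u x < v ->
  exists2 e, (0 < e)%R & slope_sup u x e < v.
Proof. by rewrite lipE => /ereal_inf_lt[_ [e e0 <-]]; exists e. Qed.

Lemma continuous_mdist x : continuous (fun y => mdist x y : R).
Proof.
apply: lipschitz_continuous; exists 1%R => y z; rewrite mul1r.
have h1 := metric_triangle x y z; have h2 := metric_triangle x z y.
rewrite (metric_sym z y) in h2.
by rewrite ler_norml; apply/andP; split; lra.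
Qed.

(** For a fixed [y], to have a slope larger than [r] towards [y] is an open condition
    on [x], so the supremum is lower semicontinuous. *)
Lemma borel_slope_sup u e : continuous u -> borel_fun (slope_sup u ^~ e).
Proof.
move=> cu; apply: lsc_borel => r.
have [r0|r0] := ltP r 0%R.
  rewrite (_ : [set _ | _] = setT); first exact: openT.
  apply/seteqP; split => // x _ /=.
  by apply: lt_le_trans (slope_sup_ge0 u x e); rewrite lte_fin.
rewrite (_ : [set x | _] = \bigcup_y ([set x | mdist y x < e]%R `&`
    [set x | 0 < `|u y - u x| - r * mdist y x]%R)).
  apply: bigcup_open => y _; apply: openI.
    apply: (@open_comp _ _ (fun x => mdist y x : R) [set t | t < e]%R).
      by move=> x _; exact: continuous_mdist.
    exact: open_lt.
  apply: (@open_comp _ _ (fun x => `|u y - u x| - r * mdist y x : R)%R [set t | 0 < t]%R).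
    move=> x _; apply: cvgB.
      by apply: cvg_norm; apply: cvgB; [exact: cvg_cst|exact: cu].
    by apply: cvgM; [exact: cvg_cst|exact: continuous_mdist].
  exact: open_gt.
apply/seteqP; split => x /=.
  move=> /ereal_sup_gt[_ [->|[y [xy yx] <-]]]; rewrite lte_fin.
    by rewrite ltNge r0.
  rewrite ballEmdist /= in xy.
  have d0 : (0 < mdist x y)%R by rewrite mdist_gt0; apply/eqP => E; apply: yx.
  rewrite ltr_pdivlMr// => h; exists y => //=; split; rewrite metric_sym//.
  by rewrite subr_gt0.
move=> [y _ [/= yx]]; rewrite subr_gt0 => h.
have nxy : x <> y.
  by move=> E; move: h; rewrite E subrr normr0 mdistxx mulr0 ltxx.
rewrite metric_sym in yx h.
apply: lt_le_trans (slope_sup_lower u yx nxy).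
by rewrite lte_fin ltr_pdivlMr// mdist_gt0; exact/eqP.
Qed.

(** The difference of [u] over a step is bounded by the slope at either end of the
    step, hence by the mean of the two. *)
Lemma slope_sup_UGeps u e e' : continuous u -> (e' < e)%R ->
  UGeps e' u (slope_sup u ^~ e).
Proof.
move=> cu e'e; split.
- exact: borel_slope_sup.
- by move=> x; exact: slope_sup_ge0.
move=> N q; elim: N => [|N ih] qe.
  by rewrite subrr normr0 /chain_integral big_ord0.
rewrite /chain_integral big_ord_recr/=.
apply: (@le_trans _ _ (`|u (q N) - u (q 0%N)|%:E + `|u (q N.+1) - u (q N)|%:E)).
  rewrite -EFinD lee_fin.
  have -> : (u (q N.+1) - u (q 0%N) = (u (q N) - u (q 0%N)) + (u (q N.+1) - u (q N)))%R.
    by rewrite addrAC addrCA subrr addr0.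
  exact: ler_normD.
apply: leeD; first by apply: ih => i iN; apply: qe; exact: ltn_trans iN _.
have qq : (mdist (q N) (q N.+1) < e)%R by apply: le_lt_trans (qe N (ltnSn N)) e'e.
have h1 := slope_sup_dist u qq.
rewrite metric_sym in qq; have h2 := slope_sup_dist u qq.
rewrite metric_sym distrC in h2.
have s1 := slope_sup_ge0 u (q N) e; have s2 := slope_sup_ge0 u (q N.+1) e.
have d0 := mdist_ge0 (q N) (q N.+1).
rewrite muleAC ge0_muleDl//.
have -> : `|u (q N.+1) - u (q N)|%:E =
    (`|u (q N.+1) - u (q N)|%:E + `|u (q N.+1) - u (q N)|%:E) * (2^-1)%:E.
  by rewrite -EFinD -EFinM; congr EFin; lra.
by apply: lee_wpmul2r; [rewrite lee_fin invr_ge0|exact: leeD].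
Qed.

Section lipschitz.
Variables (u : X -> R).
Hypothesis ul : is_lipschitz u.

Lemma slope_sup_fin x e : slope_sup u x e \is a fin_num.
Proof.
have [L L0 uL] := is_lipschitz_pos ul.
rewrite ge0_fin_numE ?slope_sup_ge0//.
exact: le_lt_trans (slope_sup_lipschitz x e (ltW L0) uL) (ltry _).
Qed.

Lemma lip_fin x : lip u x \is a fin_num.
Proof.
rewrite ge0_fin_numE ?lip_ge0//; apply: le_lt_trans (lip_le_slope u x ltr01) _.
by rewrite -ge0_fin_numE ?slope_sup_ge0// slope_sup_fin.
Qed.

Lemma slope_sup_cvg x :
  (fun n => fine (slope_sup u x n.+1%:R^-1)) @ \oo --> fine (lip u x).
Proof.
apply/cvgrPdist_le => e e0.
have [] := @lip_lt_slope u x (lip u x + e%:E).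
  by rewrite lteDl ?lip_fin ?lte_fin.
move=> r r0 hr.
have : (fun n => n.+1%:R^-1 : R)%R @ \oo --> 0%R by exact: cvg_harmonic.
move=> /cvgrPdist_lt/(_ r r0); apply: filterS => n.
rewrite sub0r normrN ger0_norm// => nr.
rewrite distrC ger0_norm.
  rewrite lerBlDl -lee_fin EFinD !fineK ?slope_sup_fin ?lip_fin//.
  apply: ltW; apply: le_lt_trans hr.
  by apply: slope_sup_homo; exact: ltW.
rewrite subr_ge0 fine_le ?slope_sup_fin ?lip_fin//.
by apply: lip_le_slope.
Qed.

Lemma slope_sup_ecvg x :
  (fun n => slope_sup u x n.+1%:R^-1) @ \oo --> lip u x.
Proof.
rewrite -(fineK (lip_fin x)).
rewrite (_ : (fun n => _) = (fun n => (fine (slope_sup u x n.+1%:R^-1))%:E)).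
  by apply: cvg_EFin; [exact: nearW|exact: slope_sup_cvg].
by apply/funext => n; rewrite fineK// slope_sup_fin.
Qed.

Lemma borel_lip : borel_fun (lip u).
Proof.
apply: (@emeasurable_fun_cvg _ (g_sigma_algebraType (@open X)) R setT
  (fun n x => slope_sup u x n.+1%:R^-1)).
- by move=> n; apply: borel_slope_sup; exact: lipschitz_continuous.
- by move=> x _; exact: slope_sup_ecvg.
Qed.

(** The slopes at the scale [1 / (n + 1)] bound the oscillation along curves by
    [UGeps_curve_le], and they decrease boundedly to [lip u]; in this way no
    differentiability along curves is involved. *)
Lemma lip_UG : UG u (lip u).
Proof.
split; first exact: lipschitz_borel.
- exact: borel_lip.
- exact: lip_ge0.
move=> a b c rect; have [L L0 uL] := is_lipschitz_pos ul.
have sL x e : slope_sup u x e <= L%:E by apply: slope_sup_lipschitz (ltW L0) uL.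
have ms e : borel_fun (slope_sup u ^~ e).
  by apply: borel_slope_sup; exact: lipschitz_continuous.
have key n : `|u (c b) - u (c a)|%:E <= curve_integral (slope_sup u ^~ (n.+1%:R^-1)%R) a b c.
  have e0 : (0 < n.+1%:R^-1 / 2 :> R)%R by rewrite divr_gt0.
  apply: (UGeps_curve_le e0) => //.
  - apply: slope_sup_UGeps; first exact: lipschitz_continuous.
    by rewrite ltr_pdivrMr// ltr_pMr// ltr1n.
  - by apply: le_lt_trans (sL _ _) _; rewrite ltry.
  - by apply: le_lt_trans (sL _ _) _; rewrite ltry.
have := @dominated_convergence _ _ R lebesgue_measure
  `[0%R, fine (curve_length a b c)] (measurable_itv _)
  (fun n => (slope_sup u ^~ (n.+1%:R^-1)%R) \o clamped_arclength a b c)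
  (lip u \o clamped_arclength a b c) (cst L%:E).
case.
- by move=> n; apply: measurable_funTS; exact: measurable_clamped_arclength.
- by apply: measurable_funTS; apply: measurable_clamped_arclength => //; exact: borel_lip.
- by apply: aeW => s _; exact: slope_sup_ecvg.
- apply/integrableP; split => //.
  rewrite integral_cst//= lebesgue_measure_itv/=.
  by case: ifP => _; rewrite ?mule0// -EFinB -EFinM ltry.
- by apply: aeW => s n _; rewrite gee0_abs//= slope_sup_ge0.
move=> _ _ cv; rewrite curve_integralE.
rewrite -(cvg_lim _ cv)//; apply: lime_ge.
  by apply/cvg_ex; eexists; exact: cv.
by apply: nearW => n; have := key n; rewrite curve_integralE.
Qed.

End lipschitz.
End slopes.

(** * Cutoff functions *)

Section cutoff.
Context {R : realType} {X : pMetricType R}.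
Variables (x0 : X) (r : R).
Hypothesis r0 : 0 < r.

Definition cutoff (x : X) : R := Num.max 0 (Num.min 1 (2 - mdist x0 x / r)).

Lemma cutoff_ge0 x : 0 <= cutoff x.
Proof. by rewrite /cutoff le_max lexx. Qed.

Lemma cutoff_le1 x : cutoff x <= 1.
Proof. by rewrite /cutoff ge_max ler01 ge_min lexx. Qed.

Lemma cutoff1 x : mdist x0 x <= r -> cutoff x = 1.
Proof.
move=> xr; rewrite /cutoff min_l ?max_r//.
have : mdist x0 x / r <= 1 by rewrite ler_pdivrMr// mul1r.
lra.
Qed.

Lemma cutoff0 x : 2 * r <= mdist x0 x -> cutoff x = 0.
Proof.
move=> xr; have h : 2 <= mdist x0 x / r by rewrite ler_pdivlMr.
by rewrite /cutoff max_l// ge_min; apply/orP; right; lra.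
Qed.

Lemma cutoff_lipschitz x y : `|cutoff x - cutoff y| <= mdist x y / r.
Proof.
wlog : x y / cutoff y <= cutoff x => [wlg|].
  have [h|h] := leP (cutoff y) (cutoff x); first exact: wlg.
  by rewrite distrC metric_sym wlg// ltW.
move=> h; rewrite ger0_norm ?subr_ge0//; rewrite /cutoff in h *.
have D : mdist x0 y / r <= mdist x0 x / r + mdist x y / r.
  by rewrite -mulrDl ler_pM2r ?invr_gt0// metric_triangle.
have d0 : 0 <= mdist x y / r by rewrite divr_ge0 ?mdist_ge0// ltW.
move: h D d0; rewrite /Num.max /Num.min.
by repeat case: ifPn; rewrite -?leNgt; lra.
Qed.

Variable f : X -> R.
Hypothesis fl : is_lipschitz f.

Definition cut (x : X) : R := f x * cutoff x.

Lemma cut_dist x y : `|cut y - cut x| <= `|f y - f x| + `|f x| * (mdist x y / r).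
Proof.
have -> : cut y - cut x = (f y - f x) * cutoff y + f x * (cutoff y - cutoff x).
  by rewrite /cut; lra.
apply: le_trans (ler_normD _ _) _; rewrite !normrM; apply: lerD.
  by rewrite (ger0_norm (cutoff_ge0 _)) ler_piMr// cutoff_le1.
by rewrite ler_wpM2l// metric_sym cutoff_lipschitz.
Qed.

Lemma cut_lipschitz : is_lipschitz cut.
Proof.
have [L L0 fL] := is_lipschitz_pos fl.
pose B := `|f x0| + L * (2 * r).
have B0 : 0 <= B by rewrite addr_ge0// mulr_ge0 ?mulr_ge0// ltW.
exists (L + B / r) => x y.
wlog : x y / mdist x0 x <= mdist x0 y => [wlg|xy].
  have [h|h] := leP (mdist x0 x) (mdist x0 y); first exact: wlg.
  by rewrite distrC metric_sym wlg// ltW.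
have [h|h] := leP (2 * r) (mdist x0 x).
  rewrite /cut !cutoff0 ?(le_trans h)// !mulr0 subrr normr0.
  by rewrite mulr_ge0 ?mdist_ge0// addr_ge0 ?(ltW L0)// divr_ge0// ltW.
rewrite distrC; apply: le_trans (cut_dist x y) _.
rewrite mulrDl; apply: lerD; first by rewrite distrC.
rewrite -mulrA [X in _ <= _ * X]mulrC.
apply: ler_wpM2r; first by rewrite divr_ge0 ?mdist_ge0// ltW.
rewrite /B -lerBlDl; apply: le_trans (lerB_dist _ _) _.
apply: le_trans (fL _ _) _; rewrite ler_pM2l// metric_sym.
exact: ltW.
Qed.

(** The Leibniz rule, with [f] evaluated at the base point in the second term. *)
Lemma lip_cut x : (lip cut x <=
  if (mdist x0 x <= 2 * r)%R then lip f x + (`|f x| / r)%:E else 0)%E.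
Proof.
case: ifPn => [_|]; last first.
  rewrite -ltNge => h; apply: (@le_trans _ _ (slope_sup cut x (mdist x0 x - 2 * r))).
    by apply: lip_le_slope; rewrite subr_gt0.
  apply: slope_sup_le => // y xy.
  rewrite /cut !cutoff0 ?mulr0 ?subrr ?normr0 ?mul0e//; first exact: ltW.
  by have := metric_triangle x0 y x; rewrite (metric_sym y x); lra.
apply/lee_addgt0Pr => e e0.
have [] := @lip_lt_slope _ _ f x (lip f x + e%:E).
  by rewrite lteDl ?lip_fin ?lte_fin.
move=> d d0 hd; apply: le_trans (lip_le_slope cut x d0) _.
apply: (@le_trans _ _ (slope_sup f x d + (`|f x| / r)%:E)%E); last first.
  by rewrite addeAC leeD2r// ltW.
have fr0 : (0 <= (`|f x| / r)%:E)%E by rewrite lee_fin divr_ge0// ltW.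
apply: slope_sup_le; first by rewrite adde_ge0// slope_sup_ge0.
move=> y xy; rewrite ge0_muleDl ?slope_sup_ge0//.
apply: (@le_trans _ _ (`|f y - f x|%:E + (`|f x| * (mdist x y / r))%:E)%E).
  by rewrite -EFinD lee_fin cut_dist.
apply: leeD; first exact: slope_sup_dist.
by rewrite -EFinM lee_fin mulrA mulrAC.
Qed.

End cutoff.

Section lip_bound.
Context {R : realType} {X : pMetricType R}.

(** Continuity of [G] turns the maximum over both ends of a step into the value at
    [x]. *)
Lemma lip_le_continuous (f G : X -> R) (d : R) x : 0 < d -> 0 <= G x ->
  {for x, continuous G} ->
  (forall y, mdist x y < d -> `|f y - f x| <= Num.max (G x) (G y) * mdist x y) ->
  (lip f x <= (G x)%:E)%E.
Proof.
move=> d0 Gx0 cG h; apply/lee_addgt0Pr => e e0.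
have := cG; move=> /cvgrPdist_lt/(_ e e0)/nbhs_ballP[d' /= d'0 hd'].
have m0 : 0 < Num.min d d' by rewrite lt_min d0.
apply: le_trans (lip_le_slope f x m0) _.
apply: slope_sup_le; first by rewrite -EFinD lee_fin addr_ge0// ltW.
move=> y; rewrite lt_min => /andP[yd yd'].
rewrite -EFinD -EFinM lee_fin; apply: le_trans (h y yd) _.
apply: ler_wpM2r; first exact: mdist_ge0.
have /hd' : ball x d' y by rewrite ballEmdist.
move=> /=; rewrite ltr_norml => /andP[h1 h2].
by rewrite ge_max; apply/andP; split; lra.
Qed.

End lip_bound.

(** * Lipschitz approximation of lower semicontinuous weights *)

Section bump.
Context {R : realType} {X : pMetricType R}.
Implicit Types (O : set X) (n : nat) (x y : X).

(** An [n]-Lipschitz function that increases with [n] to the indicator of an open set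
    [O]; the element 1 is the cap, and makes the infimum meaningful when [O] is the
    whole space. *)
Definition bump O n x : R :=
  inf (1 |` [set n%:R * mdist x y | y in ~` O]).

Let bump_lbound O n x : lbound (1 |` [set n%:R * mdist x y | y in ~` O]) 0.
Proof. by move=> _ [->|[y _ <-]] //; rewrite mulr_ge0// mdist_ge0. Qed.

Let bump_has_inf O n x : has_inf (1 |` [set n%:R * mdist x y | y in ~` O]).
Proof. by split; [exists 1; left|exists 0; exact: bump_lbound]. Qed.

Lemma bump_ge0 O n x : 0 <= bump O n x.
Proof. by apply: lb_le_inf; [exists 1; left|exact: bump_lbound]. Qed.

Lemma bump_le1 O n x : bump O n x <= 1.
Proof. by apply: ge_inf; [case: (bump_has_inf O n x)|left]. Qed.

Lemma bump_le_dist O n x y : ~ O y -> bump O n x <= n%:R * mdist x y.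
Proof. by move=> Oy; apply: ge_inf; [case: (bump_has_inf O n x)|right; exists y]. Qed.

Lemma bump_ge O n x (v : R) : v <= 1 -> (forall y, ~ O y -> v <= n%:R * mdist x y) ->
  v <= bump O n x.
Proof.
move=> v1 h; apply: lb_le_inf; first by exists 1; left.
by move=> _ [->|[y Oy <-]] //; exact: h.
Qed.

Lemma bump_out O n x : ~ O x -> bump O n x = 0.
Proof.
move=> Ox; apply/eqP; rewrite eq_le bump_ge0 andbT.
by have := bump_le_dist n x Ox; rewrite mdistxx mulr0.
Qed.

Lemma bump_eq1 O n x : (forall y, ~ O y -> 1 <= n%:R * mdist x y) -> bump O n x = 1.
Proof. by move=> h; apply/eqP; rewrite eq_le bump_le1 bump_ge. Qed.

Lemma bump_homo O n n' x : (n <= n')%N -> bump O n x <= bump O n' x.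
Proof.
move=> nn; apply: bump_ge; first exact: bump_le1.
move=> y Oy; apply: le_trans (bump_le_dist n x Oy) _.
by rewrite ler_wpM2r ?mdist_ge0// ler_nat.
Qed.

Lemma bump_lipschitz O n x y : bump O n x <= bump O n y + n%:R * mdist x y.
Proof.
rewrite -lerBlDr; apply: bump_ge.
  have h : 0 <= n%:R * mdist x y by rewrite mulr_ge0 ?mdist_ge0.
  by have := bump_le1 O n x; lra.
move=> z Oz; rewrite lerBlDr -mulrDr; apply: le_trans (bump_le_dist n x Oz) _.
by rewrite ler_wpM2l// addrC metric_triangle.
Qed.

Lemma bump_near1 O x : open O -> O x ->
  exists N, forall n, (N <= n)%N -> bump O n x = 1.
Proof.
move=> oO Ox; have : nbhs x O by exact: open_nbhs_nbhs.
move=> /nbhs_ballP[e /= e0 he].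
exists (Num.truncn e^-1).+1 => n Nn; apply: bump_eq1 => y Oy.
have ey : e <= mdist x y.
  by rewrite leNgt; apply/negP => h; apply: Oy; apply: he; rewrite ballEmdist.
have n1 : e^-1 <= n%:R.
  by apply: ltW; apply: lt_le_trans (truncnS_gt _) _; rewrite ler_nat.
apply: (@le_trans _ _ (e^-1 * e)); first by rewrite mulVf// gt_eqF.
by apply: ler_pM => //; [rewrite invr_ge0 ltW|exact: ltW].
Qed.

Variables (b : nat -> R) (O_ : nat -> set X).
Hypothesis b0 : forall k, 0 <= b k.

(** The increasing Lipschitz approximations of the lower semicontinuous function
    whose value is the supremum of the [b k] over the [k] with [x] in [O_ k]. *)
Definition weight n x : R := \big[Num.max/0]_(k < n) (b k * bump (O_ k) n x).

Lemma weight_ge0 n x : 0 <= weight n x.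
Proof. exact: bigmax_ge_id. Qed.

Lemma weight_ge n k x : (k < n)%N -> b k * bump (O_ k) n x <= weight n x.
Proof. by move=> kn; rewrite /weight; apply: (le_bigmax _ _ (Ordinal kn)). Qed.

Lemma weight_le n x (v : R) : 0 <= v -> (forall k, O_ k x -> b k <= v) -> weight n x <= v.
Proof.
move=> v0 h; apply/bigmax_leP; split => // k _.
have [Ox|Ox] := pselect (O_ k x).
  by apply: le_trans (h k Ox); rewrite ler_piMr// bump_le1.
by rewrite bump_out// mulr0.
Qed.

Lemma weight_homo n n' x : (n <= n')%N -> weight n x <= weight n' x.
Proof.
move=> nn; apply/bigmax_leP; split; first exact: weight_ge0.
move=> k _; have kn' : (k < n')%N by exact: leq_trans nn.
by apply: le_trans (weight_ge x kn'); rewrite ler_wpM2l// bump_homo.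
Qed.

Lemma weight_near x k : open (O_ k) -> O_ k x -> exists n, b k <= weight n x.
Proof.
move=> oO /(bump_near1 oO)[N hN]; exists (maxn N k.+1).
have := weight_ge x (leq_maxr N k.+1); rewrite hN ?mulr1//.
exact: leq_maxl.
Qed.

Lemma weight_bounded n : exists2 C, 0 < C & forall x, weight n x <= C.
Proof.
exists (1 + \big[Num.max/0]_(k < n) b k).
  by rewrite ltr_wpDr// bigmax_ge_id.
move=> x; apply/bigmax_leP; split; first by rewrite addr_ge0// bigmax_ge_id.
move=> k _; apply: (@le_trans _ _ (b k)); first by rewrite ler_piMr// bump_le1.
by apply: le_trans (le_bigmax 0 (fun i : 'I_n => b i) k) _; rewrite lerDr.
Qed.

Lemma weight_lipschitz n : exists2 C, 0 < C &
  forall x y, `|weight n x - weight n y| <= C * mdist x y.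
Proof.
set B := \big[Num.max/0]_(k < n) b k.
have B0 : 0 <= B by exact: bigmax_ge_id.
exists (1 + B * n%:R); first by rewrite ltr_wpDr// mulr_ge0.
have key x y : weight n x <= weight n y + (1 + B * n%:R) * mdist x y.
  apply/bigmax_leP; split.
    by rewrite addr_ge0 ?weight_ge0// mulr_ge0 ?mdist_ge0// addr_ge0// mulr_ge0.
  move=> k _; apply: (@le_trans _ _ (b k * bump (O_ k) n y + b k * (n%:R * mdist x y))).
    by rewrite -mulrDr ler_wpM2l// bump_lipschitz.
  apply: lerD; first exact: weight_ge.
  rewrite mulrA; apply: ler_wpM2r; first exact: mdist_ge0.
  apply: (@le_trans _ _ (B * n%:R)); last by rewrite lerDr.
  by apply: ler_wpM2r => //; exact: (le_bigmax 0 (fun i : 'I_n => b i) k).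
move=> x y; rewrite ler_norml; apply/andP; split.
  by have := key y x; rewrite metric_sym; lra.
by have := key x y; lra.
Qed.

End bump.

(** * Infimal cost of chains *)

Section chain_infimum.
Context {R : realType} {X : pMetricType R}.
Implicit Types (G : X -> R) (q : nat -> X).

Definition chain_cost G q N : R := \sum_(i < N) G (q i) * mdist (q i) (q i.+1).

Lemma chain_cost_ge0 G q N : (forall x, 0 <= G x) -> 0 <= chain_cost G q N.
Proof. by move=> G0; apply: sumr_ge0 => i _; rewrite mulr_ge0// mdist_ge0. Qed.

Lemma chain_cost_le G G' q N : (forall x, G x <= G' x) ->
  chain_cost G q N <= chain_cost G' q N.
Proof. by move=> GG; apply: ler_sum => i _; rewrite ler_wpM2r// mdist_ge0. Qed.

Variables (K : set X) (u : X -> R) (M : R).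
Hypothesis uM : forall x, K x -> - M <= u x.
Hypothesis M0 : 0 <= M.

Definition chain_values G (d : R) (x : X) : set R :=
  [set v | exists N q, [/\ K (q 0%N), q N = x, is_chain d N q &
    v = u (q 0%N) + chain_cost G q N]].

(** The cap [M] is also the value at the points that no chain from [K] reaches; it
    makes the function Lipschitz at distances larger than the mesh. *)
Definition chain_inf G (d : R) (x : X) : R := inf (M |` chain_values G d x).

Section fixed.
Variables (G : X -> R) (d : R).
Hypothesis G0 : forall x, 0 <= G x.
Hypothesis d0 : 0 < d.

Let lb x : lbound (M |` chain_values G d x) (- M).
Proof.
move=> _ [->|[N [q [Kq _ _ ->]]]]; first by rewrite ge0_cp.
by apply: le_trans (uM Kq) _; rewrite lerDl chain_cost_ge0.
Qed.

Let hi x : has_inf (M |` chain_values G d x).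
Proof. by split; [exists M; left|exists (- M); exact: lb]. Qed.

Lemma chain_inf_ge x : - M <= chain_inf G d x.
Proof. by apply: lb_le_inf; [exists M; left|exact: lb]. Qed.

Lemma chain_inf_le x : chain_inf G d x <= M.
Proof. by apply: ge_inf; [case: (hi x)|left]. Qed.

Lemma chain_inf_norm x : `|chain_inf G d x| <= M.
Proof. by rewrite ler_norml chain_inf_ge chain_inf_le. Qed.

Lemma chain_inf_le_chain N q : K (q 0%N) -> is_chain d N q ->
  chain_inf G d (q N) <= u (q 0%N) + chain_cost G q N.
Proof. by move=> Kq cq; apply: ge_inf; [case: (hi (q N))|right; exists N, q]. Qed.

Lemma chain_inf_le_start x : K x -> chain_inf G d x <= u x.
Proof.
move=> Kx; have := @chain_inf_le_chain 0 (fun=> x) Kx.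
by rewrite /chain_cost big_ord0 addr0; apply.
Qed.

Lemma chain_inf_lt x v : chain_inf G d x < v -> v <= M ->
  exists N q, [/\ K (q 0%N), q N = x, is_chain d N q &
    u (q 0%N) + chain_cost G q N < v].
Proof.
move=> xv vM; have := inf_lt (hi x).1 xv.
move=> [_ [->|[N [q [Kq qN cq ->]]]] h]; first by move: h; rewrite ltNge vM.
by exists N, q.
Qed.

(** A chain to [x] extends to [y] by one step, which costs [G x * mdist x y]. *)
Lemma chain_inf_step x y : mdist x y <= d ->
  chain_inf G d y <= chain_inf G d x + G x * mdist x y.
Proof.
move=> xy; rewrite -lerBlDr; apply: lb_le_inf; first by exists M; left.
move=> _ [->|[N [q [Kq qN cq ->]]]].
  by have := chain_inf_le y; have := mulr_ge0 (G0 x) (mdist_ge0 x y); lra.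
pose q' i := if (i <= N)%N then q i else y.
have q'0 : q' 0%N = q 0%N by rewrite /q'.
have cq' : is_chain d N.+1 q'.
  move=> i; rewrite ltnS leq_eqVlt => /predU1P[->|iN].
    by rewrite /q' leqnn ltnn qN.
  by rewrite /q' iN (ltnW iN); exact: cq.
have cE : chain_cost G q' N.+1 = chain_cost G q N + G x * mdist x y.
  rewrite /chain_cost big_ord_recr/=; congr (_ + _).
    by apply: eq_bigr => i _; rewrite /q' (ltnW (ltn_ord i)) ltn_ord.
  by rewrite /q' leqnn ltnn qN.
have := @chain_inf_le_chain N.+1 q'; rewrite q'0 => /(_ Kq cq').
by rewrite cE {1}/q' ltnn; lra.
Qed.

Lemma chain_inf_dist x y : mdist x y <= d ->
  `|chain_inf G d y - chain_inf G d x| <= Num.max (G x) (G y) * mdist x y.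
Proof.
move=> xy; have h1 := chain_inf_step xy.
have xy' := xy; rewrite metric_sym in xy'; have h2 := chain_inf_step xy'.
rewrite (metric_sym y x) in h2.
have m1 : G x * mdist x y <= Num.max (G x) (G y) * mdist x y.
  by rewrite ler_wpM2r ?mdist_ge0// le_max lexx.
have m2 : G y * mdist x y <= Num.max (G x) (G y) * mdist x y.
  by rewrite ler_wpM2r ?mdist_ge0// le_max lexx orbT.
by rewrite ler_norml; apply/andP; split; lra.
Qed.

Lemma chain_inf_lipschitz : (exists2 C, 0 < C & forall x, G x <= C) ->
  is_lipschitz (chain_inf G d).
Proof.
move=> [C C0 GC]; exists (C + 2 * M / d) => x y.
have t0 : 0 <= 2 * M / d by rewrite divr_ge0 ?mulr_ge0// ltW.
have [xy|xy] := leP (mdist y x) d.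
  apply: le_trans (chain_inf_dist xy) _; rewrite metric_sym.
  rewrite ler_wpM2r ?mdist_ge0//.
  by rewrite ge_max; have := GC x; have := GC y; move=> ? ?; apply/andP; split; lra.
apply: (@le_trans _ _ (2 * M)).
  have := chain_inf_norm x; have := chain_inf_norm y.
  by have := ler_normB (chain_inf G d x) (chain_inf G d y); lra.
rewrite metric_sym; apply: (@le_trans _ _ (2 * M / d * d)).
  by rewrite divfK// gt_eqF.
apply: ler_pM => //; [exact: ltW| |exact: ltW].
by rewrite lerDr ltW.
Qed.

Lemma lip_chain_inf x : {for x, continuous G} -> (lip (chain_inf G d) x <= (G x)%:E)%E.
Proof.
move=> cG; apply: (lip_le_continuous d0 (G0 x) cG) => y xy.
by apply: chain_inf_dist; exact: ltW.
Qed.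

End fixed.

Lemma chain_inf_homo G G' (d d' : R) x : (forall x, 0 <= G x) ->
  (forall x, G x <= G' x) -> d' <= d -> chain_inf G d x <= chain_inf G' d' x.
Proof.
move=> G0 GG dd; apply: lb_le_inf; first by exists M; left.
move=> _ [->|[N [q [Kq <- cq ->]]]]; first exact: chain_inf_le.
apply: (@le_trans _ _ (u (q 0%N) + chain_cost G q N)).
  by apply: chain_inf_le_chain => // i iN; apply: le_trans (cq i iN) dd.
by rewrite lerD2l chain_cost_le.
Qed.

End chain_infimum.

(** * Ultralimits of chains *)

Section ultra.

Lemma ultra_fmap (S T : Type) (f : S -> T) (F : set_system S) :
  UltraFilter F -> UltraFilter (f @ F).
Proof.
move=> FU; split; first exact: fmap_proper_filter.
move=> G GF sFG; rewrite predeqE => A; split; last exact: sFG.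
move=> GA; have [//|FnA] := in_ultra_setVsetC (f @^-1` A) FU.
have GnA : G (~` A) by apply: sFG.
by have /filter_ex [? []] : G (A `&` (~` A)) by exact: filterI.
Qed.

Context {R : realType} {X : pMetricType R}.
Variables (U : set_system nat).
Hypothesis UU : UltraFilter U.

Lemma ultra_compact_cvg (T : topologicalType) (K : set T) (y : nat -> T) :
  compact K -> U [set n | K (y n)] -> exists2 l, K l & y @ U --> l.
Proof.
move=> cK Ky; have := cK; rewrite compact_ultra => /(_ (y @ U)) h.
by have [l [Kl yl]] := h (ultra_fmap y UU) Ky; exists l.
Qed.

Lemma ultra_cvg_dist (y : nat -> X) l (e : R) : y @ U --> l -> 0 < e ->
  U [set n | mdist l (y n) < e].
Proof.
move=> yl e0; have : U (y @^-1` ball l e) := yl _ (nbhsx_ballx l e e0).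
by apply: filterS => n /=; rewrite ballEmdist.
Qed.

(** Nearby points in a compact set converge along the ultrafilter, so the image of
    the ultrafilter contains a ball of radius [e] for every [e], and is Cauchy. *)
Lemma ultra_close_cvg (y : nat -> X) : complete_space X ->
  (forall e : R, 0 < e -> exists2 K : set X, compact K &
    U [set n | exists2 z, K z & mdist (y n) z < e]) ->
  exists l : X, y @ U --> l.
Proof.
move=> cX h; suff : cvg (y @ U) by move=> /cvg_ex.
apply: cX; apply: cauchy_exP => e e0.
have e20 : 0 < e / 2 by rewrite divr_gt0.
have [K cK Ky] := h _ e20.
have /choice[z zP] : forall n, exists w,
    (exists2 z, K z & mdist (y n) z < e / 2) -> K w /\ mdist (y n) w < e / 2.
  move=> n; have [[w Kw yw]|no] := pselect (exists2 z, K z & mdist (y n) z < e / 2).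
    by exists w.
  by exists point.
have [|l Kl zl] := @ultra_compact_cvg _ K z cK.
  by apply: filterS Ky => n /zP [].
exists l; have := ultra_cvg_dist zl e20; rewrite /fmap/=.
apply: filterS2 Ky => n /zP[_ yz] /= lz; rewrite ballEmdist /=.
by have := metric_triangle l (z n) (y n); rewrite (metric_sym (z n)); lra.
Qed.

End ultra.

Section step_path.
Context {R : realType} {X : pMetricType R}.
Variables (q : nat -> X) (N : nat) (h : R).
Hypothesis h0 : 0 <= h.
Hypothesis qh : is_chain h N q.

Definition chain_time i : R := \sum_(j < i) mdist (q j) (q j.+1).

Lemma chain_timeS i : chain_time i.+1 = chain_time i + mdist (q i) (q i.+1).
Proof. by rewrite /chain_time big_ord_recr. Qed.

Lemma chain_time_homo i j : (i <= j)%N -> chain_time i <= chain_time j.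
Proof.
elim: j => [|j ih]; first by rewrite leqn0 => /eqP ->.
rewrite leq_eqVlt => /predU1P[->//|]; rewrite ltnS => /ih h1.
by rewrite chain_timeS (le_trans h1)// lerDl mdist_ge0.
Qed.

Lemma chain_time_ge0 i : 0 <= chain_time i.
Proof. by apply: sumr_ge0 => j _; exact: mdist_ge0. Qed.

Lemma chain_dist_le_time i j : (i <= j)%N -> mdist (q i) (q j) <= chain_time j - chain_time i.
Proof.
elim: j => [|j ih]; first by rewrite leqn0 => /eqP ->; rewrite mdistxx subrr.
rewrite leq_eqVlt => /predU1P[->|]; first by rewrite mdistxx subrr.
rewrite ltnS => /ih h1; rewrite chain_timeS.
by have := metric_triangle (q i) (q j) (q j.+1); lra.
Qed.

Let index_exists t : 0 <= t -> exists k, [/\ (k <= N)%N, chain_time k <= t &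
  (k = N \/ t < chain_time k.+1)].
Proof.
move=> t0; elim: N => [|n [k [kn kt h1]]].
  by exists 0%N; split => //; [rewrite /chain_time big_ord0|left].
have [lt|ge] := ltP t (chain_time k.+1).
  by exists k; split => //; [exact: leqW|right].
case: h1 => [E|]; last by rewrite ltNge ge.
by exists n.+1; rewrite -E; split => //; left.
Qed.

(** The chain run through at unit speed: at time [t] the path is at the last point
    whose time does not exceed [t]. Its jumps have size at most [h], so it is
    1-Lipschitz up to [h]. *)
Lemma step_path : exists c : R -> X, [/\
  forall t i, 0 <= t -> (i <= N)%N -> mdist (q i) (c t) <= `|chain_time i - t| + h,
  forall s t, 0 <= s -> 0 <= t -> mdist (c s) (c t) <= `|s - t| + h &
  forall t, 0 <= t -> exists2 i, (i <= N)%N & c t = q i].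
Proof.
have /choice[k kP] : forall t, exists k, 0 <= t -> [/\ (k <= N)%N, chain_time k <= t &
    (k = N \/ t < chain_time k.+1)].
  move=> t; have [t0|t0] := leP 0 t; last by exists 0%N.
  by have [k kP] := index_exists t0; exists k.
exists (q \o k); split.
- move=> t i t0 iN /=; have [kN kt kS] := kP t t0.
  have [ik|ki] := leqP i (k t).
    apply: le_trans (chain_dist_le_time ik) _.
    rewrite distrC; have := ler_norm (t - chain_time i).
    by have := h0; lra.
  rewrite metric_sym; apply: le_trans (chain_dist_le_time (ltnW ki)) _.
  case: kS => [E|kS]; first by move: ki; rewrite E ltnNge iN.
  have := chain_timeS (k t); have := qh (leq_trans ki iN).
  by have := ler_norm (chain_time i - t); lra.
- move=> s t.
  wlog st : s t / s <= t => [wlg s0 t0|].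
    have [st|ts] := leP s t; first exact: wlg.
    by rewrite metric_sym distrC wlg// ltW.
  move=> s0 t0 /=; have [kN kt kS] := kP t t0; have [jN js jS] := kP s s0.
  rewrite distrC ger0_norm ?subr_ge0//.
  case: jS => [E|jS].
    have kN' : k t = N.
      case: kS => // kS; apply/eqP; rewrite eqn_leq kN leqNgt; apply/negP => kltN.
      have := chain_time_homo kltN; rewrite -E; lra.
    by rewrite E kN' mdistxx addr_ge0// subr_ge0.
  have [jk|kj] := leqP (k s) (k t).
    apply: le_trans (chain_dist_le_time jk) _.
    have [<-|jnN] := eqVneq (k s) (k t); first by have := h0; lra.
    have jltN : (k s < N)%N by apply: leq_trans kN; rewrite ltn_neqAle jnN.
    by have := chain_timeS (k s); have := qh jltN; lra.
  case: kS => [E|kS]; first by move: kj; rewrite E ltnNge jN.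
  by have := chain_time_homo kj; lra.
- by move=> t t0; have [kN _ _] := kP t t0; exists (k t).
Qed.

End step_path.

Section chain_compactness.
Context {R : realType} {X : pMetricType R}.
Implicit Types (G : X -> R) (q : nat -> X).

Lemma chain_cost_segment G q N i j (B : R) : (forall x, 0 <= G x) -> 0 <= B ->
  (i <= j)%N -> (j <= N)%N ->
  (forall l, (i <= l)%N -> (l < j)%N -> B <= G (q l)) ->
  B * mdist (q i) (q j) <= chain_cost G q N.
Proof.
move=> G0 B0 ij jN hB; apply: (@le_trans _ _ (chain_cost G q j)); last first.
  elim: N jN => [|n ih]; first by rewrite leqn0 => /eqP ->.
  rewrite leq_eqVlt => /predU1P[->//|]; rewrite ltnS => /ih h.
  by rewrite /chain_cost big_ord_recr/= -/(chain_cost G q n) (le_trans h)// lerDl mulr_ge0// mdist_ge0.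
elim: j ij {jN} hB => [|j ih].
  by rewrite leqn0 => /eqP -> _; rewrite mdistxx mulr0 chain_cost_ge0.
rewrite leq_eqVlt => /predU1P[->|].
  by rewrite mdistxx mulr0 chain_cost_ge0.
rewrite ltnS => ij hB.
have h1 := ih ij (fun l il lj => hB l il (ltnW lj)).
rewrite /chain_cost big_ord_recr/= -/(chain_cost G q j).
apply: (@le_trans _ _ (B * (mdist (q i) (q j) + mdist (q j) (q j.+1)))).
  by rewrite ler_wpM2l// metric_triangle.
by rewrite mulrDr lerD// ler_wpM2r ?mdist_ge0// hB.
Qed.

(** A chain that ends in [K'] and leaves its [2 * eta]-neighbourhood has to travel a
    distance [eta] at points where [G] is at least [B], which costs [B * eta]. *)
Lemma chain_stays_close G q N (K' : set X) (B eta : R) : (forall x, 0 <= G x) ->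
  0 <= B -> (forall y, (forall z, K' z -> eta <= mdist y z) -> B <= G y) ->
  K' (q N) -> 0 < eta -> chain_cost G q N < B * eta ->
  forall i, (i <= N)%N -> exists2 z, K' z & mdist (q i) z < 2 * eta.
Proof.
move=> G0 B0 hB KN eta0 hcost i iN; apply: contrapT => far.
have far' z : K' z -> 2 * eta <= mdist (q i) z.
  by move=> Kz; rewrite leNgt; apply/negP => h; apply: far; exists z.
pose P j := (i <= j)%N && `[< exists2 z, K' z & mdist (q j) z < eta >].
have exP : exists j, P j.
  exists N; rewrite /P iN /=; apply/asboolP; exists (q N) => //.
  by rewrite mdistxx.
case: (ex_minnP exP) => j /andP[ij /asboolP[z Kz jz]] jmin.
have jN : (j <= N)%N.
  apply: jmin; rewrite /P iN /=; apply/asboolP; exists (q N) => //.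
  by rewrite mdistxx.
have : B * mdist (q i) (q j) <= chain_cost G q N.
  apply: chain_cost_segment => // l il lj; apply: hB => w Kw.
  rewrite leNgt; apply/negP => h.
  have : (j <= l)%N by apply: jmin; rewrite /P il /=; apply/asboolP; exists w.
  by rewrite leqNgt lj.
have : eta <= mdist (q i) (q j).
  by have := far' z Kz; have := metric_triangle (q i) (q j) z; lra.
by move=> /(ler_wpM2l B0); lra.
Qed.

End chain_compactness.

Section limit_curve.
Context {R : realType} {X : pMetricType R}.
Variables (U : set_system nat) (UU : UltraFilter U).
Variables (q : nat -> nat -> X) (N : nat -> nat) (h : nat -> R) (L : R).
Hypothesis Xcomplete : complete_space X.
Hypothesis h0 : forall n, 0 <= h n.
Hypothesis hU : forall e : R, 0 < e -> U [set n | h n < e].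
Hypothesis qchain : forall n, is_chain (h n) (N n) (q n).
Hypothesis timeL : U [set n | chain_time (q n) (N n) <= L].
Hypothesis qclose : forall e : R, 0 < e -> exists2 K : set X, compact K &
  U [set n | forall i, (i <= N n)%N -> exists2 z, K z & mdist (q n i) z < e].

(** The unit speed paths of the chains converge at every time by [ultra_close_cvg],
    and being uniformly almost 1-Lipschitz they converge uniformly. The ultrafilter
    replaces the extraction of a subsequence. *)
Lemma limit_curve : exists (l : R) (c : R -> X), [/\ 0 <= l,
  forall e : R, 0 < e -> U [set n | `|l - chain_time (q n) (N n)| < e],
  forall s t, 0 <= s -> 0 <= t -> mdist (c s) (c t) <= `|s - t| &
  forall e : R, 0 < e -> U [set n | forall i t, (i <= N n)%N -> 0 <= t -> t <= l ->
    mdist (q n i) (c t) < `|chain_time (q n) i - t| + e]].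
Proof.
have [l /= lL lU] : exists2 l, `[0, L]%classic l & (fun n => chain_time (q n) (N n)) @ U --> l.
  apply: (ultra_compact_cvg UU (@segment_compact _ 0 L)).
  by apply: filterS timeL => n /= hn; rewrite in_itv/= chain_time_ge0.
rewrite in_itv/= in lL; case/andP: lL => l0 lL.
have /choice[cn cnP] : forall n, exists c : R -> X, [/\
  forall t i, 0 <= t -> (i <= N n)%N -> mdist (q n i) (c t) <= `|chain_time (q n) i - t| + h n,
  forall s t, 0 <= s -> 0 <= t -> mdist (c s) (c t) <= `|s - t| + h n &
  forall t, 0 <= t -> exists2 i, (i <= N n)%N & c t = q n i].
  by move=> n; apply: step_path.
have /choice[c cP] : forall t, exists y : X, 0 <= t -> (cn ^~ t) @ U --> y.
  move=> t; have [t0|t0] := leP 0 t; last by exists point.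
  have [e e0|y yl] := @ultra_close_cvg _ _ U UU (cn ^~ t) Xcomplete.
    have [K cK KU] := qclose e0; exists K => //; apply: filterS KU => n Kn /=.
    by have [_ _ /(_ t t0)[i iN ->]] := cnP n; exact: Kn.
  by exists y.
have clip s t : 0 <= s -> 0 <= t -> mdist (c s) (c t) <= `|s - t|.
  move=> s0 t0; apply/ler_addgt0Pr => e e0.
  have e30 : 0 < e / 3 by rewrite divr_gt0.
  have [n [[/= hs ht] hh]] : exists n, ([set n | mdist (c s) (cn n s) < e / 3] `&`
      [set n | mdist (c t) (cn n t) < e / 3] `&` [set n | h n < e / 3]) n.
    apply: (@filter_ex _ U); apply: filterI; last exact: hU.
    apply: filterI.
      by apply: (@ultra_cvg_dist _ _ _ _ (cn ^~ s)) => //; exact: cP.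
    by apply: (@ultra_cvg_dist _ _ _ _ (cn ^~ t)) => //; exact: cP.
  have [_ /(_ s t s0 t0) hst _] := cnP n.
  have := metric_triangle (c s) (cn n s) (c t).
  have := metric_triangle (cn n s) (cn n t) (c t).
  by rewrite (metric_sym (cn n t) (c t)) /= in hh *; lra.
exists l, c; split => //.
  move=> e e0; have := lU => /cvgrPdist_lt/(_ e e0).
  by apply: filterS.
move=> e e0; have e40 : 0 < e / 4 by rewrite divr_gt0.
(* the paths are almost 1-Lipschitz, so finitely many times suffice *)
have net J : U [set n | forall j, (j < J)%N ->
    mdist (c (j%:R * (e / 4))) (cn n (j%:R * (e / 4))) < e / 4].
  elim: J => [|J ih]; first by apply: filterS filterT.
  have tJ0 : 0 <= J%:R * (e / 4) by rewrite mulr_ge0// ltW.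
  have : U [set n | mdist (c (J%:R * (e / 4))) (cn n (J%:R * (e / 4))) < e / 4].
    by apply: (@ultra_cvg_dist _ _ _ _ (cn ^~ (J%:R * (e / 4)))) => //; exact: cP.
  apply: filterS2 ih => n hn hJ j; rewrite ltnS leq_eqVlt => /predU1P[->//|].
  exact: hn.
pose J := (Num.truncn (l / (e / 4))).+1.
have := hU e40; apply: filterS2 (net J) => n hnet hn i t iN t0 tl.
have [h1 h2 _] := cnP n.
pose j := Num.truncn (t / (e / 4)).
have jJ : (j < J)%N.
  by rewrite /j /J ltnS; apply: le_truncn; rewrite ler_pM2r// invr_gt0.
have te0 : 0 <= t / (e / 4) by rewrite divr_ge0// ltW.
have /andP[j1 j2] := truncn_itv te0.
rewrite ler_pdivlMr// in j1; rewrite ltr_pdivrMr// in j2.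
have jt : `|t - j%:R * (e / 4)| <= e / 4.
  rewrite ger0_norm ?subr_ge0//.
  by move: j2; rewrite -/j -natr1 mulrDl mul1r; lra.
have tj0 : 0 <= j%:R * (e / 4) by rewrite mulr_ge0// ltW.
have a1 := hnet j jJ; rewrite metric_sym in a1.
have a2 := clip _ _ tj0 t0; rewrite distrC in a2.
have a3 := h1 (j%:R * (e / 4)) i tj0 iN.
have a4 := ler_distD t (chain_time (q n) i) (j%:R * (e / 4)).
have a5 := metric_triangle (q n i) (cn n (j%:R * (e / 4))) (c t).
have a6 := metric_triangle (cn n (j%:R * (e / 4))) (c (j%:R * (e / 4))) (c t).
by move: hn => /=; lra.
Qed.

End limit_curve.

(** * Convergence of the infimal costs *)

Section chain_inf_convergence.
Context {R : realType} {X : pMetricType R}.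
Variables (K : set X) (u : X -> R) (M : R) (b : nat -> R) (O_ : nat -> set X).
Variable (g : X -> \bar R).
Hypothesis Xcomplete : complete_space X.
Hypothesis cK : compact K.
Hypothesis M0 : 0 <= M.
Hypothesis uM : forall x, K x -> `|u x| <= M.
Hypothesis u_lsc : forall x (e : R), K x -> 0 < e ->
  exists2 d, 0 < d & forall y, K y -> mdist x y < d -> u x - e < u y.
Hypothesis b0 : forall k, 0 <= b k.
Hypothesis b_const : exists2 k, 0 < b k & O_ k = setT.
Hypothesis b_penalty : forall e : R, 0 < e -> exists k (K' : set X),
  [/\ compact K', K `<=` K', O_ k = ~` K' & 2 * M < b k * e].
Hypothesis mg : borel_fun g.
Hypothesis g0 : forall x, (0 <= g x)%E.
Hypothesis gb : forall x, (g x <= ereal_sup (range (fun n => (weight b O_ n x)%:E)))%E.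
Hypothesis ug : forall a' b' c, rectifiable a' b' c -> K (c a') -> K (c b') ->
  (`|u (c b') - u (c a')|%:E <= curve_integral g a' b' c)%E.

Local Notation G := (weight b O_).
Local Notation f := (fun n => chain_inf K u M (G n) n.+1%:R^-1).

Lemma borel_weight n : borel_fun (G n).
Proof.
apply: lipschitz_borel; have [C _ hC] := weight_lipschitz O_ b0 n.
by exists C.
Qed.

(** If the infima stayed below [u x - D], nearly optimal chains would have bounded
    cost. The constant weight bounds their lengths, and the penalties keep them close
    to compact sets, so they have a limit curve from [K] to [x]. The integral of each
    weight along this curve is at most the limit of the costs, by uniform convergence,
    hence so is the integral of [g] by monotone convergence; as [u] is lower
    semicontinuous on [K] at the start of the curve, this contradicts [ug]. *)
Lemma chain_inf_cvg_lower x (D : R) : K x -> 0 < D ->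
  exists n0, forall n, (n0 <= n)%N -> u x - D < f n x.
Proof.
move=> Kx D0.
have uM' y : K y -> - M <= u y by move=> /uM; rewrite ler_norml => /andP[].
have G0 n y : 0 <= G n y by exact: weight_ge0.
suff [n0 hn0] : exists n0, u x - D < f n0 x.
  exists n0 => n nn; apply: lt_le_trans hn0 _.
  apply: chain_inf_homo => //.
  - by move=> y; exact: weight_homo.
  - by rewrite lef_pV2 ?posrE ?ltr0n// ler_nat.
apply: contrapT => no.
have D20 : 0 < D / 2 by rewrite divr_gt0.
have /choice[Nq bad] : forall n, exists Nq : nat * (nat -> X),
    [/\ K (Nq.2 0%N), Nq.2 Nq.1 = x, is_chain n.+1%:R^-1 Nq.1 Nq.2 &
    u (Nq.2 0%N) + chain_cost (G n) Nq.2 Nq.1 < u x - D / 2].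
  move=> n; have [||N [q [h1 h2 h3 h4]]] := @chain_inf_lt R X K u M uM' M0 (G n) n.+1%:R^-1 (G0 n) x (u x - D / 2).
  - apply: (@le_lt_trans _ _ (u x - D)); last by lra.
    by rewrite leNgt; apply/negP => h; apply: no; exists n.
  - by have := uM Kx; rewrite ler_norml => /andP[_ ?]; lra.
  by exists (N, q).
pose q n := (Nq n).2; pose N n := (Nq n).1.
have Kq n : K (q n 0%N) by case: (bad n).
have qN n : q n (N n) = x by case: (bad n).
have qch n : is_chain n.+1%:R^-1 (N n) (q n) by case: (bad n).
have qcost n : u (q n 0%N) + chain_cost (G n) (q n) (N n) < u x - D / 2 by case: (bad n).
have cost2M n : chain_cost (G n) (q n) (N n) < 2 * M.
  have := qcost n; have := uM Kx; have := uM (Kq n).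
  by rewrite !ler_norml => /andP[? ?] /andP[? ?]; lra.
have [U [UU oU]] := @ultraFilterLemma nat \oo _.
have Uge n0 : U [set n | (n0 <= n)%N] by apply: oU; exact: nbhs_infty_ge.
have [k0 bk0 Ok0] := b_const.
have Gk0 n y : (k0 < n)%N -> b k0 <= G n y.
  move=> kn; have := weight_ge b O_ y kn; rewrite Ok0 bump_eq1 ?mulr1//.
  by move=> z [].
pose L := 2 * M / b k0.
have L0 : 0 <= L by rewrite divr_ge0 ?mulr_ge0.
have timeL : U [set n | chain_time (q n) (N n) <= L].
  apply: filterS (Uge k0.+1) => n /= kn; rewrite /L ler_pdivlMr//.
  apply: le_trans (ltW (cost2M n)); rewrite mulrC /chain_time mulr_sumr.
  by apply: ler_sum => i _; rewrite ler_wpM2r ?mdist_ge0// Gk0.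
have hU (e : R) : 0 < e -> U [set n | n.+1%:R^-1 < e].
  move=> e0; apply: filterS (Uge (Num.truncn e^-1)) => n /= hn.
  rewrite invf_plt ?posrE ?ltr0n//.
  by apply: lt_le_trans (truncnS_gt _) _; rewrite ler_nat.
have qclose (e : R) : 0 < e -> exists2 K' : set X, compact K' &
    U [set n | forall i, (i <= N n)%N -> exists2 z, K' z & mdist (q n i) z < e].
  move=> e0; have e20 : 0 < e / 2 by rewrite divr_gt0.
  have [k [K' [cK' KK' OK' bk]]] := b_penalty e20.
  exists K' => //; apply: filterS2 (Uge k.+1) (Uge (Num.truncn (e / 2)^-1).+1) => n /= kn he i iN.
  have := @chain_stays_close _ _ (G n) (q n) (N n) K' (b k) (e / 2) (G0 n) (b0 k).
  rewrite [2 * (e / 2)]mulrC divfK//; apply => //.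
  - move=> y hy; have := weight_ge b O_ y kn; rewrite OK' bump_eq1 ?mulr1//.
    move=> z /contrapT Kz; have n0 : 0 < n%:R :> R.
      by rewrite ltr0n; exact: leq_ltn_trans kn.
    rewrite mulrC -ler_pdivrMr// mul1r; apply: le_trans (hy z Kz).
    rewrite invf_ple ?posrE//; apply: ltW; apply: lt_le_trans (truncnS_gt _) _.
    by rewrite ler_nat.
  - by rewrite qN; exact: KK'.
  - exact: lt_trans (cost2M n) bk.
have [|l [c [l0 lU clip cU]]] := @limit_curve R X U UU q N (fun n => n.+1%:R^-1) L Xcomplete _ hU qch timeL qclose.
  by move=> n; rewrite invr_ge0.
have len_le s t : 0 <= s -> s <= t -> (curve_length s t c <= (t - s)%:E)%E.
  move=> s0 st; rewrite -[t - s]mul1r; apply: curve_length_lipschitz => // y z sy yz _.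
  have y0 := le_trans s0 sy.
  by rewrite mul1r; have := clip y z y0 (le_trans y0 yz); rewrite distrC ger0_norm// subr_ge0.
have rect : rectifiable 0 l c.
  split; last by apply: le_lt_trans (len_le 0 l (lexx _) l0) _; exact: ltry.
  split => //; rewrite continuous_subspace_in => t; rewrite inE => tl.
  apply/cvg_ballP => e e0.
  rewrite /= nearE /nbhs /= -(nbhs_subspace_in tl).
  apply/nbhs_ballP; exists e => // s ts sl.
  have {}ts : `|t - s| < e := ts.
  move: tl sl; rewrite /= !in_itv/= => /andP[t0 _] /andP[s0 _].
  by rewrite ballEmdist /=; apply: le_lt_trans (clip t s t0 s0) ts.
have [p0 Kp0 qp0] := @ultra_compact_cvg U UU X K (fun n => q n 0%N) cK (filterS (fun n _ => Kq n) filterT).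
have c0p : c 0 = p0.
  apply: mdist_positivity; apply/eqP; rewrite eq_le mdist_ge0 andbT.
  apply/ler_addgt0Pr => e e0; have e20 : 0 < e / 2 by rewrite divr_gt0.
  have [n [/= h1 h2]] : exists n, ([set n | mdist p0 (q n 0%N) < e / 2] `&`
      [set n | forall i t, (i <= N n)%N -> 0 <= t -> t <= l ->
      mdist (q n i) (c t) < `|chain_time (q n) i - t| + e / 2]) n.
    apply: (@filter_ex _ U); apply: filterI; last exact: cU.
    exact: (@ultra_cvg_dist _ _ _ UU (fun n => q n 0%N)).
  have := h2 0%N 0 isT (lexx 0) l0; rewrite /chain_time big_ord0 subrr normr0 add0r.
  have := metric_triangle (c 0) (q n 0%N) p0.
  by rewrite (metric_sym (q n 0%N) p0) (metric_sym (c 0) (q n 0%N)); lra.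
have clx : c l = x.
  apply: mdist_positivity; apply/eqP; rewrite eq_le mdist_ge0 andbT.
  apply/ler_addgt0Pr => e e0; have e20 : 0 < e / 2 by rewrite divr_gt0.
  have [n [/= h1 h2]] : exists n, ([set n | `|l - chain_time (q n) (N n)| < e / 2] `&`
      [set n | forall i t, (i <= N n)%N -> 0 <= t -> t <= l ->
      mdist (q n i) (c t) < `|chain_time (q n) i - t| + e / 2]) n.
    by apply: (@filter_ex _ U); apply: filterI; [exact: lU|exact: cU].
  have := h2 (N n) l (leqnn _) l0 (lexx l); rewrite qN distrC metric_sym; lra.
pose V := u x - u (c 0) - D / 4.
have cost_limit k : (curve_integral (fun y => (G k y)%:E) 0 l c <= V%:E)%E.
  have [C C0 GC] := weight_lipschitz O_ b0 k.
  have [B B0 GB] := weight_bounded O_ b0 k.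
  have D80 : 0 < D / 8 by rewrite divr_gt0.
  have C1 : 0 < 3 * C * L + B by rewrite ltr_wpDl// mulr_ge0// mulr_ge0// ltW.
  (* e1 bounds the mesh, the error in time and the uniform distance; each term of
     the Riemann sum is then off by 3 * C * e1, and the last piece costs B * e1 *)
  pose e1 := D / 8 / (3 * C * L + B).
  have e10 : 0 < e1 by rewrite divr_gt0.
  have e1E : (3 * C * L + B) * e1 = D / 8 by rewrite mulrC divfK// gt_eqF.
  have [d d0 hd] := u_lsc Kp0 D80.
  have [n [[[[[/= kn tL] he] hl] hp] hc]] : exists n, ([set n | (k <= n)%N] `&`
      [set n | chain_time (q n) (N n) <= L] `&` [set n | n.+1%:R^-1 < e1] `&`
      [set n | `|l - chain_time (q n) (N n)| < e1] `&`
      [set n | mdist p0 (q n 0%N) < d] `&`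
      [set n | forall i t, (i <= N n)%N -> 0 <= t -> t <= l ->
      mdist (q n i) (c t) < `|chain_time (q n) i - t| + e1]) n.
    apply: (@filter_ex _ U); repeat apply: filterI => //.
    - exact: hU.
    - exact: lU.
    - exact: (@ultra_cvg_dist _ _ _ UU (fun n => q n 0%N)).
    - exact: cU.
  have hu := hd _ (Kq n) hp.
  (* the times of the chain are cut at l, and l is added as the last one *)
  pose T := chain_time (q n).
  pose t i := if (i <= N n)%N then Num.min (T i) l else l.
  pose H i := if (i < N n)%N then G k (q n i) + 3 * C * e1 else B.
  have T0 i : 0 <= T i by exact: chain_time_ge0.
  have t0 i : 0 <= t i <= l.
    by rewrite /t; case: ifP => _; rewrite ?l0 ?lexx// le_min T0 l0 ge_min lexx orbT.
  have tS i : (i < (N n).+1)%N -> t i <= t i.+1.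
    rewrite /t ltnS => iN; rewrite iN; case: ifP => _; last by rewrite ge_min lexx orbT.
    rewrite le_min !ge_min lexx orbT andbT /T.
    by rewrite (@chain_time_homo _ _ (q n) i i.+1).
  have tlen i : (i < (N n).+1)%N -> fine (curve_length (t i) (t i.+1) c) <= t i.+1 - t i.
    move=> iN; have /andP[ti0 _] := t0 i; have /andP[_ til] := t0 i.+1.
    rewrite -lee_fin fineK; first exact: len_le ti0 (tS i iN).
    apply: curve_length_fin; first exact: tS.
    exact: (curve_length_sub rect ti0 (tS i iN) til).
  have len0 i : (i < (N n).+1)%N -> 0 <= fine (curve_length (t i) (t i.+1) c).
    by move=> iN; rewrite fine_ge0// curve_length_ge0// tS.
  have C3 : 0 < 3 * C * e1 by apply: mulr_gt0 => //; exact: mulr_gt0.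
  have H0 i : 0 <= H i.
    by rewrite /H; case: ifP => _; [apply: addr_ge0 => //; exact: ltW|exact: ltW].
  have := @curve_integral_le_bounds R X 0 l c rect (fun y => (G k y)%:E) t H (N n).+1.
  move=> /(_ _ _ _ _ tS (fun i _ => H0 i)) hint.
  apply: le_trans (hint _ _ _ _ _) _.
  - by apply/measurable_EFinP; exact: borel_weight.
  - by move=> y; rewrite lee_fin.
  - by rewrite /t /= /T /chain_time big_ord0 min_l.
  - by rewrite /t ltnn.
  - move=> i y iN /andP[y1 y2]; rewrite lee_fin /H; case: ifPn => [iN'|_]; last exact: GB.
    have /andP[ti0 _] := t0 i; have /andP[_ til] := t0 i.+1.
    have y0 := le_trans ti0 y1; have yl := le_trans y2 til.
    have hqc := hc i y (ltnW iN') y0 yl.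
    have Ty : `|T i - y| < 2 * e1.
      have TS : T i.+1 = T i + mdist (q n i) (q n i.+1) by rewrite /T chain_timeS.
      have TSd : mdist (q n i) (q n i.+1) < e1 := le_lt_trans (qch n i iN') he.
      have TN : T i <= T (N n) by apply: chain_time_homo; exact: ltnW.
      move: y1 y2; rewrite /t iN' (ltnW iN') le_min => y1 /andP[y2 _].
      move: hl; rewrite -/T ltr_norml => /andP[hl1 hl2].
      have := T0 i; move: y1; rewrite ge_min => /orP[y1|y1] _.
        by rewrite ltr_norml; apply/andP; split; lra.
      by rewrite ltr_norml; apply/andP; split; lra.
    have := GC (c y) (q n i); rewrite metric_sym.
    have := ler_norm (G k (c y) - G k (q n i)).
    have h3 : mdist (q n i) (c y) < 3 * e1 by apply: lt_trans hqc _; rewrite -/T; lra.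
    have : C * mdist (q n i) (c y) <= C * (3 * e1) by rewrite ler_pM2l// ltW.
    by lra.
  rewrite lee_fin big_ord_recr/=.
  have S1 : \sum_(i < N n) H i * fine (curve_length (t i) (t i.+1) c) <=
      chain_cost (G k) (q n) (N n) + 3 * C * e1 * L.
    apply: (@le_trans _ _ (\sum_(i < N n) (G k (q n i) * mdist (q n i) (q n i.+1) +
        3 * C * e1 * mdist (q n i) (q n i.+1)))).
      apply: ler_sum => i _; rewrite -mulrDl.
      have iN := ltn_ord i; have iN' := ltnW iN.
      apply: ler_pM => //; [by apply: len0; exact: leqW|by rewrite /H iN|].
      apply: le_trans (tlen i (leqW iN)) _.
      rewrite /t iN iN' /T chain_timeS -/T.
      have := mdist_ge0 (q n i) (q n i.+1).
      by rewrite /Num.min; do 2 case: ifPn; rewrite -?leNgt; lra.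
    rewrite big_split/= lerD2l -mulr_sumr -/(chain_time (q n) (N n)).
    by apply: ler_wpM2l => //; exact: ltW.
  have S2 : H (N n) * fine (curve_length (t (N n)) (t (N n).+1) c) <= B * e1.
    rewrite /H ltnn ler_pM2l//; apply: le_trans (tlen _ (leqnn _)) _.
    rewrite /t leqnn ltnn; move: hl; rewrite -/T ltr_norml => /andP[hl1 hl2].
    by rewrite /Num.min; case: ifPn; rewrite -?leNgt; lra.
  have S3 : chain_cost (G k) (q n) (N n) <= chain_cost (G n) (q n) (N n).
    by apply: chain_cost_le => y; exact: weight_homo.
  by have := qcost n; rewrite /V c0p; lra.
have : (curve_integral g 0 l c <= V%:E)%E.
  pose gn n (s : R) := (G n (clamped_arclength 0 l c s))%:E.
  have mgn n : measurable_fun setT (gn n).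
    have mG : borel_fun (EFin \o G n) by apply/measurable_EFinP; exact: borel_weight.
    exact: (measurable_clamped_arclength rect mG).
  have nd s : nondecreasing_seq (gn ^~ s).
    by move=> n n' nn; rewrite lee_fin weight_homo.
  have cvg_gn s : (gn ^~ s) @ \oo --> limn (gn ^~ s).
    exact: ereal_nondecreasing_is_cvgn.
  rewrite curve_integralE.
  apply: (@le_trans _ _ (\int[lebesgue_measure]_(s in `[0%R, fine (curve_length 0%R l c)])
      limn (gn ^~ s))%E).
    apply: ge0_le_integral => //.
    - by move=> s _; exact: g0.
    - by apply: measurable_funTS; exact: (measurable_clamped_arclength rect mg).
    - apply: measurable_funTS; apply: (@emeasurable_fun_cvg _ _ _ setT gn) => //.
    - move=> s _ /=; apply: le_trans (gb _) _.
      by rewrite (cvg_lim _ (ereal_nondecreasing_cvgn (nd s))).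
  rewrite monotone_convergence//.
  - apply: lime_le.
      apply: ereal_nondecreasing_is_cvgn => n n' nn; apply: ge0_le_integral => //.
      - by move=> s _; rewrite lee_fin.
      - by apply: measurable_funTS; exact: mgn.
      - by apply: measurable_funTS; exact: mgn.
      - by move=> s _; exact: nd.
    by apply: nearW => n; have := cost_limit n; rewrite curve_integralE.
  - by move=> n; apply: measurable_funTS; exact: mgn.
  - by move=> n s _; rewrite lee_fin.
have := ug rect; rewrite c0p clx => /(_ Kp0 Kx) h1 h2.
have := le_trans h1 h2; rewrite lee_fin /V c0p.
have := ler_norm (u x - u p0); lra.
Qed.

End chain_inf_convergence.

(** * Majorants of small norm and compact sets of almost full measure *)

Section small_majorant.
Context d (T : measurableType d) (R : realType).
Variables (mu : {measure set T -> \bar R}) (p : R).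
Hypothesis p1 : 1 <= p.
Local Open Scope ereal_scope.

Let p0 : (0 < p)%R. Proof. exact: lt_le_trans p1. Qed.

(** The [p]-th power of the majorant is the sum of the [p]-th powers of the functions
    with value [b k] on [D k], so that its integral is a series of measures. *)
Lemma small_majorant (b : nat -> R) (D : nat -> set T) (e : R) : (0 <= e)%R ->
  (forall k, 0 <= b k)%R -> (forall k, measurable (D k)) ->
  (forall k, (b k `^ p)%R%:E * mu (D k) <= (e `^ p / (2 ^ k.+1)%:R)%R%:E) ->
  exists E : T -> \bar R, [/\ measurable_fun setT E, forall x, 0 <= E x,
    forall k x, D k x -> (b k)%:E <= E x & Lnorm mu p%:E E <= e%:E].
Proof.
move=> e0 b0 mD bD.
pose s k x := (b k `^ p)%R%:E * (\1_(D k) x)%:E : \bar R.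
have s0 k x : 0 <= s k x by rewrite mule_ge0 ?lee_fin ?powR_ge0.
have ms k : measurable_fun setT (s k).
  apply: emeasurable_funM => //; apply/measurable_EFinP.
  exact: measurable_indic.
pose S x := \sum_(k <oo) s k x.
have S0 x : 0 <= S x by apply: nneseries_ge0 => k _ _.
have mS : measurable_fun setT S.
  by apply: ge0_emeasurable_sum => k //.
exists (fun x => S x `^ p^-1); split.
- exact: (measurableT_comp (measurable_poweR _)).
- by move=> x; exact: poweR_ge0.
- move=> k x Dx.
  have -> : (b k)%:E = (b k `^ p)%R%:E `^ p^-1.
    by rewrite poweR_EFin -powRrM mulfV ?gt_eqF// powRr1.
  apply: le_poweR; first by rewrite invr_ge0 ltW.
    by rewrite lee_fin powR_ge0.
  have -> : (b k `^ p)%R%:E = s k x by rewrite /s indicE mem_set// mule1.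
  rewrite /S (@nneseriesD1 _ _ k)//.
  by rewrite leeDl// nneseries_ge0.
- apply: Lnorm_le_integral => //.
  have -> : \int[mu]_x `|S x `^ p^-1| `^ p = \int[mu]_x S x.
    apply: eq_integral => x _.
    by rewrite gee0_abs ?poweR_ge0// -poweRrM mulVf ?gt_eqF// poweRe1.
  rewrite integral_nneseries//.
  apply: (@le_trans _ _ (\sum_(k <oo) (0 + (e `^ p / (2 ^ k.+1)%:R)%R%:E))).
    apply: lee_nneseries => [k _ _|k _]; first by apply: integral_ge0.
    rewrite add0e /s ge0_integralZl_EFin ?powR_ge0//; last first.
      by apply/measurable_EFinP; exact: measurable_indic.
    by rewrite integral_indic// setIT.
  apply: le_trans (epsilon_trick _ _ _) _ => //; first exact: powR_ge0.
  by rewrite eseries0 ?add0e.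
Qed.

End small_majorant.

Section good_sets.
Context {R : realType} {X : pMetricType R}.
Variable m : {outer_measure set X -> \bar R}.
Hypothesis Xm : is_metric_measure_space m.
Variable p : R.
Hypothesis p1 : 1 <= p.
Local Open Scope ereal_scope.
Local Notation T := (caratheodory_type m).

Let p0 : (0 < p)%R. Proof. exact: lt_le_trans p1. Qed.

Lemma bounded_subset (A B : set X) : A `<=` B -> metric_bounded B -> metric_bounded A.
Proof. by move=> AB [M BM]; exists M => x y /AB Bx /AB By; exact: BM. Qed.

(** A form of the Vitali-Caratheodory theorem. The superlevel sets of [g] at the
    multiples of [delta] are enlarged to open sets, which makes the supremum of the
    weights lower semicontinuous and costs [delta] plus an excess [E] carried by sets
    of small measure. Complements of compact sets of almost full measure are added
    with arbitrarily large values: they are the penalties that keep chains close to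
    compact sets. Outside of [B], where nothing has to be integrated, the supremum is
    infinite. *)
Lemma exists_weights (B K : set X) (g : X -> \bar R) (delta e : R) :
  closed B -> metric_bounded B -> compact K -> K `<=` B ->
  borel_fun g -> (forall x, 0 <= g x) -> (0 < delta)%R -> (0 < e)%R ->
  exists (b : nat -> R) (O_ : nat -> set X) (E : X -> \bar R), [/\
    (forall k, 0 <= b k)%R /\ (exists2 k, (0 < b k)%R & O_ k = setT),
    (forall C r : R, (0 < r)%R -> exists k (K' : set X),
      [/\ compact K', K `<=` K', O_ k = ~` K' & (C < b k * r)%R]),
    (forall x, g x <= ereal_sup (range (fun n => (weight b O_ n x)%:E))),
    [/\ measurable_fun setT (E : T -> \bar R), forall x, 0 <= E x &
      Lnorm (cara_measure m) p%:E E <= e%:E] &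
    forall n x, B x -> (weight b O_ n x)%:E <= g x + delta%:E + E x].
Proof.
move=> clB bB cK KB mg g0 de0 e0.
(* The index 3 * j + i stands for a superlevel set of g if i = 0, for the complement
   of a compact set if i = 1, and for the complement of B if i = 2; the value grows
   with j. The index 0 is the whole space. *)
pose j k := (k %/ 3)%N.
pose b k := ((j k).+1%:R * delta)%R.
have b0 k : (0 <= b k)%R by rewrite mulr_ge0// ltW.
(* the measure allowed for the exceptional set of index k, given the value b k *)
pose s k := (e `^ p / (2 ^ k.+1)%:R / (1 + b k `^ p))%R.
have bp1 k : (0 < 1 + b k `^ p)%R by rewrite ltr_wpDr// powR_ge0.
have ep0 k : (0 < e `^ p / (2 ^ k.+1)%:R)%R.
  by rewrite divr_gt0 ?powR_gt0// ltr0n expn_gt0.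
have s0 k : (0 < s k)%R by rewrite divr_gt0.
have cB : m.-caratheodory B by exact: closed_caratheodory.
have mgT : measurable_fun setT (g : T -> \bar R) by exact: borel_caratheodory.
have level k : exists OD : set X * set X, [/\ open OD.1, m.-caratheodory OD.2,
    m OD.2 <= (s k)%:E, forall x, B x -> OD.1 x -> (b k)%:E <= g x + delta%:E \/ OD.2 x &
    [/\ k = 0%N -> OD.1 = setT,
      (k %% 3 = 0)%N -> forall x, B x -> ((j k)%:R * delta)%:E <= g x -> OD.1 x,
      (k %% 3 = 1)%N -> exists K', [/\ compact K', K `<=` K' & OD.1 = ~` K'] &
      (k %% 3 = 2)%N -> OD.1 = ~` B]].
  have [->|kn0] := eqVneq k 0%N.
    exists (setT, set0); split => //=.
    - exact: openT.
    - exact: caratheodory_measurable_set0.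
    - by rewrite outer_measure0 lee_fin ltW.
    - by move=> x _ _; left; rewrite /b /j div0n mul1r leeDr.
  case E3 : (k %% 3)%N => [|[|[|n]]]; last by have := ltn_pmod k (isT : 0 < 3)%N; rewrite E3.
  - pose A := B `&` [set x | ((j k)%:R * delta)%:E <= g x].
    have cA : m.-caratheodory A.
      apply: caratheodory_measurable_setI => //.
      have := @emeasurable_fun_c_infty _ T R setT g measurableT mgT ((j k)%:R * delta)%:E.
      by rewrite setTI.
    have Afin : m A < +oo.
      by apply: (bounded_finite Xm); apply: bounded_subset bB; exact: subIsetl.
    have [U [oU AU hU]] := outer_regular Xm cA Afin (s0 k).
    exists (U, U `\` A); split => //=.
    - apply: caratheodory_measurable_setD => //.
      by apply: open_caratheodory.
    - move=> x Bx Ux; have [gx|gx] := pselect (((j k)%:R * delta)%:E <= g x).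
        left; rewrite /b -natr1 mulrDl mul1r EFinD.
        exact: leeD2r.
      by right; split => // -[].
    - split => //; first by move=> k0; rewrite k0 in kn0.
      by move=> _ x Bx gx; apply: AU.
  - have [C [cC CB hC]] := inner_regular Xm cB bB (s0 k).
    exists (~` (K `|` C), B `\` (K `|` C)); split => //=.
    - rewrite openC; apply: compact_closed; last exact: compactU.
      exact: metric_hausdorff.
    - apply: caratheodory_measurable_setD => //.
      by apply: compact_caratheodory => //; exact: compactU.
    - apply: le_trans hC; apply: le_outer_measure => x [Bx KC]; split => // Cx.
      by apply: KC; right.
    - by move=> x Bx h; right.
    - split => //; first by move=> k0; rewrite k0 in kn0.
      by move=> _; exists (K `|` C); split => //; exact: compactU.
  - exists (~` B, set0); split => //=.
    - by rewrite openC.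
    - exact: caratheodory_measurable_set0.
    - by rewrite outer_measure0 lee_fin ltW.
    - by split => // k0; rewrite k0 in kn0.
have [OD ODP] := choice level.
pose O_ k := (OD k).1; pose D k := (OD k).2.
have [k|k|E [mE E0 DE NE]] := @small_majorant _ T R (cara_measure m) p p1 b D e (ltW e0) b0.
- by case: (ODP k).
- case: (ODP k) => _ _ h _ _.
  apply: (@le_trans _ _ ((b k `^ p)%:E * (s k)%:E)).
    by apply: lee_wpmul2l => //; rewrite lee_fin powR_ge0.
  rewrite -EFinM lee_fin /s mulrCA ler_piMr ?(ltW (ep0 k))//.
  by rewrite ler_pdivrMr// mul1r lerDr.
have oO k : open (O_ k) by case: (ODP k).
exists b, O_, E; split => //.
- split => //; exists 0%N; first by rewrite /b mulr_gt0 ?ltr0n.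
  by case: (ODP 0%N) => _ _ _ _ [h _ _ _]; exact: h.
- move=> C r r0; pose k := (3 * (Num.truncn (C / (delta * r))) + 1)%N.
  have jk : j k = Num.truncn (C / (delta * r)) by rewrite /j /k mulnC divnMDl// addn0.
  case: (ODP k) => _ _ _ _ [_ _ h _].
  have [|K' [cK' KK' OK']] := h _; first by rewrite /k mulnC modnMDl.
  exists k, K'; split => //; rewrite /b jk -mulrA -ltr_pdivrMr ?mulr_gt0//.
  exact: truncnS_gt.
- move=> x; have up i k : O_ k x -> (i%:R * delta <= b k)%R ->
      (i%:R * delta)%:E <= ereal_sup (range (fun n => (weight b O_ n x)%:E)).
    move=> Ox ib; have [n hn] := weight_near b (oO k) Ox.
    apply: (@le_trans _ _ (weight b O_ n x)%:E); first by rewrite lee_fin (le_trans ib).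
    by apply: ereal_sup_ubound; exists n.
  have all_oo : (forall i : nat, (i%:R * delta)%:E <= ereal_sup (range (fun n => (weight b O_ n x)%:E))) ->
      g x <= ereal_sup (range (fun n => (weight b O_ n x)%:E)).
    move=> h; suff -> : ereal_sup (range (fun n => (weight b O_ n x)%:E)) = +oo by rewrite leey.
    move: h; case: (ereal_sup _) => // [r h|h]; last by have := h 0%N.
    have := h (Num.truncn (r / delta)).+1; rewrite lee_fin -ler_pdivlMr// leNgt.
    by rewrite truncnS_gt.
  have [Bx|Bx] := pselect (B x); last first.
    apply: all_oo => i; apply: (up i (3 * i + 2)%N).
      case: (ODP (3 * i + 2)%N) => _ _ _ _ [_ _ _ h].
      by rewrite /O_ h// mulnC modnMDl.
    by rewrite /b /j mulnC divnMDl// addn0 ler_wpM2r ?(ltW de0)// ler_nat.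
  have lev i : (i%:R * delta)%:E <= g x -> O_ (3 * i)%N x.
    move=> gx; case: (ODP (3 * i)%N) => _ _ _ _ [_ h _ _]; apply: h => //.
      by rewrite mulnC modnMl.
    by rewrite /j mulKn.
  case gxE : (g x) => [r| |]; last by have := g0 x; rewrite gxE.
    have r0 : (0 <= r)%R by have := g0 x; rewrite gxE.
    have rd : (0 <= r / delta)%R by rewrite divr_ge0// ltW.
    have /andP[h1 h2] := truncn_itv rd; set i := Num.truncn _ in h1 h2.
    rewrite ler_pdivlMr// in h1; rewrite ltr_pdivrMr// in h2.
    apply: (@le_trans _ _ (i.+1%:R * delta)%:E); first by rewrite lee_fin ltW.
    apply: (up i.+1 (3 * i)%N); first by apply: lev; rewrite gxE lee_fin.
    by rewrite /b /j mulKn.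
  rewrite -gxE; apply: all_oo => i; apply: (up i (3 * i)%N); first by apply: lev; rewrite gxE leey.
  by rewrite /b /j mulKn// ler_wpM2r ?(ltW de0)// ler_nat.
- move=> n x Bx; set v := g x + delta%:E + E x.
  have v0 : 0 <= v by rewrite !adde_ge0// lee_fin ltW.
  have [->|vy] := eqVneq v +oo; first by rewrite leey.
  have vfin : v \is a fin_num by rewrite ge0_fin_numE// ltey.
  rewrite -(fineK vfin) lee_fin; apply: weight_le => //; first exact: fine_ge0.
  move=> k Ox; rewrite -lee_fin (fineK vfin).
  case: (ODP k) => _ _ _ /(_ x Bx Ox)[h|Dx] _.
    by apply: le_trans h _; rewrite leeDl.
  by apply: le_trans (DE k x Dx) _; rewrite leeDr// adde_ge0// lee_fin ltW.
Qed.

End good_sets.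

Section good_compact.
Context {R : realType} {X : pMetricType R}.
Variable m : {outer_measure set X -> \bar R}.
Hypothesis Xm : is_metric_measure_space m.
Variable p : R.
Hypothesis p1 : 1 <= p.
Local Open Scope ereal_scope.
Local Notation T := (caratheodory_type m).
Local Notation N := (Lnorm (cara_measure m) p%:E).

(** For every rational [q] the set [{v > q}] is enlarged to an open set, and the small
    excess is removed from [K]: in [K] the set [{v > q}] becomes relatively open, and
    [v] lower semicontinuous. *)
Lemma exists_good_compact (B : set X) (v : X -> R) (g : X -> \bar R) (e : R) :
  closed B -> metric_bounded B -> measurable_fun setT (v : T -> R) ->
  measurable_fun setT (g : T -> \bar R) -> (forall x, 0 <= g x) -> N g < +oo ->
  (0 < e)%R ->
  exists K, [/\ compact K, K `<=` B, m (B `\` K) <= e%:E,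
    forall x, K x -> g x < +oo &
    forall x (r : R), K x -> (0 < r)%R ->
      exists2 d, (0 < d)%R & forall y, K y -> (mdist x y < d)%R -> (v x - r < v y)%R].
Proof.
move=> clB bB mv mg g0 Ng e0; have e20 : (0 < e / 2)%R by rewrite divr_gt0.
have cB : m.-caratheodory B by exact: closed_caratheodory.
pose qq k : R := ratr (odflt 0%R (unpickle k : option rat)).
pose s k := (e / 2 / (2 ^ k.+1)%:R)%R.
have s0 k : (0 < s k)%R by rewrite divr_gt0// ltr0n expn_gt0.
pose A k := B `&` [set x | qq k < v x]%R.
have cA k : m.-caratheodory (A k).
  apply: caratheodory_measurable_setI => //.
  have := mv measurableT _ (measurable_itv `]qq k, +oo[); rewrite setTI.
  by congr (m.-caratheodory _); apply/seteqP; split => x /=; rewrite in_itv/= andbT.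
have Afin k : m (A k) < +oo.
  by apply: (bounded_finite Xm); apply: bounded_subset bB; exact: subIsetl.
have /choice[U UP] : forall k, exists U, [/\ open U, A k `<=` U & m (U `\` A k) <= (s k)%:E].
  by move=> k; exact: (outer_regular Xm (cA k) (Afin k) (s0 k)).
pose Z := \bigcup_k (U k `\` A k).
have cZ : m.-caratheodory Z.
  apply: caratheodory_measurable_bigcup => k; apply: caratheodory_measurable_setD => //.
  by apply: open_caratheodory; case: (UP k).
have mZ : m Z <= (e / 2)%:E.
  apply: le_trans (outer_measure_sigma_subadditive m _) _.
  apply: (@le_trans _ _ (\sum_(k <oo) (0 + (s k)%:E))).
    apply: lee_nneseries => [k _ _|k _]; first exact: outer_measure_ge0.
    by rewrite add0e; case: (UP k).
  apply: le_trans (epsilon_trick _ _ _) _ => //; first exact: ltW.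
  by rewrite eseries0 ?add0e.
pose Y := [set x | g x = +oo].
have cY : m.-caratheodory Y by have := mg measurableT [set +oo] (emeasurable_set1 _); rewrite setTI.
have mY : m Y = 0.
  have [Q [mQ Q0 hQ]] := @Lnorm_lty_ae_fin _ T R (cara_measure m) p p1 g mg Ng.
  apply/eqP; rewrite eq_le outer_measure_ge0 andbT -Q0.
  apply: le_outer_measure => x Yx; apply: hQ => /= /(_ I).
  by rewrite (Yx : g x = +oo).
have cB0 : m.-caratheodory (B `\` (Z `|` Y)).
  apply: caratheodory_measurable_setD => //.
  exact: caratheodory_measurable_setU.
have bB0 : metric_bounded (B `\` (Z `|` Y)) by apply: bounded_subset bB; exact: subDsetl.
have [K [cK KB0 hK]] := inner_regular Xm cB0 bB0 e20.
exists K; split => //.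
- by move=> x /KB0[].
- apply: (@le_trans _ _ (m (Z `|` Y `|` ((B `\` (Z `|` Y)) `\` K)))).
    apply: le_outer_measure => x [Bx Kx].
    by have [h|h] := pselect ((Z `|` Y) x); [left|right].
  apply: le_trans (outer_measureU2 _ _ _) _.
  rewrite (splitr e) EFinD; apply: leeD => //.
  by apply: le_trans (outer_measureU2 _ _ _) _; rewrite mY adde0.
- move=> x /KB0[_ h]; rewrite ltey; apply/eqP => gx; apply: h; right; exact: gx.
- move=> x r Kx r0.
  have : (v x - r < v x)%R by rewrite ltrBlDr ltrDl.
  move=> /rat_in_itvoo[q]; rewrite in_itv/= => /andP[q1 q2].
  have [oU AU _] := UP (pickle q).
  have qE : qq (pickle q) = ratr q by rewrite /qq pickleK.
  have Ux : U (pickle q) x by apply: AU; split; [case: (KB0 x Kx)|rewrite /= qE].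
  have : nbhs x (U (pickle q)) by exact: open_nbhs_nbhs.
  move=> /nbhs_ballP[d /= d0 hd]; exists d => // y Ky xy.
  have Uy : U (pickle q) y by apply: hd; rewrite ballEmdist.
  apply: lt_trans q1 _; rewrite -qE.
  have [_ hy] := KB0 y Ky.
  have : A (pickle q) y by apply: contrapT => nA; apply: hy; left; exists (pickle q).
  by case.
Qed.

End good_compact.

(** * Density in energy of Lipschitz functions *)

Section Lnorm_indicator.
Context d (T : measurableType d) (R : realType).
Variables (mu : {measure set T -> \bar R}) (p : R).
Hypothesis p1 : 1 <= p.
Local Open Scope ereal_scope.
Local Notation N := (Lnorm mu p%:E).

Let p0 : (0 < p)%R. Proof. exact: lt_le_trans p1. Qed.

Lemma integral_indic_poweR (c : R) (D : set T) : (0 <= c)%R -> measurable D ->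
  \int[mu]_x `|(c * \1_D x)%R%:E| `^ p = (c `^ p)%R%:E * mu D.
Proof.
move=> c0 mD; rewrite (eq_integral (fun x => (c `^ p)%R%:E * (\1_D x)%:E)).
  rewrite ge0_integralZl_EFin ?powR_ge0//.
    by rewrite integral_indic// setIT.
  by apply/measurable_EFinP; exact: measurable_indic.
move=> x _; rewrite indicE abse_EFin poweR_EFin -EFinM; congr EFin.
case: (x \in D); first by rewrite !mulr1 ger0_norm.
by rewrite !mulr0 normr0 powR0// gt_eqF.
Qed.

Lemma measurable_scaled_indic (c : R) (D : set T) : measurable D ->
  measurable_fun setT (fun x => (c * \1_D x)%R%:E).
Proof. by move=> mD; apply/measurable_EFinP; apply: measurable_funM => //; exact: measurable_indic. Qed.

Lemma Lnorm_scaled_indic_le (c e : R) (D : set T) : (0 <= c)%R -> (0 <= e)%R ->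
  measurable D -> (c `^ p)%R%:E * mu D <= (e `^ p)%R%:E ->
  N (fun x => (c * \1_D x)%R%:E) <= e%:E.
Proof. by move=> c0 e0 mD h; apply: Lnorm_le_integral; rewrite // integral_indic_poweR. Qed.

Lemma Lnorm_scaled_indic_lty (c : R) (D : set T) : (0 <= c)%R ->
  measurable D -> mu D < +oo -> N (fun x => (c * \1_D x)%R%:E) < +oo.
Proof.
move=> c0 mD Dfin; rewrite LnormE poweR_lty// integral_indic_poweR//.
by rewrite lte_mul_pinfty// lee_fin powR_ge0.
Qed.

Lemma Lnorm_add_le (a b : T -> \bar R) (x y : \bar R) :
  measurable_fun setT a -> measurable_fun setT b ->
  (forall t, 0 <= a t) -> (forall t, 0 <= b t) -> N a <= x -> N b <= y ->
  N (fun t => a t + b t) <= x + y.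
Proof. by move=> ma mb a0 b0 ax by_; apply: le_trans (ge0_minkowski _ _ _ _ _ _) _ => //; exact: leeD. Qed.

Lemma ge0_le_Lnorm (a b : T -> \bar R) :
  measurable_fun setT a -> measurable_fun setT b ->
  (forall t, 0 <= a t) -> (forall t, a t <= b t) -> N a <= N b.
Proof.
move=> ma mb a0 ab; apply: le_Lnorm => // x.
by rewrite !gee0_abs// (le_trans (a0 x)).
Qed.

Definition trunc_at (n : nat) (t : R) : R := Num.max (- n%:R)%R (Num.min n%:R t).

Lemma trunc_at_bound n t : (`|trunc_at n t| <= n%:R)%R.
Proof.
rewrite /trunc_at ler_norml le_max lexx ge_max ge_min lexx/= andbT.
have := ler0n R n; lra.
Qed.

Lemma trunc_at_le n t : (`|trunc_at n t| <= `|t|)%R.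
Proof.
rewrite /trunc_at; have := ler0n R n; have := ler_norm t; have := ler_norm (- t)%R.
rewrite normrN /Num.max /Num.min => ? ? ?.
by rewrite ler_norml; repeat case: ifPn; rewrite -?leNgt => *; apply/andP; split; lra.
Qed.

Lemma trunc_at_dist n s t : (`|trunc_at n s - trunc_at n t| <= `|s - t|)%R.
Proof.
rewrite /trunc_at; have := ler0n R n; have := ler_norm (s - t)%R; have := ler_norm (- (s - t))%R.
rewrite normrN /Num.max /Num.min => ? ? ?.
by rewrite ler_norml; repeat case: ifPn; rewrite -?leNgt => *; apply/andP; split; lra.
Qed.

Lemma trunc_at_id n t : (`|t| <= n%:R)%R -> trunc_at n t = t.
Proof.
rewrite ler_norml => /andP[h1 h2]; rewrite /trunc_at.
by rewrite min_r// max_r.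
Qed.

Lemma trunc_at_dist_le n t : (`|trunc_at n t - t| <= `|t|)%R.
Proof.
rewrite /trunc_at; have := ler0n R n; have := ler_norm t; have := ler_norm (- t)%R.
rewrite normrN /Num.max /Num.min => ? ? ?.
by rewrite ler_norml; repeat case: ifPn; rewrite -?leNgt => *; apply/andP; split; lra.
Qed.

Lemma measurable_trunc_at n (u : T -> R) : measurable_fun setT u ->
  measurable_fun setT (trunc_at n \o u).
Proof.
by move=> mu_; apply: measurable_maxr => //; apply: measurable_minr.
Qed.

Lemma Lnorm_trunc_at (u : T -> R) (e : R) : measurable_fun setT u ->
  N (EFin \o u) < +oo -> (0 < e)%R ->
  exists n, N (fun x => `|trunc_at n (u x) - u x|%R%:E) <= e%:E.
Proof.
move=> mu_ Nu e0.
have mf n : measurable_fun setT (fun x => `|trunc_at n (u x) - u x|%R).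
  by apply: measurableT_comp => //; apply: measurable_funB => //; exact: measurable_trunc_at.
have mg : measurable_fun setT (fun x => `|u x|%:E).
  by apply/measurable_EFinP; exact: measurableT_comp.
have Ng : N (fun x => `|u x|%:E) < +oo by rewrite -[X in X < _](Lnorm_abse mu) in Nu.
have f0 x : (fun n => `|trunc_at n (u x) - u x|%R) @ \oo --> 0%R.
  apply: cvg_near_cst; near=> n.
  rewrite trunc_at_id ?subrr ?normr0//.
  near: n; exists (Num.truncn `|u x|%R).+1 => // n /= hn; apply: ltW.
  by apply: lt_le_trans (truncnS_gt _) _; rewrite ler_nat.
have hfg n x : `| `|trunc_at n (u x) - u x|%R |%R%:E <= `|u x|%:E.
  by rewrite lee_fin normr_id trunc_at_dist_le.
have [n _ hn] := Lnorm_dominated_cvg p1 mf mg hfg Ng f0 e0.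
by exists n; exact: (hn n (leqnn n)).
Unshelve. all: by end_near. Qed.

End Lnorm_indicator.

Section density.
Context {R : realType} {X : pMetricType R}.
Variable m : {outer_measure set X -> \bar R}.
Hypothesis Xm : is_metric_measure_space m.
Hypothesis Xcomplete : complete_space X.
Variable p : R.
Hypothesis p1 : 1 <= p.
Local Open Scope ereal_scope.
Local Notation T := (caratheodory_type m).
Local Notation N := (Lnorm (cara_measure m) p%:E).

Lemma closed_mdist_le (x0 : X) (r : R) : closed [set x | mdist x0 x <= r]%R.
Proof.
apply: (@closed_comp _ _ (fun x => mdist x0 x : R) [set t | t <= r]%R).
  by move=> x _; exact: continuous_mdist.
exact: closed_le.
Qed.

Lemma closed_ball_caratheodory (x0 : X) (r : R) :
  m.-caratheodory [set x | mdist x0 x <= r]%R.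
Proof. by apply: (closed_caratheodory Xm); exact: closed_mdist_le. Qed.

(** The two errors made by a cutoff at distance [n + 1]: the part of [u] that is cut
    off, and the term of the Leibniz rule in which the cutoff function is
    differentiated. *)
Lemma cutoff_radius (x0 : X) (u : X -> R) (h : R) :
  measurable_fun setT (u : T -> R) -> N (EFin \o u) < +oo -> (0 < h)%R ->
  exists n, N (fun x => (`|u x| * \1_(~` [set x | mdist x0 x <= n.+1%:R]%R) x)%R%:E) <= h%:E /\
    N (fun x => (`|u x| / n.+1%:R)%R%:E) <= h%:E.
Proof.
move=> mu_ Nu h0.
have mu1 : measurable_fun setT (fun x : T => `|u x|%:E).
  by apply/measurable_EFinP; exact: measurableT_comp.
have Nu1 : N (fun x => `|u x|%:E) < +oo.
  by rewrite -[X in X < _](Lnorm_abse (cara_measure m)) in Nu.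
pose f1 k (x : T) := (`|u x| * \1_(~` [set x | mdist x0 x <= k.+1%:R]%R) x)%R.
pose f2 k (x : T) := (`|u x| / k.+1%:R)%R.
have mf1 k : measurable_fun setT (f1 k).
  apply: measurable_funM; first exact: measurableT_comp.
  by apply: measurable_indic; exact: caratheodory_measurable_setC (closed_ball_caratheodory _ _).
have mf2 k : measurable_fun setT (f2 k).
  by apply: measurable_funM => //; exact: measurableT_comp.
have d1 k x : `|f1 k x|%R%:E <= `|u x|%:E.
  rewrite lee_fin /f1 normrM normr_id indicE.
  by case: (_ \in _); rewrite ?normr1 ?mulr1// normr0 mulr0.
have d2 k x : `|f2 k x|%R%:E <= `|u x|%:E.
  rewrite lee_fin /f2 normrM normr_id ger0_norm// ler_piMr//.
  by rewrite invf_le1 ?ler1n// ltr0n.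
have c1 x : f1 ^~ x @ \oo --> 0%R.
  apply: cvg_near_cst; near=> k.
  rewrite /f1 indicE memNset ?mulr0//=; apply; near: k.
  exists (Num.truncn (mdist x0 x)) => // k /= hk; apply: ltW.
  by apply: lt_le_trans (truncnS_gt _) _; rewrite ler_nat.
have c2 x : f2 ^~ x @ \oo --> 0%R.
  rewrite -[X in _ --> X](mulr0 `|u x|%R); apply: cvgM; first exact: cvg_cst.
  exact: cvg_harmonic.
have [n [/= h1 h2]] := filter_ex (filterI (Lnorm_dominated_cvg p1 mf1 mu1 d1 Nu1 c1 h0)
  (Lnorm_dominated_cvg p1 mf2 mu1 d2 Nu1 c2 h0)).
by exists n; split; [exact: h1|exact: h2].
Unshelve. all: by end_near. Qed.

(** After a truncation, which does not increase oscillations, the approximation is the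
    cutoff of an infimal cost [f k]. On the compact set [K] it converges by
    [chain_inf_cvg_lower]; on the rest of the ball [B] it is bounded by the height of
    the truncation and the measure is small; outside of [B] the cutoff vanishes. Hence
    the weights need to be compared with [g] on [B] only. *)
Lemma density_in_energy (u : X -> R) (g : X -> \bar R) (e : R) :
  measurable_fun setT (u : T -> R) -> N (EFin \o u) < +oo ->
  borel_fun g -> (forall x, 0 <= g x) -> N g < +oo ->
  (forall a b c, rectifiable a b c -> g (c a) < +oo -> g (c b) < +oo ->
    `|u (c b) - u (c a)|%:E <= curve_integral g a b c) ->
  (0 < e)%R ->
  exists w : X -> R, [/\ is_lipschitz w, N (fun x => (w x - u x)%:E) <= e%:E &
    N (lip w) <= N g + e%:E].
Proof.
move=> mu_ Nu mg g0 Ng ug e0.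
pose h := (e / 5)%R; have h0 : (0 < h)%R by rewrite divr_gt0.
have h0' := ltW h0.
have [M hM] := Lnorm_trunc_at p1 mu_ Nu h0.
pose v := @trunc_at R M \o u.
have mv : measurable_fun setT (v : T -> R) by exact: measurable_trunc_at.
have vu x : (`|v x| <= `|u x|)%R by exact: trunc_at_le.
have vM x : (`|v x| <= M%:R)%R by exact: trunc_at_bound.
pose x0 : X := point.
have [n [hn1 hn2]] := cutoff_radius x0 mu_ Nu h0.
pose r : R := n.+1%:R; have r0 : (0 < r)%R by rewrite ltr0n.
have r1 : (1 <= r)%R by rewrite ler1n.
pose B := [set x | mdist x0 x <= 2 * r]%R.
have clB : closed B by exact: closed_mdist_le.
have bB : metric_bounded B by exact: bounded_closed_ball.
have cB : m.-caratheodory B by exact: closed_ball_caratheodory.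
have mB : m B < +oo by exact: bounded_finite.
have mBfin : m B \is a fin_num by rewrite ge0_fin_numE// outer_measure_ge0.
(* the measure of B `\` K has to compensate for the bound 2 * M on f k - v *)
have M2 : (0 < 1 + (2 * M%:R) `^ p)%R by rewrite ltr_wpDr// powR_ge0.
have hM2 : (0 < h `^ p / (1 + (2 * M%:R) `^ p))%R by rewrite divr_gt0// powR_gt0.
have mgT : measurable_fun setT (g : T -> \bar R) by exact: borel_caratheodory.
have [K [cK KB hK Kg Klsc]] := exists_good_compact Xm p1 clB bB mv mgT g0 Ng hM2.
have cKm : m.-caratheodory K by exact: compact_caratheodory.
have cBK : m.-caratheodory (B `\` K) by exact: caratheodory_measurable_setD.
(* dl is chosen for the constant dl on B to have norm at most h *)
pose dl := ((h `^ p / (1 + fine (m B))) `^ p^-1)%R.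
have mB1 : (0 < 1 + fine (m B))%R by rewrite ltr_wpDr// fine_ge0// outer_measure_ge0.
have dl0 : (0 < dl)%R by rewrite powR_gt0// divr_gt0// powR_gt0.
have [b [Os [E [[b0 bc] bpen gw [mE E0 NE] wE]]]] :=
  exists_weights Xm p1 clB bB cK KB mg g0 dl0 h0.
have vKM x : K x -> (- M%:R <= v x)%R.
  by move=> _; have := vM x; rewrite ler_norml => /andP[].
pose f k := chain_inf K v M%:R (weight b Os k) k.+1%:R^-1.
have G0 k x : (0 <= weight b Os k x)%R by exact: weight_ge0.
have kk0 k : (0 < k.+1%:R^-1 :> R)%R by rewrite invr_gt0 ltr0n.
have fl k : is_lipschitz (f k).
  by apply: chain_inf_lipschitz => //; exact: weight_bounded.
have flip k x : lip (f k) x <= (weight b Os k x)%:E.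
  apply: lip_chain_inf => //; apply: lipschitz_continuous.
  by have [C _ hC] := weight_lipschitz Os b0 k; exists C.
have fM k x : (`|f k x| <= M%:R)%R by apply: chain_inf_norm.
have fcvg x : K x -> (fun k => f k x) @ \oo --> v x.
  move=> Kx; apply/cvgrPdist_le => D D0.
  have ugv a b' c : rectifiable a b' c -> K (c a) -> K (c b') ->
      `|v (c b') - v (c a)|%:E <= curve_integral g a b' c.
    move=> rc Ka Kb; apply: le_trans (ug _ _ _ rc (Kg _ Ka) (Kg _ Kb)).
    by rewrite lee_fin trunc_at_dist.
  have [n0 hn0] := chain_inf_cvg_lower Xcomplete cK (ler0n _ _) (fun x _ => vM x) Klsc
    b0 bc (bpen (2 * M%:R)%R) mg g0 gw ugv Kx D0.
  exists n0 => // k /= /hn0 hk.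
  have hk' : (f k x <= v x)%R by apply: chain_inf_le_start.
  by rewrite ger0_norm ?subr_ge0//; move: hk; rewrite -/(f k x); lra.
have mf k : measurable_fun setT (f k : T -> R).
  by apply: borel_caratheodory => //; exact: lipschitz_borel.
have mfv k : measurable_fun setT ((fun x => `|f k x - v x|%R) : T -> R).
  by apply: measurableT_comp => //; exact: measurable_funB.
have mind (D : set X) : m.-caratheodory D -> measurable_fun setT (\1_D : T -> R).
  by move=> mD; exact: measurable_indic.
have m2 k : measurable_fun setT ((fun x => `|f k x - v x| * \1_K x)%R : T -> R).
  by apply: measurable_funM; [exact: mfv|exact: mind].
have m3 k : measurable_fun setT ((fun x => `|f k x - v x| * \1_(B `\` K) x)%R : T -> R).
  by apply: measurable_funM; [exact: mfv|exact: mind].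
have m4 : measurable_fun setT
    ((fun x => `|u x| * \1_(~` [set x | mdist x0 x <= n.+1%:R]%R) x)%R : T -> R).
  apply: measurable_funM; first exact: measurableT_comp.
  by apply: mind; exact: caratheodory_measurable_setC (closed_ball_caratheodory _ _).
have m1 : measurable_fun setT ((fun x => `|v x - u x|%R) : T -> R).
  by apply: measurableT_comp => //; exact: measurable_funB.
have [k hk] : exists k, N (fun x => (`|f k x - v x| * \1_K x)%R%:E) <= h%:E.
  have mfk k : measurable_fun setT ((fun x => `|f k x - v x| * \1_K x)%R : T -> R).
    by apply: measurable_funM; [exact: mfv|exact: mind].
  have hfg k x : `| (`|f k x - v x| * \1_K x)%R |%R%:E <= (2 * M%:R * \1_K x)%R%:E.
    rewrite lee_fin normrM normr_id [X in (_ * X <= _)%R]ger0_norm ?indicE//.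
    rewrite ler_wpM2r//; have := ler_normB (f k x) (v x).
    by have := fM k x; have := vM x; lra.
  have hc x : (fun k => `|f k x - v x| * \1_K x)%R @ \oo --> 0%R.
    rewrite indicE; have [Kx|Kx] := pselect (K x).
      rewrite mem_set//= -[X in _ --> X](mulr1 0%R); apply: cvgM; last exact: cvg_cst.
      rewrite -[X in _ --> X](normr0 R); apply: cvg_norm.
      by rewrite -(subrr (v x)); apply: cvgB; [exact: fcvg|exact: cvg_cst].
    by rewrite memNset//=; under eq_fun do rewrite mulr0; exact: cvg_cst.
  have Kfin : m K < +oo by apply: le_lt_trans mB; exact: le_outer_measure.
  have [k _ hk] := Lnorm_dominated_cvg p1 mfk
    (measurable_scaled_indic (2 * M%:R) (cKm : measurable (K : set T))) hfg
    (Lnorm_scaled_indic_lty p1 (mulr_ge0 (ler0n R 2) (ler0n R M)) (cKm : measurable (K : set T)) Kfin) hc h0.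
  by exists k; exact: (hk k (leqnn k)).
have hk2 : N (fun x => (`|f k x - v x| * \1_(B `\` K) x)%R%:E) <= h%:E.
  have M20 : (0 <= 2 * M%:R :> R)%R by rewrite mulr_ge0.
  apply: le_trans (Lnorm_scaled_indic_le p1 M20 h0' (cBK : measurable (B `\` K : set T)) _).
    apply: ge0_le_Lnorm => //.
    - by apply/measurable_EFinP; apply: measurable_funM; [exact: mfv|exact: mind].
    - exact: measurable_scaled_indic.
    - move=> x; rewrite lee_fin indicE ler_wpM2r//.
      have := ler_normB (f k x) (v x).
      by have := fM k x; have := vM x; lra.
  apply: (@le_trans _ _ ((2 * M%:R) `^ p * (h `^ p / (1 + (2 * M%:R) `^ p)))%R%:E).
    by rewrite EFinM; apply: lee_wpmul2l => //; rewrite lee_fin powR_ge0.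
  rewrite lee_fin mulrCA ler_piMr ?powR_ge0//.
  by rewrite ler_pdivrMr// mul1r lerDr.
have hdl : N (fun x => (dl * \1_B x)%R%:E) <= h%:E.
  apply: Lnorm_scaled_indic_le => //; first exact: ltW.
  have -> : cara_measure m B = (fine (m B))%:E by rewrite fineK.
  rewrite -EFinM lee_fin /dl -powRrM mulVf ?gt_eqF ?(lt_le_trans _ p1)//.
  rewrite powRr1 ?divr_ge0 ?powR_ge0 ?(ltW mB1)//.
  rewrite mulrAC ler_pdivrMr// ler_wpM2l ?powR_ge0//.
  by rewrite lerDr.
pose A1 (x : T) := `|v x - u x|%R%:E.
pose A2 (x : T) := (`|f k x - v x| * \1_K x)%R%:E.
pose A3 (x : T) := (`|f k x - v x| * \1_(B `\` K) x)%R%:E.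
pose A4 (x : T) := (`|u x| * \1_(~` [set x | mdist x0 x <= n.+1%:R]%R) x)%R%:E.
pose A5 (x : T) := (dl * \1_B x)%R%:E.
pose A6 (x : T) := (`|u x| / n.+1%:R)%R%:E.
have e1 : measurable_fun setT A1 by exact/measurable_EFinP.
have e2 : measurable_fun setT A2 by apply/measurable_EFinP; exact: m2.
have e3 : measurable_fun setT A3 by apply/measurable_EFinP; exact: m3.
have e4 : measurable_fun setT A4 by exact/measurable_EFinP.
have e5 : measurable_fun setT A5 by exact: measurable_scaled_indic.
have e6 : measurable_fun setT A6.
  by apply/measurable_EFinP; apply: measurable_funM => //; exact: measurableT_comp.
have z1 x : 0 <= A1 x by rewrite lee_fin.
have z2 x : 0 <= A2 x by rewrite lee_fin mulr_ge0.
have z3 x : 0 <= A3 x by rewrite lee_fin mulr_ge0.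
have z4 x : 0 <= A4 x by rewrite lee_fin mulr_ge0.
have z5 x : 0 <= A5 x by rewrite lee_fin mulr_ge0// ltW.
have z6 x : 0 <= A6 x by rewrite lee_fin divr_ge0.
have cutm : measurable_fun setT (cut x0 r (f k) : T -> R).
  by apply: (borel_caratheodory Xm); apply: lipschitz_borel; exact: cut_lipschitz.
exists (cut x0 r (f k)); split; first exact: cut_lipschitz.
- have s3 := Lnorm_add_le p1 e3 e4 z3 z4 hk2 hn1.
  have e34 := emeasurable_funD e3 e4.
  have z34 x := adde_ge0 (z3 x) (z4 x).
  have s2 := Lnorm_add_le p1 e2 e34 z2 z34 hk s3.
  have e234 := emeasurable_funD e2 e34.
  have z234 x := adde_ge0 (z2 x) (z34 x).
  have s1 := Lnorm_add_le p1 e1 e234 z1 z234 hM s2.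
  have e1234 := emeasurable_funD e1 e234.
  apply: (@le_trans _ _ (h%:E + (h%:E + (h%:E + h%:E)))); last first.
    by rewrite -!EFinD lee_fin /h; lra.
  apply: le_trans s1; apply: le_Lnorm => //.
    by apply/measurable_EFinP; exact: measurable_funB.
  move=> x; rewrite /A1 /A2 /A3 /A4 -!EFinD !abse_EFin lee_fin.
  have fv0 := normr_ge0 (f k x - v x)%R.
  have ch0 := cutoff_ge0 x0 r x; have ch1 := cutoff_le1 x0 r x.
  set ch := cutoff x0 r x in ch0 ch1.
  have -> : (cut x0 r (f k) x - u x = (v x - u x) + (ch * (f k x - v x) - (1 - ch) * v x))%R.
    by rewrite /cut -/ch; lra.
  rewrite [X in (_ <= X)%R]ger0_norm; last first.
    by rewrite !addr_ge0// mulr_ge0.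
  apply: le_trans (ler_normD _ _) _; rewrite lerD2l addrA.
  apply: le_trans (ler_normB _ _) _; rewrite !normrM (ger0_norm ch0).
  rewrite (@ger0_norm _ (1 - ch)%R) ?subr_ge0//.
  apply: lerD.
    rewrite !indicE; have [Bx|Bx] := pselect (B x).
      have -> : ((x \in K)%:R = 1 - (x \in B `\` K)%:R :> R)%R.
        rewrite in_setD mem_set//=; case: (x \in K) => /=; first by rewrite subr0.
        by rewrite subrr.
      rewrite mulrBr mulr1 subrK ler_piMl//.
    rewrite /ch cutoff0// ?mul0r; first by rewrite addr_ge0// mulr_ge0.
    by move: Bx => /negP; rewrite -ltNge => /ltW.
  apply: (@le_trans _ _ ((1 - ch) * `|u x|)%R); first by rewrite ler_wpM2l ?subr_ge0.
  rewrite indicE mulrC; have [dx|dx] := leP (mdist x0 x) r.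
    by rewrite /ch cutoff1// subrr mulr0 mulr_ge0.
  rewrite mem_set /=; last by apply/negP; rewrite -ltNge.
  by rewrite ler_wpM2l//= gerBl.
- have s5 := Lnorm_add_le p1 e3 e6 z3 z6 hk2 hn2.
  have e36 := emeasurable_funD e3 e6.
  have z36 x := adde_ge0 (z3 x) (z6 x).
  have s4 := Lnorm_add_le p1 e2 e36 z2 z36 hk s5.
  have e236 := emeasurable_funD e2 e36.
  have z236 x := adde_ge0 (z2 x) (z36 x).
  have s3 := Lnorm_add_le p1 mE e236 E0 z236 NE s4.
  have eE := emeasurable_funD mE e236.
  have zE x := adde_ge0 (E0 x) (z236 x).
  have s2 := Lnorm_add_le p1 e5 eE z5 zE hdl s3.
  have e5E := emeasurable_funD e5 eE.
  have z5E x := adde_ge0 (z5 x) (zE x).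
  have s1 := Lnorm_add_le p1 mgT e5E g0 z5E (lexx _) s2.
  have eall := emeasurable_funD mgT e5E.
  apply: (@le_trans _ _ (N g + (h%:E + (h%:E + (h%:E + (h%:E + h%:E)))))); last first.
    by rewrite -!EFinD leeD2l// lee_fin /h; lra.
  apply: le_trans s1; apply: ge0_le_Lnorm => //.
  + by apply: (borel_caratheodory Xm); apply: borel_lip; exact: cut_lipschitz.
  + by move=> x; exact: lip_ge0.
  move=> x; apply: le_trans (lip_cut x0 r0 (fl k) x) _.
  case: ifPn => [Bx|_]; last by rewrite adde_ge0.
  apply: (@le_trans _ _ ((g x + dl%:E + E x) + ((`|f k x - v x|)%R%:E + A6 x))).
    apply: leeD; first exact: le_trans (flip k x) (wE k x Bx).
    rewrite -EFinD lee_fin -lerBlDr.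
    have h1 : (`|f k x| <= `|f k x - v x| + `|u x|)%R.
      have := ler_normD (f k x - v x)%R (v x); rewrite subrK => h1.
      exact: le_trans h1 (lerD (lexx _) (vu x)).
    rewrite lerBlDr -ler_pdivlMr ?invr_gt0// invrK mulrDl divfK ?gt_eqF//.
    by apply: le_trans h1 _; rewrite lerD2r ler_peMr.
  have -> : A5 x = dl%:E by rewrite /A5 indicE mem_set// mulr1.
  have -> : A2 x + (A3 x + A6 x) = `|f k x - v x|%R%:E + A6 x.
    rewrite addeA; congr (_ + _); rewrite /A2 /A3 -EFinD -mulrDr !indicE in_setD (mem_set (Bx : B x)).
    by case: (x \in K) => /=; rewrite ?addr0 ?add0r mulr1.
  by rewrite !addeA.
Qed.

End density.

(** * Comparison of the relaxed functionals *)

Section chain_energy.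
Context {R : realType} {X : pMetricType R}.
Variable m : {outer_measure set X -> \bar R}.
Hypothesis Xm : is_metric_measure_space m.
Variable p : R.
Hypothesis p1 : 1 <= p.
Local Open Scope ereal_scope.
Local Notation T := (caratheodory_type m).
Local Notation N := (Lnorm (cara_measure m) p%:E).

Lemma F_chainE (u : X -> R) : F_chain m p u =
  ereal_inf [set ereal_inf [set Lpnorm m p g | g in UGeps eps u] | eps in [set eps | 0 < eps]%R].
Proof.
rewrite /F_chain lim_at_right0_inf// => s t s0 st.
apply: le_ereal_inf => _ [g [mg g0 ug] <-]; exists g => //; split => // n q qs.
by apply: ug => i iN; apply: le_trans (qs i iN) st.
Qed.

Lemma Lpnorm_ge0 (g : X -> \bar R) : 0 <= Lpnorm m p g.
Proof. exact: Lnorm_ge0. Qed.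

Lemma F_chain_ge0 (u : X -> R) : 0 <= F_chain m p u.
Proof.
rewrite F_chainE; apply: le_ereal_inf_tmp => _ [eps _ <-].
by apply: le_ereal_inf_tmp => _ [g _ <-]; exact: Lpnorm_ge0.
Qed.

Lemma F_curve_ge0 (u : X -> R) : 0 <= F_curve m p u.
Proof. by apply: le_ereal_inf_tmp => _ [g _ <-]; exact: Lpnorm_ge0. Qed.

Lemma F_AGS_lipschitz (u : X -> R) : is_lipschitz u -> F_AGS m p u = N (lip u).
Proof. by move=> ul; rewrite /F_AGS asboolT. Qed.

Lemma F_AGS_lty (u : X -> R) : F_AGS m p u < +oo -> is_lipschitz u.
Proof. by rewrite /F_AGS; case: ifPn => // /asboolP. Qed.

Lemma F_curve_le_AGS (u : X -> R) : F_curve m p u <= F_AGS m p u.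
Proof.
rewrite /F_AGS; case: ifPn => [/asboolP ul|_]; last by rewrite leey.
by apply: ereal_inf_lbound; exists (lip u) => //; exact: lip_UG.
Qed.

Lemma F_chain_lt (u : X -> R) (v : \bar R) : F_chain m p u < v ->
  exists eps g, [/\ (0 < eps)%R, UGeps eps u g & N g < v].
Proof.
rewrite F_chainE => /ereal_inf_lt[_ [eps eps0 <-]] /ereal_inf_lt[_ [g ug <-]] h.
by exists eps, g.
Qed.

Lemma F_chain_le (u : X -> R) eps g : (0 < eps)%R -> UGeps eps u g ->
  F_chain m p u <= N g.
Proof.
move=> eps0 ug; rewrite F_chainE.
apply: (@le_trans _ _ (ereal_inf [set Lpnorm m p g | g in UGeps eps u])).
  by apply: ereal_inf_lbound; exists eps.
by apply: ereal_inf_lbound; exists g.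
Qed.

(** For a Lipschitz function that vanishes far away, the slopes at the scale
    [1 / (n + 1)] are bounded by a multiple of the indicator of a ball, so they converge
    in norm to the local Lipschitz constant. *)
Lemma F_chain_cut_le (x0 : X) (r : R) (f : X -> R) (e : R) : (0 < r)%R ->
  is_lipschitz f -> (0 < e)%R ->
  F_chain m p (cut x0 r f) <= N (lip (cut x0 r f)) + e%:E.
Proof.
move=> r0 fl e0; set w := cut x0 r f.
have wl : is_lipschitz w by exact: cut_lipschitz.
have [L L0 wL] := is_lipschitz_pos wl.
pose s n x := slope_sup w x n.+1%:R^-1.
have ms n : measurable_fun setT (s n : T -> \bar R).
  apply: (borel_caratheodory Xm); apply: borel_slope_sup.
  exact: lipschitz_continuous.
have ml : measurable_fun setT (lip w : T -> \bar R).
  by apply: (borel_caratheodory Xm); exact: borel_lip.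
pose D := [set x | mdist x0 x <= 2 * r + 1]%R.
have cD : m.-caratheodory D by exact: closed_ball_caratheodory.
have Dfin : m D < +oo by apply: (bounded_finite Xm); exact: bounded_closed_ball.
pose df n x := (fine (s n x) - fine (lip w x))%R.
have mdf n : measurable_fun setT (df n : T -> R).
  by apply: measurable_funB; exact: measurableT_comp.
have lws n x : lip w x <= s n x by apply: lip_le_slope; rewrite invr_gt0 ltr0n.
have sfin n x : s n x \is a fin_num by exact: slope_sup_fin.
have lfin x : lip w x \is a fin_num by exact: lip_fin.
have dfE n x : (df n x)%:E = s n x - lip w x by rewrite EFinB !fineK.
have df0 n x : (0 <= df n x)%R by rewrite subr_ge0 fine_le.
have dfb n x : `|df n x|%R%:E <= (L * \1_D x)%R%:E.
  rewrite ger0_norm// dfE leeBlDr// -[X in X <= _]adde0; apply: (@le_trans _ _ (s n x + 0)) => //.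
  rewrite adde0 indicE; have [Dx|Dx] := pselect (D x).
    rewrite mem_set// mulr1; apply: (@le_trans _ _ L%:E); last by rewrite leeDl// lip_ge0.
    exact: slope_sup_lipschitz (ltW L0) wL.
  rewrite memNset// mulr0 add0e; apply: (@le_trans _ _ 0); last exact: lip_ge0.
  have {}Dx : (2 * r + 1 < mdist x0 x)%R by rewrite ltNge; apply/negP.
  apply: slope_sup_le => // y xy.
  have xy1 : (mdist x y < 1)%R.
    by apply: lt_le_trans xy _; rewrite invf_le1 ?ler1n// ltr0n.
  have := metric_triangle x0 y x; rewrite (metric_sym y x) => tr.
  by rewrite /w /cut !cutoff0 ?mulr0 ?subrr ?normr0 ?mul0e//; lra.
have dfc x : df ^~ x @ \oo --> 0%R.
  rewrite -(subrr (fine (lip w x))); apply: cvgB; last exact: cvg_cst.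
  exact: slope_sup_cvg.
have [n _ hn] := Lnorm_dominated_cvg p1 mdf
  (measurable_scaled_indic L (cD : measurable (D : set T))) dfb
  (Lnorm_scaled_indic_lty p1 (ltW L0) (cD : measurable (D : set T)) Dfin) dfc e0.
have {}hn := hn n (leqnn n).
have e2 : (0 < n.+1%:R^-1 / 2 :> R)%R by rewrite divr_gt0// invr_gt0 ltr0n.
apply: (@le_trans _ _ (N (s n))).
  apply: (F_chain_le e2); apply: slope_sup_UGeps; first exact: lipschitz_continuous.
  by rewrite ltr_pdivrMr// ltr_pMr ?ltr1n// invr_gt0 ltr0n.
have mdE : measurable_fun setT ((EFin \o df n) : T -> \bar R) by exact/measurable_EFinP.
have df0' x : 0 <= (EFin \o df n) x by rewrite lee_fin.
have lw0 x : 0 <= lip w x by exact: lip_ge0.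
apply: le_trans (Lnorm_add_le p1 ml mdE lw0 df0' (lexx _) hn).
apply: ge0_le_Lnorm => //.
- exact: emeasurable_funD.
- by move=> x; exact: slope_sup_ge0.
- by move=> x; rewrite /= dfE addeCA subee ?adde0.
Qed.

Lemma lip_cut_approx (v : X -> R) (e : R) : measurable_fun setT (v : T -> R) ->
  N (EFin \o v) < +oo -> is_lipschitz v -> (0 < e)%R ->
  exists (x0 : X) (r : R), [/\ (0 < r)%R, N (fun x => (cut x0 r v x - v x)%:E) <= e%:E &
    N (lip (cut x0 r v)) <= N (lip v) + e%:E].
Proof.
move=> mv Nv vl e0; pose x0 : X := point.
have [n [h1 h2]] := cutoff_radius Xm p1 x0 mv Nv e0.
have r0 : (0 < n.+1%:R :> R)%R by rewrite ltr0n.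
have mc : measurable_fun setT (cut x0 n.+1%:R v : T -> R).
  by apply: (borel_caratheodory Xm); apply: lipschitz_borel; exact: cut_lipschitz.
have ml : measurable_fun setT (lip v : T -> \bar R).
  by apply: (borel_caratheodory Xm); exact: borel_lip.
have mvn : measurable_fun setT (fun x : T => (`|v x| / n.+1%:R)%R%:E).
  by apply/measurable_EFinP; apply: measurable_funM => //; exact: measurableT_comp.
exists x0, n.+1%:R; split => //.
- apply: le_trans h1; apply: le_Lnorm => //.
  + by apply/measurable_EFinP; exact: measurable_funB.
  + apply/measurable_EFinP; apply: measurable_funM; first exact: measurableT_comp.
    by apply: measurable_indic; exact: caratheodory_measurable_setC (closed_ball_caratheodory Xm _ _).
  move=> x; rewrite !abse_EFin lee_fin normrM normr_id.
  have -> : (cut x0 n.+1%:R v x - v x = - (v x * (1 - cutoff x0 n.+1%:R x)))%R.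
    by rewrite /cut; lra.
  have c0 := cutoff_ge0 x0 n.+1%:R x; have c1 := cutoff_le1 x0 n.+1%:R x.
  rewrite normrN normrM ler_wpM2l// indicE.
  have [dx|dx] := leP (mdist x0 x) n.+1%:R; first by rewrite cutoff1// subrr normr0.
  rewrite mem_set /=; last by apply/negP; rewrite -ltNge.
  by rewrite normr1 ger0_norm ?subr_ge0// gerBl.
- have v0 x : 0 <= (`|v x| / n.+1%:R)%R%:E by rewrite lee_fin divr_ge0.
  apply: le_trans (Lnorm_add_le p1 ml mvn (lip_ge0 v) v0 (lexx _) h2).
  apply: ge0_le_Lnorm => //.
  + by apply: (borel_caratheodory Xm); apply: borel_lip; exact: cut_lipschitz.
  + exact: emeasurable_funD.
  + by move=> x; exact: lip_ge0.
  move=> x; apply: le_trans (lip_cut x0 r0 vl x) _.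
  by case: ifP => // _; rewrite adde_ge0// lip_ge0.
Qed.

End chain_energy.

Section relaxation.
Context {R : realType} {X : pMetricType R}.
Variable m : {outer_measure set X -> \bar R}.
Variable p : R.
Hypothesis p1 : (1 <= p%:E)%E.
Local Open Scope ereal_scope.
Local Notation T := (caratheodory_type m).
Local Notation N := (Lnorm (cara_measure m) p%:E).
Local Notation Lp := (LfunType (cara_measure m) p1).
Implicit Types F : (X -> R) -> \bar R.

Let p1' : (1 <= p)%R. Proof. by rewrite -lee_fin. Qed.

Lemma relaxation_lt F (u : LspaceType (cara_measure m) p1) (c : \bar R) (e : R) :
  relaxation F u < c -> (0 < e)%R ->
  exists v : Lp, N (fun x => (v x - u x)%:E) <= e%:E /\ F v < c.
Proof.
move=> /ereal_inf_lt[_ [u_ uu <-]] hc e0.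
have /fine_cvgP[ufin /cvgrPdist_lt/(_ e e0)] := uu.
move=> /(filterI ufin)[n0 _ hn0].
have : einfs (fun j => F (u_ j)) n0 < c.
  apply: le_lt_trans hc; rewrite limn_einf_lim.
  have := @cvg_einfs_sup _ (fun j => F (u_ j)) => /cvg_lim ->//.
  by apply: ereal_sup_ubound; exists n0.
move=> /ereal_inf_lt[_ [k /= n0k <-]] hk; exists (u_ k); split => //.
have [/= h1 h2] := hn0 k n0k.
rewrite sub0r normrN in h2.
rewrite /Lpnorm in h1 h2.
rewrite -(fineK h1) lee_fin; apply: ltW; apply: le_lt_trans h2.
exact: ler_norm.
Qed.

Lemma relaxation_le F (u : LspaceType (cara_measure m) p1) (c : R) :
  (forall e : R, (0 < e)%R -> exists v : Lp,
    N (fun x => (v x - u x)%:E) <= e%:E /\ F v <= c%:E + e%:E) ->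
  relaxation F u <= c%:E.
Proof.
move=> h.
have /choice[v vP] : forall n, exists v : Lp,
    N (fun x => (v x - u x)%:E) <= (n.+1%:R^-1 : R)%R%:E /\ F v <= c%:E + (n.+1%:R^-1 : R)%R%:E.
  by move=> n; apply: h; rewrite invr_gt0 ltr0n.
apply: (@le_trans _ _ (limn_einf (fun j => F (v j)))).
  apply: ereal_inf_lbound; exists v => //=.
  apply: (@squeeze_cvge _ _ _ _ (cst 0) _ (fun n => (n.+1%:R^-1 : R)%R%:E)).
  - by apply: nearW => n; rewrite Lnorm_ge0/=; case: (vP n).
  - exact: cvg_cst.
  - by apply: cvg_EFin; [exact: nearW|exact: cvg_harmonic].
rewrite limn_einf_lim (cvg_lim _ (@cvg_einfs_sup _ (fun j => F (v j))))//.
apply: ge_ereal_sup => _ [n _ <-]; apply/lee_addgt0Pr => e e0.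
pose k := maxn n (Num.truncn e^-1).
have ke : (k.+1%:R^-1 <= e)%R.
  rewrite invf_ple ?posrE ?ltr0n//; apply: ltW; apply: lt_le_trans (truncnS_gt _) _.
  by rewrite ler_nat ltnS leq_maxr.
apply: (@le_trans _ _ (F (v k))).
  by apply: ereal_inf_lbound; exists k => //=; exact: leq_maxl.
have [_ hk] := vP k; apply: le_trans hk _.
by rewrite leeD2l// lee_fin.
Qed.

(** A relaxed functional is lower semicontinuous, so it suffices to approximate the
    members [v] of a sequence that nearly realizes the other one. *)
Lemma le_relaxation F F' (u : LspaceType (cara_measure m) p1) :
  (forall (v : Lp) (e : R), (0 < e)%R -> F v < +oo -> exists w : Lp,
    N (fun x => (w x - v x)%:E) <= e%:E /\ F' w <= F v + e%:E) ->
  relaxation F' u <= relaxation F u.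
Proof.
move=> h.
have key (c : R) : relaxation F u < c%:E -> relaxation F' u <= c%:E.
  move=> hc; apply: relaxation_le => e e0.
  have e20 : (0 < e / 2)%R by rewrite divr_gt0.
  have [v [vu Fv]] := relaxation_lt hc e20.
  have [w [wv Fw]] := h v _ e20 (lt_trans Fv (ltry _)).
  exists w; split; last first.
    apply: le_trans Fw _; apply: leeD; first exact: ltW.
    by rewrite lee_fin; lra.
  have mu_ : measurable_fun setT (u : T -> R).
    exact: (measurable_funP (repr (u : {mfun_ (cara_measure m), T >-> measurableTypeR R}))).
  have m1 : measurable_fun setT ((fun x => w x - v x)%R : T -> R).
    by apply: measurable_funB; exact: measurable_funP.
  have m2 : measurable_fun setT ((fun x => v x - u x)%R : T -> R).
    by apply: measurable_funB => //; exact: measurable_funP.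
  have := minkowski_EFin (cara_measure m) m1 m2 p1'.
  rewrite (_ : EFin \o _ = (fun x => (w x - u x)%:E)); last first.
    by apply/funext => x /=; congr EFin; rewrite addrA subrK.
  move=> /le_trans; apply; rewrite [X in _ <= X%:E](splitr e) EFinD.
  exact: leeD.
move: key; case: (relaxation F u) => [c||] key.
- by apply/lee_addgt0Pr => e e0; rewrite -EFinD; apply: key; rewrite lte_fin ltrDl.
- by rewrite leey.
- move: key; case: (relaxation F' u) => [c||] key //.
  + have /key : -oo < (c - 1)%R%:E by exact: ltNyr.
    by rewrite lee_fin => ?; exfalso; lra.
  + by have /key : -oo < (0 : R)%:E by exact: ltNyr.
Qed.

End relaxation.

Theorem relaxations_eq (R : realType) (p : R) (p1 : (1 <= p%:E)%E)
    (X : pMetricType R) (m : {outer_measure set X -> \bar R})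
    (Xm : is_metric_measure_space m) (Xcomplete : complete_space X)
    (u : LspaceType (cara_measure m) p1) :
  relaxation (F_chain m p) u = relaxation (F_AGS m p) u /\
  relaxation (F_AGS m p) u = relaxation (F_curve m p) u.
Proof.
have p1' : 1 <= p by rewrite -lee_fin.
pose N := Lnorm (cara_measure m) p%:E.
have mv (v : LfunType (cara_measure m) p1) :
    measurable_fun setT (v : caratheodory_type m -> R) by exact: measurable_funP.
have Nv (v : LfunType (cara_measure m) p1) : (N (EFin \o v) < +oo)%E.
  exact: Lfunction_finite.
have in_Lp (w : X -> R) (v : LfunType (cara_measure m) p1) (e : R) : is_lipschitz w ->
    (N (fun x => (w x - v x)%:E) <= e%:E)%E ->
    exists w' : LfunType (cara_measure m) p1, (w' : X -> R) = w.
  move=> wl wv; have mw : measurable_fun setT (w : caratheodory_type m -> R).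
    by apply: (borel_caratheodory Xm); exact: lipschitz_borel.
  have wL : (w : caratheodory_type m -> R) \in Lfun (cara_measure m) p%:E.
    rewrite inE /=; apply/andP; split; first by rewrite inE.
    rewrite inE /= /finite_norm.
    have mwv : measurable_fun setT ((fun x => w x - v x)%R : caratheodory_type m -> R).
      exact: measurable_funB.
    have := minkowski_EFin (cara_measure m) mwv (mv v) p1'.
    rewrite (_ : EFin \o (_ \+ _) = EFin \o w); last first.
      by apply/funext => x /=; rewrite subrK.
    move=> /le_lt_trans; apply; rewrite lte_add_pinfty//.
    exact: le_lt_trans wv (ltry _).
  by exists (Lfun_Sub p1 wL); rewrite Lfun_valP.
have AGS_le (v : LfunType (cara_measure m) p1) (g : X -> \bar R) (c : \bar R) (e : R) :
    borel_fun g -> (forall x, 0 <= g x)%E -> (N g < c)%E -> 0 < e ->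
    (forall a b c, rectifiable a b c -> g (c a) < +oo -> g (c b) < +oo ->
      `|v (c b) - v (c a)|%:E <= curve_integral g a b c)%E ->
    exists w : LfunType (cara_measure m) p1,
      (N (fun x => (w x - v x)%:E) <= e%:E)%E /\ (F_AGS m p w <= c + e%:E)%E.
  move=> mg g0 gc e0 gv; have Ng : (N g < +oo)%E by apply: lt_le_trans gc _; rewrite leey.
  have [w [wl wv we]] := density_in_energy Xm Xcomplete p1' (mv v) (Nv v) mg g0 Ng gv e0.
  have [w' w'E] := in_Lp w v e wl wv; exists w'; rewrite w'E; split => //.
  by rewrite F_AGS_lipschitz//; apply: le_trans we _; rewrite leeD2r// ltW.
have AGS_chain : (relaxation (F_AGS m p) u <= relaxation (F_chain m p) u)%E.
  apply: le_relaxation => v e e0 Fv; have e20 : 0 < e / 2 by rewrite divr_gt0.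
  have Ffin : F_chain m p v \is a fin_num by rewrite ge0_fin_numE// F_chain_ge0.
  have [] := @F_chain_lt R X m p v (F_chain m p v + (e / 2)%:E)%E.
    by rewrite lteDl// lte_fin.
  move=> eps [g [eps0 ug Ng]]; have [mg g0 _] := ug.
  have [|w [wv Fw]] := AGS_le v g _ _ mg g0 Ng e20.
    by move=> a b c rc ga gb; exact: UGeps_curve_le ug rc ga gb.
  exists w; split; first by apply: le_trans wv _; rewrite lee_fin; lra.
  by apply: le_trans Fw _; rewrite -addeA -EFinD -splitr.
have AGS_curve : (relaxation (F_AGS m p) u <= relaxation (F_curve m p) u)%E.
  apply: le_relaxation => v e e0 Fv; have e20 : 0 < e / 2 by rewrite divr_gt0.
  have Ffin : F_curve m p v \is a fin_num by rewrite ge0_fin_numE// F_curve_ge0.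
  have : (F_curve m p v < F_curve m p v + (e / 2)%:E)%E by rewrite lteDl// lte_fin.
  move=> /ereal_inf_lt[_ [g [_ mg g0 ug] <-] Ng].
  have [|w [wv Fw]] := AGS_le v g _ _ mg g0 Ng e20.
    by move=> a b c rc _ _; exact: ug.
  exists w; split; first by apply: le_trans wv _; rewrite lee_fin; lra.
  by apply: le_trans Fw _; rewrite -addeA -EFinD -splitr.
have chain_AGS : (relaxation (F_chain m p) u <= relaxation (F_AGS m p) u)%E.
  apply: le_relaxation => v e e0 Fv; have e20 : 0 < e / 2 by rewrite divr_gt0.
  have vl := F_AGS_lty Fv.
  have [x0 [r [r0 cv ce]]] := lip_cut_approx Xm p1' (mv v) (Nv v) vl e20.
  have [w' w'E] := in_Lp _ v _ (cut_lipschitz x0 r0 vl) cv.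
  exists w'; rewrite w'E; split; first by apply: le_trans cv _; rewrite lee_fin; lra.
  rewrite F_AGS_lipschitz// (splitr e) EFinD addeA.
  apply: le_trans (F_chain_cut_le Xm p1' x0 r0 vl e20) _.
  by rewrite leeD2r.
have curve_AGS : (relaxation (F_curve m p) u <= relaxation (F_AGS m p) u)%E.
  apply: le_relaxation => v e e0 _; exists v; split.
    apply: (@le_trans _ _ (N (cst 0%E))); last first.
      by rewrite /N Lnorm0 ?lee_fin ?ltW// eqe gt_eqF// (lt_le_trans _ p1').
    by rewrite le_eqVlt; apply/orP; left; apply/eqP; apply: eq_Lnorm => x; rewrite subrr.
  by apply: le_trans (F_curve_le_AGS _ _ _) _; rewrite leeDl// lee_fin ltW.
by split; apply/eqP; rewrite eq_le ?AGS_chain ?chain_AGS ?AGS_curve ?curve_AGS.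
Qed.

Theorem theorem1p1 (R : realType) (p : R) (p1 : (1 <= p%:E)%E)
    (X : pMetricType R) (m : {outer_measure set X -> \bar R})
    (Xm : is_metric_measure_space m) (Xcomplete : complete_space X) :
  [/\ Hspace m p1 (F_chain m p) = Hspace m p1 (F_AGS m p),
      Hspace m p1 (F_AGS m p) = Hspace m p1 (F_curve m p) &
      forall u : LspaceType (cara_measure m) p1,
        Hnorm m p1 (F_chain m p) u = Hnorm m p1 (F_AGS m p) u /\
        Hnorm m p1 (F_AGS m p) u = Hnorm m p1 (F_curve m p) u].
Proof.
have E u := @relaxations_eq R p p1 X m Xm Xcomplete u.
split.
- by apply/seteqP; split => u; rewrite /Hspace /= (E u).1.
- by apply/seteqP; split => u; rewrite /Hspace /= (E u).2.
- by move=> u; rewrite /Hnorm (E u).1 (E u).2.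
Qed.
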